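(* Let $\gamma\in(0,\infty)$ and $\alpha\in(\tfrac14,\tfrac12)$, and set $$s(\gamma)=\begin{cases}0,&\gamma\in(0,2\alpha),\\ \tfrac12-\tfrac\alpha\gamma,&\gamma\in[2\alpha,1),\\ \tfrac12-\alpha,&\gamma\in[1,\tfrac1{2\alpha}),\\ \tfrac12(1-\tfrac1\gamma),&\gamma\in[\tfrac1{2\alpha},2),\\ \tfrac14,&\gamma\in[2,\infty).\end{cases}$$ For every admissible curve $\Gamma$ with Hölder exponent $\alpha$ and every $s>s(\gamma)$, $\lim_{t\to0^+}P_\gamma f(\Gamma(x,t),t)=f(x)$ for a.e. $x\in\mathbb{R}$, for all $f\in H^s(\mathbb{R})$. Conversely, there exists an admissible curve $\Gamma$ with Hölder exponent $\alpha$ such that for every $s<s(\gamma)$ there is $f\in H^s(\mathbb{R})$ for which this a.e. convergence fails.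
   Context: For $\gamma>0$, $f\in H^s(\mathbb{R})$, $\Gamma:\mathbb{R}\times[-1,1]\to\mathbb{R}$ and $t\in[0,1]$, define $$P_\gamma f(\Gamma(x,t),t)=\frac1{2\pi}\int_{\mathbb{R}}e^{i(\Gamma(x,t)\xi+t|\xi|^2)}e^{-t^\gamma|\xi|^2}\hat f(\xi)\,d\xi,$$ where $\hat f(\xi)=\int e^{-ix\xi}f(x)\,dx$. An admissible curve with Hölder exponent $\alpha\in(0,1]$ is a continuous $\Gamma:\mathbb{R}\times[-1,1]\to\mathbb{R}$ with $\Gamma(x,0)=x$, bilipschitz in $x$: $C_1|x-x'|\le|\Gamma(x,t)-\Gamma(x',t)|\le C_2|x-x'|$ for all $t\in[-1,1]$, $x,x'\in\mathbb{R}$, and $\alpha$-Hölder in $t$: $|\Gamma(x,t)-\Gamma(x,t')|\le C_3|t-t'|^\alpha$ for all $x\in\mathbb{R}$, $t,t'\in[-1,1]$, with constants $C_1,C_2,C_3>0$.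
   Formalization: The converse is stated for 0 ≤ s < s(γ): for s < 0 an element of H^s need not be a function and f(x) is undefined. Where s(γ) > 0, negative s follows from s = 0 as L² ⊂ H^s; where s(γ) = 0 the converse is empty. *)

(* Defs.v *)
(* Complex-valued functions R -> C are represented
   by their real and imaginary parts (two functions R -> R). *)
From HB Require Import structures.
From mathcomp Require Import all_boot all_order all_algebra.
From mathcomp Require Import all_classical all_reals all_analysis.
Set Implicit Arguments. Unset Strict Implicit. Unset Printing Implicit Defensive.
Import Order.TTheory GRing.Theory Num.Theory.
Import numFieldNormedType.Exports.
Local Open Scope classical_set_scope.
Local Open Scope ring_scope.

Section Defs.
Variable R : realType.
Local Notation mu := (@lebesgue_measure R).

Definition L2 (fre fim : R -> R) : Prop :=
  measurable_fun setT fre /\ measurable_fun setT fim /\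
  mu.-integrable setT (fun x => (fre x ^+ 2 + fim x ^+ 2)%:E).

(* truncated Fourier transform  \int_{-N}^{N} e^{-i x xi} f(x) dx *)
Definition FT_trunc_re (fre fim : R -> R) (N : nat) (xi : R) : R :=
  Rintegral mu `[- (N%:R), N%:R]
    (fun x => cos (x * xi) * fre x + sin (x * xi) * fim x).
Definition FT_trunc_im (fre fim : R -> R) (N : nat) (xi : R) : R :=
  Rintegral mu `[- (N%:R), N%:R]
    (fun x => cos (x * xi) * fim x - sin (x * xi) * fre x).

(* g = gre + i gim is the (L^2 / Plancherel) Fourier transform of f,
   \hat f(xi) = \int e^{-i x xi} f(x) dx, i.e. the L^2-limit of the
   truncated integrals. *)
Definition is_fourier (fre fim gre gim : R -> R) : Prop :=
  L2 fre fim /\ L2 gre gim /\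
  (fun N : nat => (\int[mu]_xi
      (((FT_trunc_re fre fim N xi - gre xi) ^+ 2
       + (FT_trunc_im fre fim N xi - gim xi) ^+ 2)%:E))%E)
    @ \oo --> 0%E.

Definition in_Hs (s : R) (fre fim gre gim : R -> R) : Prop :=
  is_fourier fre fim gre gim /\
  measurable_fun setT (fun xi : R => (1 + xi ^+ 2) `^ s) /\
  mu.-integrable setT
    (fun xi => ((gre xi ^+ 2 + gim xi ^+ 2) * (1 + xi ^+ 2) `^ s)%:E).

(* P_gamma f (y, t) = 1/(2 pi) \int e^{i (y xi + t xi^2)} e^{-t^gamma xi^2} \hat f(xi) dxi *)
Definition P_re (gamma : R) (gre gim : R -> R) (y t : R) : R :=
  (2 * pi)^-1 * Rintegral mu setT (fun xi =>
    expR (- (t `^ gamma) * xi ^+ 2) *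
    (cos (y * xi + t * xi ^+ 2) * gre xi - sin (y * xi + t * xi ^+ 2) * gim xi)).
Definition P_im (gamma : R) (gre gim : R -> R) (y t : R) : R :=
  (2 * pi)^-1 * Rintegral mu setT (fun xi =>
    expR (- (t `^ gamma) * xi ^+ 2) *
    (cos (y * xi + t * xi ^+ 2) * gim xi + sin (y * xi + t * xi ^+ 2) * gre xi)).

Definition admissible (alpha : R) (Gam : R -> R -> R) : Prop :=
  {within [set p : R * R | -1 <= p.2 <= 1], continuous (fun p : R * R => Gam p.1 p.2)} /\
  (forall x, Gam x 0 = x) /\
  (exists C1 C2 C3 : R, 0 < C1 /\ 0 < C2 /\ 0 < C3 /\
    (forall t x x', -1 <= t <= 1 ->
        C1 * `|x - x'| <= `|Gam x t - Gam x' t| <= C2 * `|x - x'|) /\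
    (forall x t t', -1 <= t <= 1 -> -1 <= t' <= 1 ->
        `|Gam x t - Gam x t'| <= C3 * `|t - t'| `^ alpha)).

Definition ae_conv (gamma : R) (Gam : R -> R -> R) (fre fim gre gim : R -> R) : Prop :=
  {ae mu, forall x,
     (P_re gamma gre gim (Gam x t) t @[t --> 0^'+] --> fre x) /\
     (P_im gamma gre gim (Gam x t) t @[t --> 0^'+] --> fim x)}.

Definition s_crit (alpha gamma : R) : R :=
  if gamma < 2 * alpha then 0
  else if gamma < 1 then 2^-1 - alpha / gamma
  else if gamma < (2 * alpha)^-1 then 2^-1 - alpha
  else if gamma < 2 then 2^-1 * (1 - gamma^-1)
  else 4^-1.

End Defs.

(* Main.v *)
Require Import Defs.
From HB Require Import structures.
From mathcomp Require Import all_boot all_order all_algebra.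
From mathcomp Require Import all_classical all_reals all_analysis.
From mathcomp Require Import measurable_realfun.
From mathcomp Require Import ring lra.
Set Implicit Arguments. Unset Strict Implicit. Unset Printing Implicit Defensive.
Import Order.TTheory GRing.Theory Num.Theory.
Import numFieldNormedType.Exports.
Local Open Scope classical_set_scope.
Local Open Scope ring_scope.

(* Convergence. Cut the frequencies dyadically. For a piece at frequency at most
   lambda, linearise the maximal function by a measurable choice of times T(x) and
   apply the TT* method: after inserting a Gaussian factor, the kernel is
   K = int e^(-a xi^2 + i (y xi + tau xi^2)) dxi, with
   a = T(x)^gamma + T(x')^gamma + lambda^-2, tau = T(x) - T(x'), and y the difference
   of the two curve points; here
   |K|^2 <= pi (a^2 + tau^2)^(-1/2) e^(- y^2 a / (2 (a^2 + tau^2))).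
   As |y| >= C1 |x - x'| - C3 |tau|^alpha, either |tau|^alpha or |y| controls |x - x'|,
   so that |K| <= C lambda^(2 sigma) (|x - x'|^-p + |x - x'|^-theta) with p, theta < 1 as
   soon as sigma > s(gamma), and Schur's test bounds the maximal function by
   lambda^sigma in L^2. Summing the pieces, the sum of their suprema over t is finite
   a.e.; hence the limit at t = 0 exists, and it is identified by integrating over
   intervals.

   Divergence. On N frequency intervals of bounded length in arithmetic progression
   with step 2 pi / rho, the phase at a suitable small time t(x) is constant up to 1/2
   modulo 2 pi: for the curve x - |t|^alpha take t with x - t^alpha in rho Z; for the
   vertical line start the progression at mu and take t with x + 2 t mu in rho Z. If
   s < s(gamma), then rho = N^-kappa (and mu = N^m) can be chosen so that the damping
   is harmless while the H^s norm is small compared with the L^1 norm. A lacunary sum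
   of such pieces is unbounded along the curve at every x in [1, 2]. *)

(** * Integrable real functions *)

(** The threshold is the maximum of 0, of 1/2 - alpha / min(gamma, 1), and of min(1/4, (1 -
    1/gamma)/2). The second term is the condition p < 1: when |x - x'| is at most a multiple of
    |tau|^alpha, damping and dispersion together only give (a^2 + tau^2)^(1/2) >= |tau|^min(gamma,
    1). The third comes from the other regime, where e^(-u) is replaced by u^(-theta) with theta
    free in [1/2, 1): theta close to 1 is best for gamma < 2, theta = 1/2 for gamma >= 2. Since
    alpha > 1/4, the second term stays below 1/4. The two counterexamples realise these two terms
    separately, so the curve is chosen from gamma alone, before s is given.

    The Gaussian factor makes every double integral absolutely convergent. With all times equal to 0
    the same argument yields the Plancherel inequality, and this in turn gives the size of K at y =
    0, so no complex Gaussian has to be evaluated.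

    At t = 0 the frequency integral of an L^2 function need not converge, so the limit can only be
    identified through frequency cut-offs. The counterexamples are built on the frequency side, so f
    must be recovered from its transform; step functions suffice. *)

Section Toolkit.
Variable R : realType.
Local Notation mu := (@lebesgue_measure R).
Implicit Types f g h : R -> R.

Definition L1 f := mu.-integrable setT (EFin \o f).

Lemma L1_meas f : L1 f -> measurable_fun setT f.
Proof. by move=> /integrableP[/measurable_EFinP]. Qed.

Lemma L1_le f g : measurable_fun setT f -> (forall x, `|f x| <= g x) -> L1 g -> L1 f.
Proof.
move=> mf fg ig; apply: (@le_integrable _ _ _ mu setT measurableT _ (EFin \o g)) => //.
  exact/measurable_EFinP.
move=> x _ /=; rewrite lee_fin; apply: (le_trans (fg x)); exact: ler_norm.
Qed.

Lemma L1D f g : L1 f -> L1 g -> L1 (fun x => f x + g x).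
Proof. by move=> lf lg; exact: (integrableD measurableT lf lg). Qed.

Lemma L1N f : L1 f -> L1 (fun x => - f x).
Proof. by move=> lf; exact: (integrableN lf). Qed.

Lemma L1B f g : L1 f -> L1 g -> L1 (fun x => f x - g x).
Proof. by move=> lf lg; apply: L1D => //; exact: L1N. Qed.

Lemma L1Z k f : L1 f -> L1 (fun x => k * f x).
Proof. by move=> lf; exact: (integrableZl measurableT k lf). Qed.

Lemma L1Zr k f : L1 f -> L1 (fun x => f x * k).
Proof.
move=> /(L1Z k); rewrite /L1; congr (mu.-integrable _ _).
by apply/funext => x /=; rewrite mulrC.
Qed.

Lemma L1_norm f : L1 f -> L1 (fun x => `|f x|).
Proof. by move=> lf; exact: (integrable_norm lf). Qed.

Lemma L1_0 : L1 (fun=> 0).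
Proof. exact: (@integrable0 _ _ _ mu setT). Qed.

Lemma L1_eq f g : f =1 g -> L1 f -> L1 g.
Proof. by move=> /funext ->. Qed.

Lemma iD f g : L1 f -> L1 g -> \int[mu]_x (f x + g x) = \int[mu]_x f x + \int[mu]_x g x.
Proof. by move=> lf lg; exact: RintegralD. Qed.

Lemma iB f g : L1 f -> L1 g -> \int[mu]_x (f x - g x) = \int[mu]_x f x - \int[mu]_x g x.
Proof. by move=> lf lg; exact: RintegralB. Qed.

Lemma iZ k f : L1 f -> \int[mu]_x (k * f x) = k * \int[mu]_x f x.
Proof. by move=> lf; exact: RintegralZl. Qed.

Lemma iZr k f : L1 f -> \int[mu]_x (f x * k) = \int[mu]_x f x * k.
Proof. by move=> lf; exact: RintegralZr. Qed.

Lemma iN f : L1 f -> \int[mu]_x (- f x) = - \int[mu]_x f x.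
Proof.
move=> lf; rewrite -mulN1r -iZ//; congr Rintegral.
by apply/funext => x; rewrite mulN1r.
Qed.

Lemma i_eq f g : f =1 g -> \int[mu]_x f x = \int[mu]_x g x.
Proof. by move=> /funext ->. Qed.

Lemma i_ge0 f : (forall x, 0 <= f x) -> 0 <= \int[mu]_x f x.
Proof. by move=> f0; exact: Rintegral_ge0. Qed.

Lemma i_le f g : L1 f -> L1 g -> (forall x, f x <= g x) -> \int[mu]_x f x <= \int[mu]_x g x.
Proof. by move=> lf lg fg; apply: le_Rintegral => // x _; exact: fg. Qed.

Lemma i_norm f : L1 f -> `|\int[mu]_x f x| <= \int[mu]_x `|f x|.
Proof. by move=> lf; exact: le_normr_Rintegral. Qed.

Lemma i_norm_le f g : L1 f -> L1 g -> (forall x, `|f x| <= g x) ->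
  `|\int[mu]_x f x| <= \int[mu]_x g x.
Proof.
by move=> lf lg fg; apply: (le_trans (i_norm lf)); apply: i_le => //; exact: L1_norm.
Qed.

Lemma i_fin f : L1 f -> (\int[mu]_x (f x)%:E)%E = (\int[mu]_x f x)%:E.
Proof. by move=> lf; rewrite /Rintegral fineK//; exact: integrable_fin_num. Qed.

Lemma L1_of_le f (M : R) : measurable_fun setT f -> (forall x, 0 <= f x) ->
  (\int[mu]_x (f x)%:E <= M%:E)%E -> L1 f /\ \int[mu]_x f x <= M.
Proof.
move=> mf f0 fM.
have lf : L1 f.
  apply/integrableP; split; first exact/measurable_EFinP.
  under eq_integral do rewrite /= ger0_norm//.
  by apply: (le_lt_trans fM); rewrite ltry.
by split => //; rewrite -lee_fin -i_fin.
Qed.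

Lemma dct (f_ : nat -> R -> R) f g : (forall n, measurable_fun setT (f_ n)) ->
  (forall x, f_ n x @[n --> \oo] --> f x) -> L1 g ->
  (forall n x, `|f_ n x| <= g x) ->
  L1 f /\ \int[mu]_x f_ n x @[n --> \oo] --> \int[mu]_x f x.
Proof.
move=> mf cf lg fg.
have mf' : measurable_fun setT f.
  by apply: (measurable_fun_cvg mf) => x _; exact: cf.
have lf : L1 f.
  apply: (L1_le mf' _ lg) => x.
  by apply: (cvgr_to_le (cvg_norm (cf x))); near=> n.
split => //.
have lf_ n : L1 (f_ n) by apply: L1_le lg.
have : (\int[mu]_x (f_ n x)%:E)%E @[n --> \oo] --> (\int[mu]_x (f x)%:E)%E.
  apply: (@dominated_cvg _ _ _ mu setT measurableT (fun n x => (f_ n x)%:E) _ (EFin \o g)) => //=.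
  - by move=> n; apply/measurable_EFinP; exact: mf.
  - by move=> x _; apply: cvg_EFin; [exact: nearW|exact: cf].
  - by move=> n x _; rewrite lee_fin; exact: fg.
by rewrite (i_fin lf) => /fine_cvg.
Unshelve. all: by end_near. Qed.

Lemma fatou_real (f_ : nat -> R -> R) f (M : R) : (forall n, L1 (f_ n)) ->
  (forall n x, 0 <= f_ n x) -> (forall x, f_ n x @[n --> \oo] --> f x) ->
  (forall n, \int[mu]_x f_ n x <= M) ->
  L1 f /\ \int[mu]_x f x <= M.
Proof.
move=> lf f0 cf fM.
apply: L1_of_le.
- apply: (measurable_fun_cvg (fun n => L1_meas (lf n))) => x _; exact: cf.
- move=> x; by apply: (cvgr_to_ge (cf x)); near=> n.
have -> : (\int[mu]_x (f x)%:E)%E = (\int[mu]_x limn_einf (fun n => (f_ n x)%:E))%E.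
  apply: eq_integral => x _; apply/esym.
  rewrite limn_einf_lim; apply: cvg_lim => //.
  by apply: cvg_einfs; apply: cvg_EFin; [exact: nearW|exact: cf].
apply: (le_trans (fatou mu measurableT _ _)).
- by move=> n; apply/measurable_EFinP; exact: L1_meas.
- by move=> n x _; rewrite lee_fin.
rewrite limn_einf_lim; apply: lime_le; first exact: is_cvg_einfs.
near=> n; apply: ereal_inf_le => /=.
exists (\int[mu]_x (f_ n x)%:E)%E; last by rewrite i_fin// lee_fin.
by exists n => /=.
Unshelve. all: by end_near. Qed.

(** A majorant in product form gives joint integrability at once; all double integrals below have
    one. *)
Lemma fubini_dom0 (u v : R -> R) (F : R * R -> R) : measurable_fun setT F ->
  L1 u -> L1 v -> (forall x y, `|F (x, y)| <= u x * v y) ->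
  [/\ forall x, L1 (fun y => F (x, y)), forall y, L1 (fun x => F (x, y)),
      L1 (fun x => \int[mu]_y F (x, y)) &
      \int[mu]_x \int[mu]_y F (x, y) = \int[mu]_y \int[mu]_x F (x, y)].
Proof.
move=> mF lu lv Fuv.
have l1 x : L1 (fun y => F (x, y)).
  apply: (L1_le _ (Fuv x)); first exact: measurableT_comp.
  exact: L1Z.
have l2 y : L1 (fun x => F (x, y)).
  apply: (L1_le _ (Fuv ^~ y)); first exact: measurableT_comp.
  exact: L1Zr.
have imF : (mu \x mu)%E.-integrable setT (EFin \o F).
  apply/integrable12ltyP; first exact/measurable_EFinP.
  apply: (@le_lt_trans _ _ (\int[mu]_x (u x * \int[mu]_y v y)%:E)%E).
    apply: ge0_le_integral => //.
    - by move=> x _; exact: integral_ge0.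
    - apply: (@measurable_fun_fubini_tonelli_F _ _ _ _ _ mu (fun z => `|(F z)%:E|)%E) => //.
      by apply: measurableT_comp => //; exact/measurable_EFinP.
    - apply/measurable_EFinP; apply: measurable_funM => //; exact: L1_meas.
    - move=> x _; rewrite -iZ// -i_fin; last exact: L1Z.
      apply: ge0_le_integral => //.
      + by apply: measurableT_comp => //; apply/measurable_EFinP; exact: L1_meas.
      + by apply/measurable_EFinP; apply: measurable_funM => //; exact: L1_meas.
      + by move=> y _; rewrite lee_fin.
  rewrite i_fin ?ltry//; exact: L1Zr.
have e1 : (fun x => \int[mu]_y (F (x, y))%:E)%E = EFin \o (fun x => \int[mu]_y F (x, y)).
  by apply/funext => x /=; rewrite i_fin.
have e2 : (fun y => \int[mu]_x (F (x, y))%:E)%E = EFin \o (fun y => \int[mu]_x F (x, y)).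
  by apply/funext => x /=; rewrite i_fin.
split; [exact: l1|exact: l2| |].
- by have := integrable_fubini_F imF; rewrite /fubini_F /= e1.
- have := Fubini imF; rewrite /= e1 e2 => h.
  exact: (congr1 fine h).
Qed.

Lemma fubini_dom (u v : R -> R) (F : R * R -> R) : measurable_fun setT F ->
  L1 u -> L1 v -> (forall x y, `|F (x, y)| <= u x * v y) ->
  [/\ forall x, L1 (fun y => F (x, y)), forall y, L1 (fun x => F (x, y)),
      L1 (fun x => \int[mu]_y F (x, y)), L1 (fun y => \int[mu]_x F (x, y)) &
      \int[mu]_x \int[mu]_y F (x, y) = \int[mu]_y \int[mu]_x F (x, y)].
Proof.
move=> mF lu lv Fuv; have [l1 l2 l3 e] := fubini_dom0 mF lu lv Fuv; split => //.
have [||//] := fubini_dom0 (F := fun p => F (p.2, p.1)) _ lv lu.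
- exact: (measurableT_comp mF (measurable_fun_pair measurable_snd measurable_fst)).
- by move=> x y; rewrite mulrC; exact: Fuv.
Qed.

End Toolkit.

(** * Measurability and differentiation rules *)

Section Measurability.
Context d (T : measurableType d) (R : realType).
Implicit Types f g : T -> R.

Lemma m_cst (c : R) : measurable_fun setT (fun _ : T => c).
Proof. exact: measurable_cst. Qed.
Lemma m_mul f g : measurable_fun setT f -> measurable_fun setT g -> measurable_fun setT (fun x => f x * g x).
Proof. exact: measurable_funM. Qed.
Lemma m_add f g : measurable_fun setT f -> measurable_fun setT g -> measurable_fun setT (fun x => f x + g x).
Proof. exact: measurable_funD. Qed.
Lemma m_opp f : measurable_fun setT f -> measurable_fun setT (fun x => - f x).
Proof. by move=> mf; exact: measurableT_comp. Qed.
Lemma m_expR f : measurable_fun setT f -> measurable_fun setT (fun x => expR (f x)).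
Proof. by move=> mf; exact: measurableT_comp. Qed.
Lemma m_cos f : measurable_fun setT f -> measurable_fun setT (fun x => cos (f x)).
Proof.
move=> mf; apply: measurableT_comp => //; apply: continuous_measurable_fun.
exact: continuous_cos.
Qed.
Lemma m_sin f : measurable_fun setT f -> measurable_fun setT (fun x => sin (f x)).
Proof.
move=> mf; apply: measurableT_comp => //; apply: continuous_measurable_fun.
exact: continuous_sin.
Qed.
Lemma m_norm f : measurable_fun setT f -> measurable_fun setT (fun x => `|f x|).
Proof. by move=> mf; exact: measurableT_comp. Qed.
Lemma m_sqr f : measurable_fun setT f -> measurable_fun setT (fun x => f x ^+ 2).
Proof. by move=> mf; under eq_fun do rewrite expr2; exact: m_mul. Qed.
Lemma m_powR (p : R) f : measurable_fun setT f -> measurable_fun setT (fun x => f x `^ p).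
Proof. by move=> mf; exact: (measurableT_comp (measurable_powR p)). Qed.
Lemma m_indic (A : set T) : measurable A -> measurable_fun setT (\1_A : T -> R).
Proof. by move=> mA; exact: measurable_indic. Qed.
End Measurability.

Lemma m_fst (R : realType) (f : R -> R) : measurable_fun setT f ->
  measurable_fun setT (fun p : R * R => f p.1).
Proof. by move=> mf; exact: (measurableT_comp mf measurable_fst). Qed.
Lemma m_snd (R : realType) (f : R -> R) : measurable_fun setT f ->
  measurable_fun setT (fun p : R * R => f p.2).
Proof. by move=> mf; exact: (measurableT_comp mf measurable_snd). Qed.

Ltac mf1 := lazymatch goal with
  | |- measurable_fun _ (fun _ => ?c) => exact: m_cst
  | |- measurable_fun _ (fun x => x) => exact: measurable_id
  | |- measurable_fun _ (fun x => x.1) => exact: measurable_fst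
  | |- measurable_fun _ (fun x => x.2) => exact: measurable_snd
  | |- measurable_fun _ (fun x => GRing.mul _ _) => apply: m_mul
  | |- measurable_fun _ (fun x => GRing.add _ _) => apply: m_add
  | |- measurable_fun _ (fun x => GRing.opp _) => apply: m_opp
  | |- measurable_fun _ (fun x => GRing.exp _ 2) => apply: m_sqr
  | |- measurable_fun _ (fun x => expR _) => apply: m_expR
  | |- measurable_fun _ (fun x => cos _) => apply: m_cos
  | |- measurable_fun _ (fun x => sin _) => apply: m_sin
  | |- measurable_fun _ (fun x => Num.norm _) => apply: m_norm
  | |- measurable_fun _ (fun x => powR _ _) => apply: m_powR
  | |- measurable_fun _ (@GRing.opp _) => first [exact: (m_opp (@measurable_id _ _ setT)) | exact: (m_opp measurable_id)]
  | |- measurable_fun _ snd => exact: measurable_snd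
  | |- measurable_fun _ fst => exact: measurable_fst
  | |- measurable_fun _ (fun x => ?f x.1) => apply: m_fst
  | |- measurable_fun _ (fun x => ?f x.2) => apply: m_snd
  | _ => assumption
  end.
Ltac mf := repeat mf1.

Section Calc.
Variable R : realType.
Implicit Types f g : R -> R.

(* [is_derive] is a class; the wrapper keeps instance resolution from interfering. *)
Definition isD f (x df : R) := is_derive x (1:R) f df.

Lemma eq_d f (x a b : R) : isD f x a -> a = b -> isD f x b.
Proof. by move=> h <-. Qed.
Lemma d_mul f g (x df dg : R) : isD f x df -> isD g x dg ->
  isD (fun z => f z * g z) x (df * g x + f x * dg).
Proof.
move=> hf hg; apply: (eq_d (is_deriveM hf hg)).
by rewrite /GRing.scale /= addrC (mulrC df).
Qed.
Lemma d_add f g (x df dg : R) : isD f x df -> isD g x dg ->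
  isD (fun z => f z + g z) x (df + dg).
Proof. by move=> hf hg; have := is_deriveD hf hg. Qed.
Lemma d_opp f (x df : R) : isD f x df -> isD (fun z => - f z) x (- df).
Proof. by move=> hf; have := is_deriveN hf. Qed.
Lemma d_cst (c x : R) : isD (fun=> c) x 0.
Proof. exact: is_derive_cst. Qed.
Lemma d_id (x : R) : isD (fun z : R => z) x 1.
Proof. exact: is_derive_id. Qed.
Lemma d_expR f (x df : R) : isD f x df -> isD (fun z => expR (f z)) x (expR (f x) * df).
Proof. by move=> hf; have := is_derive1_comp (is_derive_expR (f x)) hf. Qed.
Lemma d_cos f (x df : R) : isD f x df -> isD (fun z => cos (f z)) x (- sin (f x) * df).
Proof. by move=> hf; have := is_derive1_comp (is_derive_cos (f x)) hf. Qed.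
Lemma d_sin f (x df : R) : isD f x df -> isD (fun z => sin (f z)) x (cos (f x) * df).
Proof. by move=> hf; have := is_derive1_comp (is_derive_sin (f x)) hf. Qed.
Lemma d_sqr f (x df : R) : isD f x df -> isD (fun z => f z ^+ 2) x (2 * f x * df).
Proof.
move=> hf; have := d_mul hf hf; under eq_fun do rewrite -expr2.
by move=> /eq_d; apply; ring.
Qed.
Lemma d_cont f (df : R -> R) : (forall x, isD f x (df x)) -> continuous f.
Proof.
move=> hf x; apply: differentiable_continuous; apply/derivable1_diffP.
by case: (hf x).
Qed.
End Calc.

Ltac dv := repeat first [ apply: d_cst | apply: d_id | apply: d_sqr | apply: d_mul | apply: d_add | apply: d_opp | apply: d_expR
  | apply: d_cos | apply: d_sin ].

(** * Integration over the whole line *)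

Section Line.
Variable R : realType.
Local Notation mu := (@lebesgue_measure R).
Implicit Types f g : R -> R.

Lemma i_set (D : set R) f : \int[mu]_(x in D) f x = \int[mu]_x (\1_D x * f x).
Proof.
rewrite Rintegral_mkcond; apply: i_eq => x; rewrite patchE indicE.
by case: (x \in D); rewrite ?mul1r ?mul0r.
Qed.

Lemma indic_le1 (D : set R) (x : R) : (0:R) <= \1_D x <= (1:R).
Proof. by rewrite indicE; case: (x \in D); rewrite ?lexx ?ler01. Qed.

Lemma L1_indic (D : set R) f : measurable D -> L1 f -> L1 (fun x => \1_D x * f x).
Proof.
move=> mD lf; apply: (L1_le (g := fun x => `|f x|)); last exact: L1_norm.
- by apply: m_mul; [exact: m_indic|exact: L1_meas].
- move=> x; rewrite normrM -[leRHS]mul1r ler_wpM2r//.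
  by have /andP[h0 h1] := indic_le1 D x; rewrite ger0_norm.
Qed.

Lemma indic_trunc_cvg (x : R) : \1_(`[- n%:R, n%:R]%classic) x @[n --> \oo] --> (1 : R).
Proof.
apply: cvg_near_cst; near=> n; apply/eqP; rewrite indicE mem_set//= in_itv/=.
rewrite -ler_norml; near: n; exact: nbhs_infty_ger.
Unshelve. all: by end_near. Qed.

Lemma i_trunc f : L1 f ->
  \int[mu]_(x in `[- n%:R, n%:R]) f x @[n --> \oo] --> \int[mu]_x f x.
Proof.
move=> lf; under eq_fun do rewrite i_set.
have [||||_] := @dct R (fun n x => \1_(`[- n%:R, n%:R]%classic) x * f x) f (fun x => `|f x|) => //.
- by move=> n; apply: m_mul; [exact: m_indic|exact: L1_meas].
- move=> x; rewrite -[X in _ --> X]mul1r; apply: cvgM; last exact: cvg_cst.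
  exact: indic_trunc_cvg.
- exact: L1_norm.
- move=> n x; rewrite normrM -[leRHS]mul1r ler_wpM2r//.
  by have /andP[h0 h1] := indic_le1 `[- n%:R, n%:R]%classic x; rewrite ger0_norm.
Qed.

Lemma ftc_R (F f : R -> R) (a b : R) : a <= b -> (forall x, isD F x (f x)) ->
  continuous f -> \int[mu]_(x in `[a, b]) f x = F b - F a.
Proof.
rewrite le_eqVlt => /predU1P[<- _ _|ab dF cf].
  by rewrite set_itv1 Rintegral_set1 subrr.
have cF := d_cont dF.
rewrite /Rintegral (@continuous_FTC2 _ f F)//.
- exact: continuous_subspaceT.
- split.
  + by move=> x _; case: (dF x).
  + by apply: cvg_at_right_filter; exact: cF.
  + by apply: cvg_at_left_filter; exact: cF.
- by move=> x _; rewrite derive1E; have := dF x => /@derive_val.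
Qed.

Lemma ibp_line (F f : R -> R) : (forall x, isD F x (f x)) -> continuous f ->
  L1 f -> F n%:R @[n --> \oo] --> 0 -> F (- n%:R) @[n --> \oo] --> 0 ->
  \int[mu]_x f x = 0.
Proof.
move=> dF cf lf F1 F2.
have h1 := i_trunc lf.
have h2 : \int[mu]_(x in `[- n%:R, n%:R]) f x @[n --> \oo] --> (0:R).
  rewrite (_ : (fun n => _) = (fun n => F n%:R - F (- n%:R))); last first.
    by apply/funext => n; apply: ftc_R => //; have : (0:R) <= n%:R by []; lra.
  by rewrite -[X in _ --> X](subrr (0:R)); exact: cvgB.
exact: (cvg_unique _ h1 h2).
Qed.

Lemma dui (f df : R -> R -> R) (G : R -> R) (y : R) : (forall y, L1 (f y)) ->
  (forall y x, isD (f^~ x) y (df y x)) -> L1 G ->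
  (forall y x, `|df y x| <= G x) ->
  isD (fun y => \int[mu]_x f y x) y (\int[mu]_x df y x).
Proof.
move=> lf hd lG dG.
have Iy : `]y - 1, y + 1[%classic y by rewrite /= in_itv/=; lra.
have e z x : partial1of2 f z x = df z x.
  by rewrite partial1of2E; have := hd z x => /@derive_val.
have G0 x : 0 <= G x by apply: le_trans (dG 0 x).
have hlf : forall x : R, `]y - 1, y + 1[%classic x -> mu.-integrable setT (EFin \o f x).
  by move=> x _; exact: lf.
have hdf : forall x z, `]y - 1, y + 1[%classic x -> setT z -> derivable (f ^~ z) x 1.
  by move=> x z _ _; case: (hd x z).
have hG : forall x z, `]y - 1, y + 1[%classic x -> setT z -> `|partial1of2 f x z| <= G z.
  by move=> x z _ _; rewrite e.
have D := derivable_under_integral measurableT Iy hlf hdf G0 lG hG.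
have V := differentiation_under_integral measurableT Iy hlf hdf G0 lG hG.
apply: DeriveDef => //; rewrite -derive1E V; apply: i_eq => x; exact: e.
Qed.

End Line.

(** * Gaussian oscillatory integrals *)

Section Gauss.
Variable R : realType.
Local Notation mu := (@lebesgue_measure R).

Lemma gauss_shift (a m : R) : 0 < a ->
  L1 (fun x => expR (- a * (x - m) ^+ 2)) /\
  \int[mu]_x expR (- a * (x - m) ^+ 2) = Num.sqrt (pi / a).
Proof.
(* The standard deviation for which the normal density is a multiple of exp(- a (x - m)^2). *)
move=> a0; pose s : R := (Num.sqrt (2 * a))^-1.
have a20 : 0 < 2 * a by lra.
have s0 : s != 0 by rewrite invr_eq0 sqrtr_eq0 -ltNge.
have s2 : s ^+ 2 *+ 2 = a^-1.
  by rewrite exprVn sqr_sqrtr ?ltW// -mulr_natr invfM mulrAC mulVf ?mul1r.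
pose k : R := Num.sqrt (pi / a).
have k0 : 0 < k by rewrite sqrtr_gt0 divr_gt0// pi_gt0.
have e : normal_pdf m s = (fun x => k^-1 * expR (- a * (x - m) ^+ 2)).
  rewrite normal_pdfE//; apply/funext => x; rewrite /normal_peak /normal_fun.
  congr (_ * expR _); last by rewrite s2 invrK mulrC mulNr mulrN.
  by rewrite /k -mulrnAl s2 mulrC.
have L : L1 (fun x => expR (- a * (x - m) ^+ 2)).
  have /(L1Z k) := integrable_normal_pdf m s; rewrite e; apply: L1_eq => x.
  by rewrite mulrA mulfV ?mul1r// gt_eqF.
split=> //; have := integral_normal_pdf m s; rewrite e i_fin; last exact: L1Z.
rewrite iZ// => -[h]; rewrite -[LHS]mul1r -[1](mulfV (lt0r_neq0 k0)).
by rewrite -mulrA h mulr1.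
Qed.

Lemma gauss_L1 (a : R) : 0 < a -> L1 (fun x => expR (- a * x ^+ 2)).
Proof.
by move=> a0; have [] := gauss_shift 0 a0; under eq_fun do rewrite subr0.
Qed.

Lemma gauss_int (a : R) : 0 < a -> \int[mu]_x expR (- a * x ^+ 2) = Num.sqrt (pi / a).
Proof.
by move=> a0; have [_ <-] := gauss_shift 0 a0; apply: i_eq => x; rewrite subr0.
Qed.

(** Half of the Gaussian absorbs the factor [|x|]. *)
Lemma xgauss_le (a x : R) : 0 < a ->
  `|x| * expR (- a * x ^+ 2) <= (1 + 2 / a) * expR (- (a / 2) * x ^+ 2).
Proof.
move=> a0.
have h : 1 + a / 2 * x ^+ 2 <= expR (a / 2 * x ^+ 2) by exact: expR_ge1Dx.
have -> : expR (- (a / 2) * x ^+ 2) = expR (a / 2 * x ^+ 2) * expR (- a * x ^+ 2).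
  by rewrite -expRD; congr expR; field.
rewrite [leRHS]mulrA ler_wpM2r ?expR_ge0//.
apply: (le_trans _ (ler_wpM2l _ h)); last first.
  by rewrite addr_ge0// divr_ge0// ltW.
have -> : (1 + 2 / a) * (1 + a / 2 * x ^+ 2) = 1 + x ^+ 2 + (2 / a + a / 2 * x ^+ 2).
  by field; rewrite gt_eqF.
apply: ler_wpDr.
  apply: addr_ge0; first by rewrite divr_ge0// ltW.
  by rewrite mulr_ge0 ?sqr_ge0// divr_ge0// ltW.
by have := sqr_ge0 (`|x| - 1); have := real_normK (num_real x); nra.
Qed.

Lemma xgauss_L1 (a : R) : 0 < a -> L1 (fun x => `|x| * expR (- a * x ^+ 2)).
Proof.
move=> a0; apply: (L1_le (g := fun x => (1 + 2 / a) * expR (- (a / 2) * x ^+ 2))).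
- by mf.
- move=> x; rewrite ger0_norm; first exact: xgauss_le.
  by rewrite mulr_ge0 ?expR_ge0.
- by apply: L1Z; apply: gauss_L1; rewrite divr_gt0.
Qed.

Lemma cvg_gauss_seq (a : R) : 0 < a -> expR (- a * n%:R ^+ 2) @[n --> \oo] --> (0 : R).
Proof.
move=> a0.
have h : expR (- a) ^+ n @[n --> \oo] --> (0:R).
  by apply: cvg_expr; rewrite ger0_norm ?expR_ge0// expR_lt1 oppr_lt0.
apply: (squeeze_cvgr _ (cvg_cst (0:R)) h); near=> n.
rewrite expR_ge0 /= -expRM_natl ler_expR mulNr mulrN lerN2 (mulrC n%:R) ler_wpM2l//; first exact: ltW.
by rewrite -natrX ler_nat; case: (n) => // k; rewrite expnS expn1 leq_pmulr.
Unshelve. all: by end_near. Qed.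

Variables a t : R.
Hypothesis a0 : 0 < a.
Let D := a ^+ 2 + t ^+ 2.
Let D0 : 0 < D. Proof. by rewrite ltr_pwDl ?sqr_ge0// exprn_gt0. Qed.

(** Real and imaginary parts of K(y), the integral of e^(- a x^2 + i (y x + t x^2)). Below, [X] and
    [Z] are its first moments: Kc' = - Z and Ks' = X. *)
Definition Kc y := \int[mu]_x (expR (- a * x ^+ 2) * cos (y * x + t * x ^+ 2)).
Definition Ks y := \int[mu]_x (expR (- a * x ^+ 2) * sin (y * x + t * x ^+ 2)).
Let X y := \int[mu]_x (x * expR (- a * x ^+ 2) * cos (y * x + t * x ^+ 2)).
Let Z y := \int[mu]_x (x * expR (- a * x ^+ 2) * sin (y * x + t * x ^+ 2)).

Lemma cos_le1n (x : R) : `|cos x| <= 1.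
Proof. by rewrite ler_norml cos_geN1 cos_le1. Qed.
Lemma sin_le1n (x : R) : `|sin x| <= 1.
Proof. by rewrite ler_norml sin_geN1 sin_le1. Qed.

Let lc y : L1 (fun x => expR (- a * x ^+ 2) * cos (y * x + t * x ^+ 2)).
Proof.
apply: (L1_le _ _ (gauss_L1 a0)); first by mf.
move=> x; rewrite normrM ger0_norm ?expR_ge0// ler_piMr ?expR_ge0//; exact: cos_le1n.
Qed.
Let ls y : L1 (fun x => expR (- a * x ^+ 2) * sin (y * x + t * x ^+ 2)).
Proof.
apply: (L1_le _ _ (gauss_L1 a0)); first by mf.
move=> x; rewrite normrM ger0_norm ?expR_ge0// ler_piMr ?expR_ge0//; exact: sin_le1n.
Qed.
Let lX y : L1 (fun x => x * expR (- a * x ^+ 2) * cos (y * x + t * x ^+ 2)).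
Proof.
apply: (L1_le _ _ (xgauss_L1 a0)); first by mf.
move=> x; rewrite !normrM (ger0_norm (expR_ge0 _)) ler_piMr ?mulr_ge0 ?expR_ge0//; exact: cos_le1n.
Qed.
Let lZ y : L1 (fun x => x * expR (- a * x ^+ 2) * sin (y * x + t * x ^+ 2)).
Proof.
apply: (L1_le _ _ (xgauss_L1 a0)); first by mf.
move=> x; rewrite !normrM (ger0_norm (expR_ge0 _)) ler_piMr ?mulr_ge0 ?expR_ge0//; exact: sin_le1n.
Qed.

Let dC y : isD Kc y (- Z y).
Proof.
have := @dui R (fun y x => expR (- a * x ^+ 2) * cos (y * x + t * x ^+ 2))
  (fun y x => - (x * expR (- a * x ^+ 2) * sin (y * x + t * x ^+ 2))) _ y lc _ (xgauss_L1 a0).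
rewrite (iN (lZ y)); apply.
- move=> {}y x; apply: eq_d; first by dv.
  by rewrite /=; ring.
- move=> {}y x; rewrite normrN !normrM (ger0_norm (expR_ge0 _)) ler_piMr ?mulr_ge0 ?expR_ge0//; exact: sin_le1n.
Qed.

Let dS y : isD Ks y (X y).
Proof.
have := @dui R (fun y x => expR (- a * x ^+ 2) * sin (y * x + t * x ^+ 2))
  (fun y x => x * expR (- a * x ^+ 2) * cos (y * x + t * x ^+ 2)) _ y ls _ (xgauss_L1 a0).
apply.
- move=> {}y x; apply: eq_d; first by dv.
  by rewrite /=; ring.
- move=> {}y x; rewrite !normrM (ger0_norm (expR_ge0 _)) ler_piMr ?mulr_ge0 ?expR_ge0//; exact: cos_le1n.
Qed.

Let dec (F : R -> R) : (forall x, `|F x| <= 1) ->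
  expR (- a * n%:R ^+ 2) * F n%:R @[n --> \oo] --> (0 : R) /\
  expR (- a * (- n%:R) ^+ 2) * F (- n%:R) @[n --> \oo] --> (0 : R).
Proof.
move=> F1; split; apply: norm_cvg0;
  apply: (squeeze_cvgr _ (cvg_cst (0:R)) (cvg_gauss_seq a0)); near=> n;
  by rewrite normr_ge0 /= normrM ger0_norm ?expR_ge0// ?sqrrN ler_piMr ?expR_ge0.
Unshelve. all: by end_near. Qed.

(** The derivative of the damped cosine integrates to 0. With the sine version this is a linear
    system for [X] and [Z] of determinant proportional to [D]; solving it closes the equation K' = -
    (y / (2 D)) (a + i t) K. *)
Let ibp1 y : 2 * a * X y + y * Ks y + 2 * t * Z y = 0.
Proof.
pose f x := (- (2 * a)) * (x * expR (- a * x ^+ 2) * cos (y * x + t * x ^+ 2))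
  + (- y) * (expR (- a * x ^+ 2) * sin (y * x + t * x ^+ 2))
  + (- (2 * t)) * (x * expR (- a * x ^+ 2) * sin (y * x + t * x ^+ 2)).
have dF x : isD (fun x => expR (- a * x ^+ 2) * cos (y * x + t * x ^+ 2)) x (f x).
  by apply: eq_d; [dv | rewrite /f; ring].
have : \int[mu]_x f x = 0.
  have [F1 F2] := dec (fun x => cos_le1n (y * x + t * x ^+ 2)).
  apply: (ibp_line dF) => //.
  - apply: d_cont => x; rewrite /f; dv.
  - by rewrite /f; repeat apply: L1D; apply: L1Z.
have l1 := L1Z (- (2 * a)) (lX y); have l2 := L1Z (- y) (ls y); have l3 := L1Z (- (2 * t)) (lZ y).
rewrite /f iD//; last exact: L1D.
rewrite iD// !iZ// -/(X y) -/(Z y) -/(Ks y) => h.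
by apply/eqP; rewrite -oppr_eq0 -h; apply/eqP; ring.
Qed.

Let ibp2 y : 2 * a * Z y = y * Kc y + 2 * t * X y.
Proof.
pose f x := (- (2 * a)) * (x * expR (- a * x ^+ 2) * sin (y * x + t * x ^+ 2))
  + y * (expR (- a * x ^+ 2) * cos (y * x + t * x ^+ 2))
  + (2 * t) * (x * expR (- a * x ^+ 2) * cos (y * x + t * x ^+ 2)).
have dF x : isD (fun x => expR (- a * x ^+ 2) * sin (y * x + t * x ^+ 2)) x (f x).
  by apply: eq_d; [dv | rewrite /f; ring].
have : \int[mu]_x f x = 0.
  have [F1 F2] := dec (fun x => sin_le1n (y * x + t * x ^+ 2)).
  apply: (ibp_line dF) => //.
  - apply: d_cont => x; rewrite /f; dv.
  - by rewrite /f; repeat apply: L1D; apply: L1Z.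
have l1 := L1Z (- (2 * a)) (lZ y); have l2 := L1Z (y) (lc y); have l3 := L1Z ((2 * t)) (lX y).
rewrite /f iD//; last exact: L1D.
rewrite iD// !iZ// -/(X y) -/(Z y) -/(Kc y) => h.
by apply/eqP; rewrite -subr_eq0 -oppr_eq0 -h; apply/eqP; ring.
Qed.

Let XE y : X y = - (y / (2 * D)) * (a * Ks y + t * Kc y).
Proof.
apply: (mulfI (x := 2 * D)); first by rewrite mulf_neq0// gt_eqF.
have -> : 2 * D * (- (y / (2 * D)) * (a * Ks y + t * Kc y)) = - y * (a * Ks y + t * Kc y).
  by field; rewrite gt_eqF.
have := congr1 (fun z => a * z) (ibp1 y); have := congr1 (fun z => t * z) (ibp2 y).
by rewrite /D /=; lra.
Qed.
Let ZE y : Z y = y / (2 * D) * (a * Kc y - t * Ks y).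
Proof.
apply: (mulfI (x := 2 * D)); first by rewrite mulf_neq0// gt_eqF.
have -> : 2 * D * ((y / (2 * D)) * (a * Kc y - t * Ks y)) = y * (a * Kc y - t * Ks y).
  by field; rewrite gt_eqF.
have := congr1 (fun z => t * z) (ibp1 y); have := congr1 (fun z => a * z) (ibp2 y).
by rewrite /D /=; lra.
Qed.

Lemma Kc_derive y : isD Kc y (- (y / (2 * D)) * (a * Kc y - t * Ks y)).
Proof. by apply: (eq_d (dC y)); rewrite ZE; ring. Qed.

Lemma Ks_derive y : isD Ks y (- (y / (2 * D)) * (a * Ks y + t * Kc y)).
Proof. by apply: (eq_d (dS y)); rewrite XE. Qed.

(** By the differential equation, |K|^2 has logarithmic derivative - y a / D. The value at y = 0 is
    left open here; its bound comes from Plancherel's inequality. *)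
Lemma gauss_kernel_norm y : Kc y ^+ 2 + Ks y ^+ 2 =
  (Kc 0 ^+ 2 + Ks 0 ^+ 2) * expR (- (y ^+ 2 * a / (2 * D))).
Proof.
pose Q y := (Kc y ^+ 2 + Ks y ^+ 2) * expR (y ^+ 2 * (a / (2 * D))).
have dQ y' : isD Q y' 0.
  apply: eq_d; first by rewrite /Q; dv; (exact: dC || exact: dS).
  by rewrite /= XE ZE; field; rewrite gt_eqF.
have := is_derive_0_is_cst y 0 dQ; rewrite /Q expr0n /= mul0r expR0 mulr1 => <-.
by rewrite -mulrA -expRD mulrA subrr expR0 mulr1.
Qed.
End Gauss.

Section GaussFT.
Variables (R : realType) (a : R).
Hypothesis a0 : 0 < a.

Lemma Kc0E y : Kc a 0 y = Num.sqrt (pi / a) * expR (- (4 * a)^-1 * y ^+ 2).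
Proof.
pose Q y := Kc a 0 y * expR ((4 * a)^-1 * y ^+ 2).
have dQ y' : isD Q y' 0.
  apply: eq_d.
    apply: d_mul; first exact: (Kc_derive _ a0).
    by apply: d_expR; apply: d_mul; [exact: d_cst|apply: d_sqr; exact: d_id].
  by rewrite /= expr0n /= addr0; field; rewrite gt_eqF.
have := is_derive_0_is_cst y 0 dQ; rewrite /Q expr0n /= mulr0 expR0 mulr1.
have -> : Kc a 0 0 = Num.sqrt (pi / a).
  by rewrite -gauss_int//; apply: i_eq => x; rewrite !mul0r addr0 cos0 mulr1.
by move=> <-; rewrite -mulrA -expRD mulNr subrr expR0 mulr1.
Qed.

Lemma Ks0E y : Ks a 0 y = 0.
Proof.
pose Q y := Ks a 0 y * expR ((4 * a)^-1 * y ^+ 2).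
have dQ y' : isD Q y' 0.
  apply: eq_d.
    apply: d_mul; first exact: (Ks_derive _ a0).
    by apply: d_expR; apply: d_mul; [exact: d_cst|apply: d_sqr; exact: d_id].
  by rewrite /= expr0n /= addr0; field; rewrite gt_eqF.
have := is_derive_0_is_cst y 0 dQ; rewrite /Q.
have -> : Ks a 0 0 = 0.
  rewrite /Ks (i_eq (g := fun=> 0)); first by rewrite /Rintegral integral0.
  by move=> x; rewrite !mul0r addr0 sin0 mulr0.
by rewrite mul0r => /eqP; rewrite mulf_eq0 (gt_eqF (expR_gt0 _)) orbF => /eqP.
Qed.
End GaussFT.

(** * Schur's test and the TT* method *)

Section Schur.
Variable R : realType.
Local Notation mu := (@lebesgue_measure R).
Variables (W kap : R -> R) (M : R).
Hypotheses (lW : L1 W) (W0 : forall x, 0 <= W x).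
Hypotheses (mk : measurable_fun setT kap) (k0 : forall r, 0 <= kap r)
  (kE : forall r, kap (- r) = kap r)
  (kM : forall x, (\int[mu]_x' (kap (x - x'))%:E <= M%:E)%E).

Let f1 (z : R * R) := (W z.1 / 2 * kap (z.1 - z.2))%:E.
Let f2 (z : R * R) := (W z.2 / 2 * kap (z.1 - z.2))%:E.

Let p0 x y : (0 <= (W x / 2 * kap y)%:E)%E.
Proof. by rewrite lee_fin; apply: mulr_ge0; [exact: divr_ge0|exact: k0]. Qed.

Let m12 : measurable_fun setT f1 /\ measurable_fun setT f2.
Proof.
have mW := L1_meas lW.
split; apply/measurable_EFinP; apply: m_mul; [mf| |mf|];
  by apply: (measurableT_comp mk); mf.
Qed.

Let s1 : (\int[mu]_x \int[mu]_x' f1 (x, x') <= (M / 2 * \int[mu]_x W x)%:E)%E.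
Proof.
have M0 : 0 <= M.
  rewrite -lee_fin; apply: (le_trans _ (kM 0)).
  by apply: integral_ge0 => x _; rewrite lee_fin.
have -> : M / 2 * \int[mu]_x W x = \int[mu]_x (W x / 2 * M).
  by rewrite -iZ//; apply: i_eq => x; ring.
have mW := L1_meas lW.
rewrite -i_fin; last by apply: L1Zr; exact: (L1Zr _ lW).
apply: ge0_le_integral.
- exact: measurableT.
- by move=> x _; apply: integral_ge0 => x' _; exact: p0.
- exact: (@measurable_fun_fubini_tonelli_F _ _ _ _ _ mu f1 m12.1 (fun z => p0 _ _)).
- by apply/measurable_EFinP; mf.
- move=> x _; rewrite /f1 /=; under eq_integral do rewrite EFinM.
  rewrite ge0_integralZl.
  + by rewrite [leRHS]EFinM lee_wpmul2l// lee_fin divr_ge0.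
  + exact: measurableT.
  + by apply/measurable_EFinP; apply: (measurableT_comp mk); mf.
  + by move=> x' _; rewrite lee_fin.
  + by rewrite lee_fin divr_ge0.
Qed.

Let s2 : (\int[mu]_x \int[mu]_x' f2 (x, x') <= (M / 2 * \int[mu]_x W x)%:E)%E.
Proof.
have E := @fubini_tonelli _ _ _ _ _ mu mu f2 m12.2 (fun z => p0 _ _).
rewrite E (_ : (\int[mu]_y _)%E = \int[mu]_x \int[mu]_x' f1 (x, x'))%E; first exact: s1.
apply: eq_integral => x _; apply: eq_integral => x' _.
by rewrite /f1 /f2 /= -[in LHS]kE opprB.
Qed.

(** The two halves of the majorant have equal double integrals by Tonelli and the evenness of [kap],
    and each is at most M/2 times the integral of [W]. *)
Lemma schur_bound (J : R -> R -> R) : (forall x, L1 (J x)) ->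
  L1 (fun x => \int[mu]_x' J x x') ->
  (forall x x', `|J x x'| <= (W x + W x') / 2 * kap (x - x')) ->
  \int[mu]_x \int[mu]_x' J x x' <= M * \int[mu]_x W x.
Proof.
move=> lJx lJ Jle.
have [m1 m2] := m12.
have mF1 := @measurable_fun_fubini_tonelli_F _ _ _ _ _ mu f1 m1 (fun z => p0 _ _).
have mF2 := @measurable_fun_fubini_tonelli_F _ _ _ _ _ mu f2 m2 (fun z => p0 _ _).
rewrite -lee_fin -i_fin//.
apply: (@le_trans _ _ (\int[mu]_x (\int[mu]_x' f1 (x, x') + \int[mu]_x' f2 (x, x')))%E); last first.
  rewrite ge0_integralD.
  - apply: (le_trans (leeD s1 s2)); rewrite -EFinD lee_fin le_eqVlt; apply/orP; left.
    by apply/eqP; field.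
  - exact: measurableT.
  - by move=> x _; apply: integral_ge0 => x' _; exact: p0.
  - exact: mF1.
  - by move=> x _; apply: integral_ge0 => x' _; exact: p0.
  - exact: mF2.
apply: (@le_trans _ _ (\int[mu]_x (`|\int[mu]_x' J x x'|)%:E)%E).
  apply: le_integral => //; first exact: L1_norm.
  by move=> x _; rewrite lee_fin ler_norm.
apply: ge0_le_integral.
- exact: measurableT.
- by move=> x _; rewrite lee_fin.
- by apply/measurable_EFinP; apply: m_norm; exact: L1_meas.
- exact: (emeasurable_funD mF1 mF2).
- move=> x _; apply: (@le_trans _ _ (\int[mu]_x' (`|J x x'|)%:E)%E).
    by rewrite i_fin ?lee_fin; [exact: i_norm|exact: L1_norm].
  have mkx : measurable_fun setT (fun x' : R => kap ((x : R) - x')) by apply: (measurableT_comp mk); mf.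
  have mW := L1_meas lW.
  rewrite /f1 /f2 /= -ge0_integralD.
  + apply: ge0_le_integral.
    * exact: measurableT.
    * by move=> y _; rewrite lee_fin.
    * by apply/measurable_EFinP; apply: m_norm; exact: L1_meas.
    * by apply: emeasurable_funD; apply/measurable_EFinP; mf.
    * by move=> x' _; rewrite lee_fin -mulrDl -mulrDl.
  + exact: measurableT.
  + by move=> x' _; exact: p0.
  + by apply/measurable_EFinP; mf.
  + by move=> x' _; exact: p0.
  + by apply/measurable_EFinP; mf.
Qed.
End Schur.

Section Duality.
Variable R : realType.
Local Notation mu := (@lebesgue_measure R).
Variables (Y T b : R -> R) (eps : R).
Hypotheses (mY : measurable_fun setT Y) (mT : measurable_fun setT T)
  (mb : measurable_fun setT b) (b0 : forall x, 0 <= b x) (eps0 : 0 < eps).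

Definition phase x xi := Y x * xi + T x * xi ^+ 2.
(** Half of [eps] sits in each copy of the operator, so that the composite kernel carries exactly
    [b x + b x' + eps]. *)
Definition damp x xi := expR (- (b x + eps / 2) * xi ^+ 2).

Lemma damp_ge0 x xi : 0 <= damp x xi. Proof. exact: expR_ge0. Qed.

Lemma damp_le x xi : damp x xi <= expR (- (eps / 2) * xi ^+ 2).
Proof. by rewrite ler_expR !mulNr lerN2 ler_wpM2r ?sqr_ge0// lerDr. Qed.

Lemma gauss_half_L1 : L1 (fun xi : R => expR (- (eps / 2) * xi ^+ 2)).
Proof. by apply: gauss_L1; rewrite divr_gt0. Qed.

Section bound.
Variables (w1 w2 : R -> R).
Hypotheses (l1 : L1 w1) (l2 : L1 w2) (lW : L1 (fun x => w1 x ^+ 2 + w2 x ^+ 2)).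

Let W x := w1 x ^+ 2 + w2 x ^+ 2.
Let a x xi := damp x xi * (w1 x * cos (phase x xi) + w2 x * sin (phase x xi)).
Let c x xi := damp x xi * (w2 x * cos (phase x xi) - w1 x * sin (phase x xi)).
Let u x := `|w1 x| + `|w2 x|.
Let g xi := expR (- (eps / 2) * xi ^+ 2).
(* Real and imaginary parts of the adjoint of the linearised maximal operator at [w1 + i w2]. *)
Definition dualA xi := \int[mu]_x (damp x xi * (w1 x * cos (phase x xi) + w2 x * sin (phase x xi))).
Definition dualB xi := \int[mu]_x (damp x xi * (w2 x * cos (phase x xi) - w1 x * sin (phase x xi))).
Let A := dualA. Let B := dualB.

Let lu : L1 u. Proof. by apply: L1D; exact: L1_norm. Qed.
Let u0 x : 0 <= u x. Proof. by rewrite addr_ge0. Qed.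
Let g0 x : 0 <= g x. Proof. exact: expR_ge0. Qed.
Let lg : L1 g. Proof. exact: gauss_half_L1. Qed.
Let mw1 := L1_meas l1.
Let mw2 := L1_meas l2.

Let ma : measurable_fun setT (fun p : R * R => a p.1 p.2).
Proof.
by rewrite /a /damp /phase; mf.
Qed.
Let mc : measurable_fun setT (fun p : R * R => c p.1 p.2).
Proof.
by rewrite /c /damp /phase; mf.
Qed.

Let norm_trig (p q z : R) : `|p * cos z + q * sin z| <= `|p| + `|q|.
Proof.
apply: (le_trans (ler_normD _ _)); rewrite !normrM.
by apply: lerD; rewrite ler_piMr ?cos_le1n ?sin_le1n.
Qed.

Let a_le x xi : `|a x xi| <= u x * g xi.
Proof.
rewrite /a normrM ger0_norm ?damp_ge0// mulrC; apply: ler_pM; rewrite ?damp_ge0 ?damp_le//.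
Qed.
Let c_le x xi : `|c x xi| <= u x * g xi.
Proof.
rewrite /c normrM ger0_norm ?damp_ge0// mulrC; apply: ler_pM; rewrite ?damp_ge0 ?damp_le//.
by rewrite -mulNr /u (addrC `|w1 x|) -(normrN (w1 x)) norm_trig.
Qed.

Let N := \int[mu]_x u x.
Let N0 : 0 <= N. Proof. exact: i_ge0. Qed.

Let fa := fubini_dom ma lu lg a_le.
Let fc := fubini_dom mc lu lg c_le.

Lemma dualA_le xi : `|dualA xi| <= N * expR (- (eps / 2) * xi ^+ 2).
Proof.
have [_ h _ _ _] := fa; have := i_norm_le (h xi) (L1Zr (g xi) lu) (a_le ^~ xi).
by rewrite iZr.
Qed.
Lemma dualB_le xi : `|dualB xi| <= N * expR (- (eps / 2) * xi ^+ 2).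
Proof.
have [_ h _ _ _] := fc; have := i_norm_le (h xi) (L1Zr (g xi) lu) (c_le ^~ xi).
by rewrite iZr.
Qed.
Lemma dualA_L1 : L1 dualA. Proof. by have [_ _ _ h _] := fa. Qed.
Lemma dualB_L1 : L1 dualB. Proof. by have [_ _ _ h _] := fc. Qed.

(** Adjointness by Fubini. The test pair may grow, as long as its bound [C] is integrable against
    the Gaussian; this is what later allows the Gaussian to be divided out. *)
Lemma dual_pair (G1 G2 C : R -> R) : measurable_fun setT G1 -> measurable_fun setT G2 ->
  (forall xi, `|G1 xi| <= C xi) -> (forall xi, `|G2 xi| <= C xi) ->
  L1 (fun xi => C xi * expR (- (eps / 2) * xi ^+ 2)) ->
  L1 (fun x => \int[mu]_xi (G1 xi * a x xi + G2 xi * c x xi)) /\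
  \int[mu]_xi (G1 xi * A xi + G2 xi * B xi) =
  \int[mu]_x \int[mu]_xi (G1 xi * a x xi + G2 xi * c x xi).
Proof.
move=> m1 m2 b1 b2 lC.
have b12 x xi : `|G1 xi * a x xi + G2 xi * c x xi| <= u x * (2 * (C xi * g xi)).
  apply: (le_trans (ler_normD _ _)); rewrite [`|G1 xi * _|]normrM [`|G2 xi * _|]normrM.
  have h1 := ler_pM (normr_ge0 _) (normr_ge0 _) (b1 xi) (a_le x xi).
  have h2 := ler_pM (normr_ge0 _) (normr_ge0 _) (b2 xi) (c_le x xi).
  by apply: (le_trans (lerD h1 h2)); rewrite le_eqVlt; apply/orP; left; apply/eqP; ring.
have [|F1 F2 F3 F4 F5] := fubini_dom (F := fun p => G1 p.2 * a p.1 p.2 + G2 p.2 * c p.1 p.2) _ lu (L1Z 2 lC) b12.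
  by apply: m_add; apply: m_mul; [exact: m_snd|exact: ma|exact: m_snd|exact: mc].
split; first exact: F3.
rewrite /= in F5; rewrite F5; apply: i_eq => xi.
have [_ ha _ _ _] := fa; have [_ hc _ _ _] := fc.
rewrite iD; [|exact: (L1Z _ (ha xi))|exact: (L1Z _ (hc xi))].
by rewrite iZ; [rewrite iZ; [|exact: (hc xi)]|exact: (ha xi)].
Qed.

Variables (kap : R -> R) (M : R).
Hypotheses (mk : measurable_fun setT kap) (k0 : forall r, 0 <= kap r)
  (kE : forall r, kap (- r) = kap r)
  (kM : forall x, (\int[mu]_x' (kap (x - x'))%:E <= M%:E)%E).
Hypothesis HK : forall x x', W x != 0 -> W x' != 0 ->
  Kc (b x + b x' + eps) (T x - T x') (Y x - Y x') ^+ 2 +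
  Ks (b x + b x' + eps) (T x - T x') (Y x - Y x') ^+ 2 <= kap (x - x') ^+ 2.

Let W0 x : 0 <= W x. Proof. by rewrite addr_ge0 ?sqr_ge0. Qed.

Let bb0 x x' : 0 < b x + b x' + eps.
Proof. by rewrite ltr_wpDl// addr_ge0. Qed.

(** With w = w1 + i w2, the numbers p and q are the real and imaginary parts of w(x) times the
    conjugate of w(x'), so p^2 + q^2 = W(x) W(x'). Cauchy-Schwarz in the plane separates them from
    K, and the arithmetic mean replaces the geometric one to fit Schur's test. *)
Let inner x x' :
  `|\int[mu]_xi (a x' xi * a x xi + c x' xi * c x xi)| <= (W x + W x') / 2 * kap (x - x').
Proof.
set p := w1 x * w1 x' + w2 x * w2 x'; set q := w2 x * w1 x' - w1 x * w2 x'.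
have -> : \int[mu]_xi (a x' xi * a x xi + c x' xi * c x xi) =
   p * Kc (b x + b x' + eps) (T x - T x') (Y x - Y x') +
   q * Ks (b x + b x' + eps) (T x - T x') (Y x - Y x').
  have lc : L1 (fun xi => expR (- (b x + b x' + eps) * xi ^+ 2) * cos ((Y x - Y x') * xi + (T x - T x') * xi ^+ 2)).
    apply: (L1_le _ _ (gauss_L1 (bb0 x x'))); first by mf.
    by move=> xi; rewrite normrM ger0_norm ?expR_ge0// ler_piMr ?expR_ge0//; exact: cos_le1n.
  have ls : L1 (fun xi => expR (- (b x + b x' + eps) * xi ^+ 2) * sin ((Y x - Y x') * xi + (T x - T x') * xi ^+ 2)).
    apply: (L1_le _ _ (gauss_L1 (bb0 x x'))); first by mf.
    by move=> xi; rewrite normrM ger0_norm ?expR_ge0// ler_piMr ?expR_ge0//; exact: sin_le1n.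
  rewrite -iZ// -[X in _ + X]iZ// -iD; [|exact: L1Z|exact: L1Z].
  apply: i_eq => xi.
  have -> : (Y x - Y x') * xi + (T x - T x') * xi ^+ 2 = phase x xi - phase x' xi.
    by rewrite /phase; ring.
  have -> : expR (- (b x + b x' + eps) * xi ^+ 2) = damp x xi * damp x' xi.
    by rewrite /damp -expRD; congr expR; field.
  by rewrite cosB sinB /a /c /p /q; ring.
set kc := Kc _ _ _; set ks := Ks _ _ _.
have pq : p ^+ 2 + q ^+ 2 = W x * W x' by rewrite /p /q /W; ring.
have H : (p * kc + q * ks) ^+ 2 <= W x * W x' * kap (x - x') ^+ 2.
  have [Wx|Wx] := eqVneq (W x * W x') 0.
    have [p0 q0] : p = 0 /\ q = 0.
      move: pq; rewrite Wx => /eqP; rewrite paddr_eq0 ?sqr_ge0// !sqrf_eq0.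
      by move=> /andP[/eqP-> /eqP->].
    by rewrite p0 q0 Wx !mul0r addr0 expr0n.
  move: Wx; rewrite mulf_eq0 negb_or => /andP[n1 n2].
  have h := HK n1 n2; rewrite -/kc -/ks in h.
  apply: (@le_trans _ _ ((p ^+ 2 + q ^+ 2) * (kc ^+ 2 + ks ^+ 2))).
    by rewrite -subr_ge0 (_ : _ - _ = (p * ks - q * kc) ^+ 2) ?sqr_ge0//; ring.
  by rewrite pq ler_wpM2l// mulr_ge0.
rewrite -(@ler_pXn2r _ 2)// ?nnegrE//; last first.
  by rewrite mulr_ge0 ?k0// divr_ge0// addr_ge0.
rewrite real_normK ?num_real//; apply: (le_trans H); rewrite exprMn ler_wpM2r ?sqr_ge0//.
by have := sqr_ge0 (W x - W x'); nra.
Qed.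

(** The squared norm is the adjoint paired with itself. Using adjointness twice, the second time
    with x frozen, turns it into the double integral of the kernel bounded by [inner]. The kernel
    hypothesis is restricted to points where [W] does not vanish, so cut-offs can be put into [w1]
    and [w2]. *)
Lemma dual_bound : L1 (fun xi => dualA xi ^+ 2 + dualB xi ^+ 2) /\
  \int[mu]_xi (dualA xi ^+ 2 + dualB xi ^+ 2) <= M * \int[mu]_x (w1 x ^+ 2 + w2 x ^+ 2).
Proof.
have g1 xi : g xi <= 1.
  by rewrite /g -expR0 ler_expR mulNr oppr_le0 mulr_ge0 ?sqr_ge0// divr_ge0// ltW.
have A1 xi : `|A xi| <= N by apply: (le_trans (dualA_le xi)); rewrite ler_piMr//; exact: g1.
have B1 xi : `|B xi| <= N by apply: (le_trans (dualB_le xi)); rewrite ler_piMr//; exact: g1.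
have mA := L1_meas dualA_L1; have mB := L1_meas dualB_L1.
split.
  apply: (L1_le (g := fun xi => 2 * N * N * g xi)); first by mf.
    move=> xi; rewrite ger0_norm ?addr_ge0 ?sqr_ge0//.
    have sq z : `|z| <= N * g xi -> z ^+ 2 <= N * N * g xi.
      move=> zN; rewrite -(real_normK (num_real z)) expr2.
      apply: (le_trans (ler_pM _ _ zN zN)) => //.
      have -> : N * g xi * (N * g xi) = N * N * g xi * g xi by ring.
      by rewrite ler_piMr// !mulr_ge0.
    by have := sq _ (dualA_le xi); have := sq _ (dualB_le xi); lra.
  exact: L1Z.
have [P1 P2] := dual_pair mA mB A1 B1 (L1Z N lg).
have -> : \int[mu]_xi (dualA xi ^+ 2 + dualB xi ^+ 2) = \int[mu]_xi (A xi * A xi + B xi * B xi).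
  by apply: i_eq.
rewrite P2.
pose J x x' := \int[mu]_xi (a x' xi * a x xi + c x' xi * c x xi).
have eJ x : \int[mu]_xi (A xi * a x xi + B xi * c x xi) = \int[mu]_x' J x x' /\ L1 (J x).
  have bd xi : `|a x xi| <= u x.
    by apply: (le_trans (a_le x xi)); rewrite ler_piMr//; exact: g1.
  have bd' xi : `|c x xi| <= u x.
    by apply: (le_trans (c_le x xi)); rewrite ler_piMr//; exact: g1.
  have hm1 : measurable_fun setT (a x) by exact: (measurableT_comp ma (measurable_pair1 x)).
  have hm2 : measurable_fun setT (c x) by exact: (measurableT_comp mc (measurable_pair1 x)).
  have [Q1 Q2] := dual_pair hm1 hm2 bd bd' (L1Z (u x) lg).
  have e1 : (fun x' => \int[mu]_xi (a x xi * a x' xi + c x xi * c x' xi)) = J x.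
    by apply/funext => x'; apply: i_eq => xi; rewrite mulrC (mulrC (c x xi)).
  rewrite e1 in Q1 Q2; split; last exact: Q1.
  rewrite -Q2.
  by apply: i_eq => xi; rewrite mulrC (mulrC (B xi)).
have -> : (fun x => \int[mu]_xi (A xi * a x xi + B xi * c x xi)) = (fun x => \int[mu]_x' J x x').
  by apply/funext => x; case: (eJ x).
have lJ : L1 (fun x => \int[mu]_x' J x x').
  by apply: L1_eq P1 => x; case: (eJ x).
have lJx x : L1 (J x) by case: (eJ x).
have Jle x x' : `|J x x'| <= (W x + W x') / 2 * kap (x - x') by exact: inner.
exact: (schur_bound lW W0 mk k0 kE kM).
Qed.

End bound.
End Duality.

(** * Plancherel and Parseval identities *)

Section Plancherel.
Variable R : realType.
Local Notation mu := (@lebesgue_measure R).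
Implicit Types f g : R -> R.

Definition FT1 f1 f2 xi := \int[mu]_x (cos (x * xi) * f1 x + sin (x * xi) * f2 x).
Definition FT2 f1 f2 xi := \int[mu]_x (cos (x * xi) * f2 x - sin (x * xi) * f1 x).

Lemma FT_dual (eps : R) f1 f2 xi : L1 f1 -> L1 f2 ->
  dualA id (fun=> 0) (fun=> 0) eps f1 f2 xi = expR (- (eps / 2) * xi ^+ 2) * FT1 f1 f2 xi /\
  dualB id (fun=> 0) (fun=> 0) eps f1 f2 xi = expR (- (eps / 2) * xi ^+ 2) * FT2 f1 f2 xi.
Proof.
move=> l1 l2.
have l f g : L1 f -> L1 g -> L1 (fun x => cos (x * xi) * f x + sin (x * xi) * g x).
  move=> lf lg; have mf := L1_meas lf; have mg := L1_meas lg.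
  apply: (L1_le (g := fun x => `|f x| + `|g x|)); first by mf.
    move=> x; apply: (le_trans (ler_normD _ _)); rewrite !normrM.
    by apply: lerD; rewrite ler_piMl// ?cos_le1n ?sin_le1n.
  by apply: L1D; exact: L1_norm.
split.
- rewrite /FT1 -iZ; last exact: l.
  apply: i_eq => x; rewrite /damp /phase mul0r !addr0 add0r.
  by rewrite (mulrC (f1 x)) (mulrC (f2 x)).
- rewrite /FT2 -iZ; last by have := l _ _ l2 (L1N l1); apply: L1_eq => x; rewrite mulrN.
  apply: i_eq => x; rewrite /damp /phase mul0r !addr0 add0r.
  by rewrite (mulrC (f1 x)) (mulrC (f2 x)).
Qed.

(** The Fourier transform of exp(- eps xi^2): an approximate identity of total mass 2 pi. *)
Definition gk (eps r : R) := Num.sqrt (pi / eps) * expR (- (4 * eps)^-1 * r ^+ 2).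

Lemma gk_int (eps : R) (x : R) : 0 < eps -> L1 (fun y => gk eps (x - y)) /\
  \int[mu]_y gk eps (x - y) = 2 * pi.
Proof.
move=> e0; have e4 : 0 < (4 * eps)^-1 by rewrite invr_gt0; lra.
have [l i] := gauss_shift x e4.
have E : (fun y => gk eps (x - y)) = (fun y => Num.sqrt (pi / eps) * expR (- (4 * eps)^-1 * (y - x) ^+ 2)).
  by apply/funext => y; rewrite /gk -[in RHS](sqrrN (y - x)) opprB.
rewrite E; split; first exact: L1Z.
rewrite iZ// i -sqrtrM; last by rewrite divr_ge0 ?pi_ge0// ltW.
have -> : pi / eps * (pi / (4 * eps)^-1) = (2 * pi) ^+ 2 :> R by field; rewrite gt_eqF.
by rewrite sqrtr_sqr ger0_norm// mulr_ge0// pi_ge0.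
Qed.

Lemma gk_ge0 (eps r : R) : 0 <= gk eps r.
Proof. by rewrite mulr_ge0 ?sqrtr_ge0 ?expR_ge0. Qed.

Lemma m_zero : measurable_fun setT (fun _ : R => (0:R)). Proof. exact: m_cst. Qed.
Lemma m_idR : measurable_fun setT (@id R). Proof. exact: measurable_id. Qed.

(** The Gaussian multiple of the transform is integrable by Fubini, hence measurable; the Gaussian
    is then divided out. *)
Lemma FT_meas f1 f2 : L1 f1 -> L1 f2 ->
  measurable_fun setT (FT1 f1 f2) /\ measurable_fun setT (FT2 f1 f2).
Proof.
move=> l1 l2.
have A := dualA_L1 m_idR m_zero m_zero (fun=> lexx _) (@ltr01 R) l1 l2.
have B := dualB_L1 m_idR m_zero m_zero (fun=> lexx _) (@ltr01 R) l1 l2.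
split.
- have -> : FT1 f1 f2 = (fun xi => expR (1 / 2 * xi ^+ 2) * dualA id (fun=> 0) (fun=> 0) 1 f1 f2 xi).
    apply/funext => xi; have [-> _] := FT_dual 1 xi l1 l2.
    by rewrite mulrA -expRD mulNr subrr expR0 mul1r.
  by apply: m_mul; [mf|exact: L1_meas].
- have -> : FT2 f1 f2 = (fun xi => expR (1 / 2 * xi ^+ 2) * dualB id (fun=> 0) (fun=> 0) 1 f1 f2 xi).
    apply/funext => xi; have [_ ->] := FT_dual 1 xi l1 l2.
    by rewrite mulrA -expRD mulNr subrr expR0 mul1r.
  by apply: m_mul; [mf|exact: L1_meas].
Qed.

(** The Fourier transform is the dual operator of the curve Y(x) = x at time 0 without damping. Its
    kernel is [gk], whose mass 2 pi is the Schur constant, and Fatou's lemma removes the Gaussian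
    factor. *)
Lemma plancherel_le f1 f2 : L1 f1 -> L1 f2 -> L1 (fun x => f1 x ^+ 2 + f2 x ^+ 2) ->
  L1 (fun xi => FT1 f1 f2 xi ^+ 2 + FT2 f1 f2 xi ^+ 2) /\
  \int[mu]_xi (FT1 f1 f2 xi ^+ 2 + FT2 f1 f2 xi ^+ 2) <=
    2 * pi * \int[mu]_x (f1 x ^+ 2 + f2 x ^+ 2).
Proof.
move=> l1 l2 l12.
pose e : nat -> R := harmonic.
have e0 n : 0 < e n by exact: harmonic_gt0.
have D n := @dual_bound R id (fun=> 0) (fun=> 0) (e n) (@measurable_id _ _ setT) (m_cst _) (m_cst _)
  (fun=> lexx _) (e0 n) f1 f2 l1 l2 l12 (gk (e n)) (2 * pi).
have {}D n : L1 (fun xi => expR (- e n * xi ^+ 2) * (FT1 f1 f2 xi ^+ 2 + FT2 f1 f2 xi ^+ 2)) /\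
   \int[mu]_xi (expR (- e n * xi ^+ 2) * (FT1 f1 f2 xi ^+ 2 + FT2 f1 f2 xi ^+ 2)) <=
    2 * pi * \int[mu]_x (f1 x ^+ 2 + f2 x ^+ 2).
  have E : (fun xi => expR (- e n * xi ^+ 2) * (FT1 f1 f2 xi ^+ 2 + FT2 f1 f2 xi ^+ 2)) =
     (fun xi => dualA id (fun=> 0) (fun=> 0) (e n) f1 f2 xi ^+ 2 + dualB id (fun=> 0) (fun=> 0) (e n) f1 f2 xi ^+ 2).
    apply/funext => xi; have [-> ->] := FT_dual (e n) xi l1 l2.
    rewrite !exprMn -mulrDr -expRM_natl; congr (expR _ * _).
    rewrite [2%:R * _]mulrA; congr (_ * _); rewrite mulrN; congr (- _).
    by rewrite mulrCA divff ?mulr1.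
  rewrite E; apply: D.
  - by rewrite /gk; mf.
  - by move=> r; rewrite mulr_ge0 ?sqrtr_ge0 ?expR_ge0.
  - by move=> r; rewrite /gk sqrrN.
  - by move=> x; have [l i] := gk_int x (e0 n); rewrite i_fin// i.
  - move=> x x' _ _; rewrite subr0 addr0 add0r Ks0E// Kc0E// expr0n addr0.
    exact: lexx.
apply: (@fatou_real R (fun n xi => expR (- e n * xi ^+ 2) * (FT1 f1 f2 xi ^+ 2 + FT2 f1 f2 xi ^+ 2))).
- by move=> n; case: (D n).
- by move=> n xi; rewrite mulr_ge0 ?expR_ge0// addr_ge0 ?sqr_ge0.
- move=> xi; rewrite -[X in _ --> X]mul1r; apply: cvgM; last exact: cvg_cst.
  rewrite -expR0; apply: continuous_cvg; first exact: continuous_expR.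
  rewrite -[X in _ --> X](mul0r (xi ^+ 2)); apply: cvgM; last exact: cvg_cst.
  by rewrite -oppr0; apply: cvgN; exact: cvg_harmonic.
- by move=> n; case: (D n).
Qed.

(** As a function of y, K is up to conjugation the Fourier transform of a chirped Gaussian of
    modulus e^(- a x^2). By [gauss_kernel_norm] the integral of |K|^2 is |K(0)|^2 times an explicit
    Gaussian integral, so Plancherel's inequality bounds |K(0)|^2. *)
Lemma gauss_kernel0_le (a t : R) : 0 < a ->
  Kc a t 0 ^+ 2 + Ks a t 0 ^+ 2 <= pi / Num.sqrt (a ^+ 2 + t ^+ 2).
Proof.
move=> a0; set D := a ^+ 2 + t ^+ 2.
have D0 : 0 < D by rewrite ltr_pwDl ?sqr_ge0// exprn_gt0.
pose h1 x := expR (- a * x ^+ 2) * cos (t * x ^+ 2).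
pose h2 x := - (expR (- a * x ^+ 2) * sin (t * x ^+ 2)).
have l1 : L1 h1.
  apply: (L1_le _ _ (gauss_L1 a0)); first by rewrite /h1; mf.
  move=> x; rewrite normrM ger0_norm ?expR_ge0// ler_piMr ?expR_ge0//; exact: cos_le1n.
have l2 : L1 h2.
  apply: (L1_le _ _ (gauss_L1 a0)); first by rewrite /h2; mf.
  move=> x; rewrite normrN normrM ger0_norm ?expR_ge0// ler_piMr ?expR_ge0//; exact: sin_le1n.
have a20 : 0 < 2 * a by lra.
have E : (fun x => h1 x ^+ 2 + h2 x ^+ 2) = (fun x => expR (- (2 * a) * x ^+ 2)).
  apply/funext => x; rewrite /h1 /h2 sqrrN !exprMn -mulrDr cos2Dsin2 mulr1 -expRM_natl.
  by congr expR; ring.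
have [|_ H] := plancherel_le l1 l2; first by rewrite E; exact: gauss_L1.
rewrite E gauss_int// in H.
have E2 : (fun y => FT1 h1 h2 y ^+ 2 + FT2 h1 h2 y ^+ 2) =
    (fun y => (Kc a t 0 ^+ 2 + Ks a t 0 ^+ 2) * expR (- (a / (2 * D)) * y ^+ 2)).
  apply/funext => y.
  have -> : FT1 h1 h2 y = Kc a t y.
    by apply: i_eq => x; rewrite /h1 /h2 (mulrC y) cosD; ring.
  have -> : FT2 h1 h2 y = - Ks a t y.
    rewrite -iN; last first.
      apply: (L1_le _ _ (gauss_L1 a0)); first by mf.
      by move=> x; rewrite normrM ger0_norm ?expR_ge0// ler_piMr ?expR_ge0//; exact: sin_le1n.
    by apply: i_eq => x; rewrite /h1 /h2 (mulrC y) sinD; ring.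
  rewrite sqrrN (gauss_kernel_norm _ a0 y); congr (_ * _); congr expR; rewrite -/D; ring.
have aD : 0 < a / (2 * D) by rewrite divr_gt0//; lra.
rewrite E2 iZ ?gauss_int// in H; last exact: gauss_L1.
have p0 := @pi_gt0 R.
have q0 : 0 < Num.sqrt (pi / (2 * a)) by rewrite sqrtr_gt0 divr_gt0.
have sD : 0 < Num.sqrt D by rewrite sqrtr_gt0.
rewrite ler_pdivlMr//.
have e : Num.sqrt (pi / (a / (2 * D))) = Num.sqrt (pi / (2 * a)) * (2 * Num.sqrt D).
  have -> : pi / (a / (2 * D)) = pi / (2 * a) * (2 ^+ 2 * D).
    by field; rewrite !gt_eqF.
  rewrite sqrtrM; last by rewrite divr_ge0 ?ltW.
  by rewrite [Num.sqrt (2 ^+ 2 * D)]sqrtrM ?sqr_ge0// sqrtr_sqr ger0_norm.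
rewrite e in H.
rewrite -(ler_pM2r q0) -(@ler_pM2l _ 2)//.
apply: (le_trans _ (le_trans H _)); rewrite le_eqVlt; apply/orP; left; apply/eqP; ring.
Qed.

Lemma gauss_kernel_le (a t y : R) : 0 < a ->
  Kc a t y ^+ 2 + Ks a t y ^+ 2 <=
  pi / Num.sqrt (a ^+ 2 + t ^+ 2) * expR (- (y ^+ 2 * a / (2 * (a ^+ 2 + t ^+ 2)))).
Proof.
by move=> a0; rewrite gauss_kernel_norm// ler_wpM2r ?expR_ge0// gauss_kernel0_le.
Qed.

Lemma aeS (P Q : R -> Prop) : (forall x, P x -> Q x) ->
  {ae mu, forall x, P x} -> {ae mu, forall x, Q x}.
Proof. by move=> PQ; exact: (@filterS _ _ (ae_filter_ringOfSetsType mu)). Qed.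

Lemma aeI (P Q : R -> Prop) : {ae mu, forall x, P x} -> {ae mu, forall x, Q x} ->
  {ae mu, forall x, P x /\ Q x}.
Proof.
by move=> hP hQ; apply: (@filterS2 _ _ (ae_filter_ringOfSetsType mu) _ _ _ _ hP hQ) => x Px Qx.
Qed.

Lemma ae_neq (c : R) : {ae mu, forall x, x != c}.
Proof.
exists [set c]; split => //; first exact: lebesgue_measure_set1.
by move=> x /= /negP; rewrite negbK => /eqP.
Qed.

Lemma dct_ae (f_ : nat -> R -> R) f g : (forall n, measurable_fun setT (f_ n)) ->
  measurable_fun setT f ->
  {ae mu, forall x, f_ n x @[n --> \oo] --> f x} -> L1 g ->
  {ae mu, forall x n, `|f_ n x| <= g x} ->
  L1 f /\ \int[mu]_x f_ n x @[n --> \oo] --> \int[mu]_x f x.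
Proof.
move=> mf_ mf cf lg fg.
have [] := @dominated_convergence _ _ _ mu setT measurableT (fun n x => (f_ n x)%:E) (EFin \o f) (EFin \o g).
- by move=> n; apply/measurable_EFinP; exact: mf_.
- exact/measurable_EFinP.
- by apply: aeS cf => x h _; apply: cvg_EFin; [exact: nearW|exact: h].
- exact: lg.
- by apply: aeS fg => x h n _; rewrite lee_fin; exact: h.
move=> lf _; rewrite (i_fin lf) => /fine_cvg h; split => //; exact: lf.
Qed.

Lemma sqr_indic (D : set R) (x : R) : (\1_D x) ^+ 2 = \1_D x :> R.
Proof. by rewrite indicE; case: (_ \in _); rewrite ?expr1n ?expr0n. Qed.

Section box.
Variables (c d : R).
Hypothesis cd : c < d.
Let I : set R := `[c, d]%classic.
(** [box1 - i box2] is the Fourier transform of the indicator of [c, d]. *)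
Definition box1 xi := \int[mu]_(y in `[c, d]) cos (y * xi).
Definition box2 xi := \int[mu]_(y in `[c, d]) sin (y * xi).

Lemma L1_itv : L1 (\1_I : R -> R).
Proof. exact: integrable_indic_itv. Qed.

Lemma i_itv : \int[mu]_x (\1_I x : R) = d - c.
Proof.
have h : mu I = (d - c)%:E by rewrite lebesgue_measure_itv/= lte_fin cd -EFinB.
have := Rintegral_cst mu (measurable_itv `[c, d]) 1; rewrite mul1r [X in fine X]h /= => <-.
by rewrite [RHS]i_set; apply: i_eq => x; rewrite mulr1.
Qed.

Lemma box1E xi : box1 xi = FT1 \1_I (fun=> 0) xi.
Proof. by rewrite /box1 i_set; apply: i_eq => x; rewrite mulr0 addr0 mulrC. Qed.
Lemma box2E xi : box2 xi = - FT2 \1_I (fun=> 0) xi.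
Proof.
have l : L1 (fun x => \1_I x * sin (x * xi)).
  apply: (L1_le (g := \1_I)); [|move=> x|exact: L1_itv].
  - by apply: m_mul; [apply: m_indic; exact: measurable_itv|mf].
  - by rewrite normrM -[leRHS]mulr1 ger0_norm ?ler_wpM2l ?sin_le1n.
rewrite /FT2 (i_eq (g := fun x => - (\1_I x * sin (x * xi)))) ?iN ?opprK.
- by rewrite /box2 i_set.
- exact: l.
- by move=> x; rewrite mulr0 sub0r mulrC.
Qed.


Lemma box_L2 : L1 (fun xi => box1 xi ^+ 2 + box2 xi ^+ 2).
Proof.
have [|h _] := plancherel_le L1_itv (L1_0 R).
  by apply: L1_eq L1_itv => x; rewrite sqr_indic expr0n addr0.
by apply: L1_eq h => xi; rewrite box1E box2E sqrrN.
Qed.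
End box.
End Plancherel.

Section Parseval.
Variable R : realType.
Local Notation mu := (@lebesgue_measure R).
Implicit Types f g : R -> R.

Lemma exp_lin_cvg (k C : R) : 0 < k -> C * expR (- (k * n%:R)) @[n --> \oo] --> (0 : R).
Proof.
move=> k0; rewrite -[X in _ --> X](mulr0 C); apply: cvgM; first exact: cvg_cst.
rewrite (_ : (fun n => _) = (fun n => expR (- k) ^+ n)).
  by apply: cvg_expr; rewrite ger0_norm ?expR_ge0// expR_lt1 oppr_lt0.
by apply/funext => n; rewrite -expRM_natl mulrN mulrC.
Qed.

Section box_parseval.
Variables (c d : R).
Hypothesis cd : c < d.
Local Notation I := (`[c, d]%classic).
Definition Phi n x := \int[mu]_y (\1_I y * gk (harmonic n) (x - y)).

Lemma Phi_L1 n x : L1 (fun y => \1_I y * gk (harmonic n) (x - y)).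
Proof. by apply: L1_indic; [exact: measurable_itv|case: (gk_int x (harmonic_gt0 n))]. Qed.

Lemma Phi_bd n x : 0 <= Phi n x <= 2 * pi.
Proof.
have [l i] := gk_int x (harmonic_gt0 n).
apply/andP; split.
  by apply: i_ge0 => y; rewrite mulr_ge0 ?gk_ge0//; have /andP[] := indic_le1 I y.
rewrite -i; apply: i_le => //; first exact: Phi_L1.
by move=> y; rewrite ler_piMl ?gk_ge0//; have /andP[] := indic_le1 I y.
Qed.

(* Off the ball of radius [del] the kernel is at most [exp(- del^2 / (8 e))]
   times a kernel of twice the variance. *)
Let tail n x del (J : set R) : 0 < del -> measurable J -> (forall y, J y -> del <= `|x - y|) ->
  \int[mu]_y (\1_J y * gk (harmonic n) (x - y)) <= 2 * pi * Num.sqrt 2 * expR (- (del ^+ 2 / 8 * n%:R)).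
Proof.
move=> d0 mJ hJ; set e := harmonic; have e0 : 0 < e n := harmonic_gt0 n.
have e8 : 0 < (8 * e n)^-1 by rewrite invr_gt0 mulr_gt0.
have [l i] := gauss_shift x e8.
have [lg _] := gk_int x (harmonic_gt0 n).
pose E := expR (- (del ^+ 2 / (8 * e n))).
have le y : \1_J y * gk (harmonic n) (x - y) <= Num.sqrt (pi / e n) * E * expR (- (8 * e n)^-1 * (y - x) ^+ 2).
  rewrite indicE; have [/set_mem Jy|_] := boolP (y \in J); last first.
    by rewrite mul0r !mulr_ge0 ?sqrtr_ge0 ?expR_ge0.
  rewrite mul1r /gk -mulrA ler_wpM2l ?sqrtr_ge0// /E -expRD ler_expR.
  have h : del ^+ 2 <= (x - y) ^+ 2.
    by rewrite -(real_normK (num_real (x - y))) ler_pXn2r ?nnegrE ?hJ// ltW.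
  have -> : (y - x) ^+ 2 = (x - y) ^+ 2 by ring.
  have -> : (4 * e n)^-1 = 2 * (8 * e n)^-1 by field; rewrite gt_eqF.
  have : (8 * e n)^-1 * del ^+ 2 <= (8 * e n)^-1 * (x - y) ^+ 2 by rewrite ler_pM2l.
  by rewrite (mulrC (del ^+ 2)); lra.
apply: (le_trans (i_le _ _ le)).
- by apply: L1_indic.
- exact: L1Z.
rewrite iZ// i mulrAC -sqrtrM; last by rewrite divr_ge0 ?pi_ge0// ltW.
have -> : pi / e n * (pi / (8 * e n)^-1) = (2 * pi) ^+ 2 * 2 :> R by field; rewrite gt_eqF.
rewrite sqrtrM ?sqr_ge0// sqrtr_sqr ger0_norm; last by rewrite mulr_ge0// pi_ge0.
rewrite ler_wpM2l//.
  by rewrite !mulr_ge0 ?sqrtr_ge0 ?pi_ge0.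
rewrite ler_expR lerN2 invfM /e /harmonic invrK mulrA ler_wpM2l ?ler_nat//.
by rewrite divr_ge0 ?sqr_ge0.
Qed.

(** Away from the endpoints a ball around x lies inside or outside the interval, and [tail] controls
    the rest. At an endpoint only half of the mass would be seen. *)
Lemma Phi_cvg x : x != c -> x != d -> Phi n x @[n --> \oo] --> 2 * pi * \1_I x.
Proof.
move=> xc xd; rewrite indicE; have [/set_mem|] := boolP (x \in I).
- rewrite /I /= in_itv /= => /andP[cx xd']; rewrite mulr1.
  have [del [d0 hdel]] : exists del, 0 < del /\ (forall y, (~` I) y -> del <= `|x - y|).
    exists (Num.min (x - c) (d - x)); split.
      by rewrite lt_min !subr_gt0 !lt_neqAle cx xd' xd (eq_sym c) xc.
    move=> y /= /negP; rewrite in_itv/= negb_and -!ltNge => /orP[h|h]; rewrite ge_min; apply/orP.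
      by left; rewrite (le_trans _ (ler_norm _))//; lra.
    by right; rewrite distrC (le_trans _ (ler_norm _))//; lra.
  have T n : 2 * pi - Phi n x <= 2 * pi * Num.sqrt 2 * expR (- (del ^+ 2 / 8 * n%:R)).
    have [l i] := gk_int x (harmonic_gt0 n).
    rewrite -{1}i -iB//; last exact: Phi_L1.
    apply: le_trans (@tail n x del (~` I) d0 _ hdel); last exact: measurableC.
    rewrite le_eqVlt; apply/orP; left; apply/eqP; apply: i_eq => y.
    by rewrite !indicE in_setC; case: (y \in I) => /=; rewrite ?mul1r ?mul0r ?subrr ?subr0.
  have h0 : 2 * pi - Phi n x @[n --> \oo] --> (0:R).
    apply: (squeeze_cvgr _ (cvg_cst (0:R)) (exp_lin_cvg (2 * pi * Num.sqrt 2) (k := del ^+ 2 / 8) _)).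
      by near=> n; rewrite T andbT subr_ge0; have /andP[] := Phi_bd n x.
    by rewrite divr_gt0// exprn_gt0.
  have -> : (fun n => Phi n x) = (fun n => 2 * pi - (2 * pi - Phi n x)).
    by apply/funext => n; ring.
  by rewrite -[X in _ --> X]subr0; apply: cvgB => //; exact: cvg_cst.
- move=> /negP xI; rewrite mulr0.
  have [del [d0 hdel]] : exists del, 0 < del /\ (forall y, I y -> del <= `|x - y|).
    have xI' : ~ (c <= x <= d) by move=> h; apply: xI; apply/mem_set; rewrite /I/= in_itv.
    have [cx|cx] := ltP x c.
      exists (c - x); split; first by rewrite subr_gt0.
      move=> y; rewrite /I /= in_itv/= => /andP[h1 h2].
      by rewrite distrC (le_trans _ (ler_norm _))//; lra.
    have dx : d < x by rewrite ltNge; apply/negP => h; apply: xI'; rewrite cx h.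
    exists (x - d); split; first by rewrite subr_gt0.
    move=> y; rewrite /I /= in_itv/= => /andP[h1 h2].
    by rewrite (le_trans _ (ler_norm _))//; lra.
  apply: (squeeze_cvgr _ (cvg_cst (0:R)) (exp_lin_cvg (2 * pi * Num.sqrt 2) (k := del ^+ 2 / 8) _)).
    by near=> n; rewrite (@tail n x del I)// ?andbT; have /andP[] := Phi_bd n x.
  by rewrite divr_gt0// exprn_gt0.
Unshelve. all: by end_near. Qed.

Variables (f1 f2 : R -> R).
Hypotheses (l1 : L1 f1) (l2 : L1 f2) (l12 : L1 (fun x => f1 x ^+ 2 + f2 x ^+ 2)).

Let h1 := FT1 f1 f2.
Let h2 := FT2 f1 f2.
Local Notation e := (@harmonic R).
Let e0 := @harmonic_gt0 R.
Let w n xi := expR (- e n * xi ^+ 2).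

Let m0 := @m_zero R.
Let mid := @m_idR R.
Let lI := L1_itv c d.
Let lI2 : L1 (fun x => (\1_I x : R) ^+ 2 + (fun=> 0) x ^+ 2).
Proof. by apply: L1_eq lI => x; rewrite sqr_indic expr0n addr0. Qed.

Let box_bd xi : `|box1 c d xi| <= d - c /\ `|box2 c d xi| <= d - c.
Proof.
have h (F : R -> R) : measurable_fun setT F -> (forall x, `|F x| <= 1) ->
   `|\int[mu]_(y in I) F y| <= d - c.
  move=> mF F1; rewrite i_set -(i_itv cd); apply: i_norm_le => //.
  - apply: (L1_le _ _ lI) => [|x].
      by apply: m_mul => //; apply: m_indic; exact: measurable_itv.
    rewrite normrM -[leRHS]mulr1 ger0_norm ?ler_wpM2l//; have /andP[] := indic_le1 I x; lra.
  - move=> x; rewrite normrM -[leRHS]mulr1 ger0_norm ?ler_wpM2l//; have /andP[] := indic_le1 I x; lra.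
split; apply: h; [by mf| |by mf|] => x; [exact: cos_le1n|exact: sin_le1n].
Qed.

Let mbox : measurable_fun setT (box1 c d) /\ measurable_fun setT (box2 c d).
Proof.
have [h1' h2'] := FT_meas lI (L1_0 R).
split; first by apply: eq_measurable_fun h1' => xi _; rewrite box1E.
by apply: eq_measurable_fun (m_opp h2') => xi _; rewrite box2E.
Qed.

Let two n : 0 < 2 * e n. Proof. by rewrite mulr_gt0// e0. Qed.

(** Adjointness is used twice: it moves the transform off f, and then, for each fixed x, off the
    interval, where the Gaussian kernel appears. The parameter is [2 * e n] because [damp] halves
    it. *)
Let smoothed n : L1 (fun x => f1 x * Phi n x) /\
  \int[mu]_xi (w n xi * (box1 c d xi * h1 xi - box2 c d xi * h2 xi)) =
  \int[mu]_x (f1 x * Phi n x).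
Proof.
have [mb1 mb2] := mbox.
have wE xi : expR (- (2 * e n / 2) * xi ^+ 2) = w n xi.
  by rewrite /w mulrAC divff ?mul1r.
have bd1 xi : `|box1 c d xi| <= d - c by case: (box_bd xi).
have bd2 xi : `|- box2 c d xi| <= d - c by rewrite normrN; case: (box_bd xi).
have [P0 P] := dual_pair mid m0 m0 (fun=> lexx _) (two n) l1 l2 mb1 (m_opp mb2) bd1 bd2 (L1Z _ (gauss_half_L1 (two n))).
have inner x : \int[mu]_xi (box1 c d xi * (damp (fun=> 0) (2 * e n) x xi * (f1 x * cos (phase id (fun=> 0) x xi) + f2 x * sin (phase id (fun=> 0) x xi)))
   + - box2 c d xi * (damp (fun=> 0) (2 * e n) x xi * (f2 x * cos (phase id (fun=> 0) x xi) - f1 x * sin (phase id (fun=> 0) x xi)))) = f1 x * Phi n x.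

pose G1 xi := f1 x * cos (x * xi) + f2 x * sin (x * xi).
pose G2 xi := f2 x * cos (x * xi) - f1 x * sin (x * xi).
have mG1 : measurable_fun setT G1 by rewrite /G1; mf.
have mG2 : measurable_fun setT G2 by rewrite /G2; mf.
have bG p q z : `|p * cos z + q * sin z| <= `|p| + `|q| :> R.
  apply: (le_trans (ler_normD _ _)); rewrite !normrM.
  by apply: lerD; rewrite ler_piMr ?cos_le1n ?sin_le1n.
have bG1 xi : `|G1 xi| <= `|f1 x| + `|f2 x| by exact: bG.
have bG2 xi : `|G2 xi| <= `|f1 x| + `|f2 x|.
  by rewrite /G2 -mulNr addrC -(normrN (f1 x)) addrC [leRHS]addrC; exact: bG.
have [_ Q] := dual_pair mid m0 m0 (fun=> lexx _) (two n) lI (L1_0 R) mG1 mG2 bG1 bG2 (L1Z _ (gauss_half_L1 (two n))).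
transitivity (\int[mu]_xi (G1 xi * dualA id (fun=> 0) (fun=> 0) (2 * e n) \1_I (fun=> 0) xi +
   G2 xi * dualB id (fun=> 0) (fun=> 0) (2 * e n) \1_I (fun=> 0) xi)).
  apply: i_eq => xi; have [-> ->] := FT_dual (2 * e n) xi lI (L1_0 R).
  rewrite box1E box2E /damp /phase /G1 /G2 /= mul0r !addr0 add0r -/I; ring.
rewrite Q /Phi -iZ; last exact: Phi_L1.
apply: i_eq => y.
have lc : L1 (fun xi => expR (- e n * xi ^+ 2) * cos ((x - y) * xi + 0 * xi ^+ 2)).
  apply: (L1_le _ _ (gauss_L1 (harmonic_gt0 n))); first by mf.
  by move=> xi; rewrite normrM ger0_norm ?expR_ge0// ler_piMr ?expR_ge0//; exact: cos_le1n.
have ls : L1 (fun xi => expR (- e n * xi ^+ 2) * sin ((x - y) * xi + 0 * xi ^+ 2)).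
  apply: (L1_le _ _ (gauss_L1 (harmonic_gt0 n))); first by mf.
  by move=> xi; rewrite normrM ger0_norm ?expR_ge0// ler_piMr ?expR_ge0//; exact: sin_le1n.
transitivity (\1_I y * (f1 x * Kc (e n) 0 (x - y) + f2 x * Ks (e n) 0 (x - y))).
  rewrite -(iZ (f1 x) lc) -(iZ (f2 x) ls) -iD; [|exact: L1Z|exact: L1Z].
  rewrite -iZ; last by apply: L1D; exact: L1Z.
  apply: i_eq => xi; rewrite /damp /phase /G1 /G2 /= !mul0r !addr0 add0r sub0r wE /w.
  have -> : (x - y) * xi = x * xi - y * xi by ring.
  by rewrite cosB sinB; ring.
  by rewrite Kc0E// Ks0E// mulr0 addr0 /gk; ring.
split; first by apply: L1_eq P0.
rewrite (i_eq (g := fun xi => box1 c d xi * dualA id (fun=> 0) (fun=> 0) (2 * e n) f1 f2 xi +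
   - box2 c d xi * dualB id (fun=> 0) (fun=> 0) (2 * e n) f1 f2 xi)); last first.
  by move=> xi; have [-> ->] := FT_dual (2 * e n) xi l1 l2; rewrite wE /h1 /h2; ring.
by rewrite P; apply: i_eq.
Qed.

Lemma FT_sum_L1 : L1 (fun xi => h1 xi ^+ 2 + h2 xi ^+ 2) .
Proof. by case: (plancherel_le l1 l2 l12). Qed.

(** Let the Gaussian factor in [smoothed] tend to 1 on both sides by dominated convergence; on the
    frequency side the sum of the two squared moduli is the majorant. *)
Lemma parseval_box : L1 (fun xi => box1 c d xi * FT1 f1 f2 xi - box2 c d xi * FT2 f1 f2 xi) /\
  \int[mu]_xi (box1 c d xi * FT1 f1 f2 xi - box2 c d xi * FT2 f1 f2 xi) =
  2 * pi * \int[mu]_(x in `[c, d]) f1 x.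
Proof.
have [mb1 mb2] := mbox; have [mh1 mh2] := FT_meas l1 l2; rewrite -/h1 -/h2 in mh1 mh2.
pose G xi := (box1 c d xi ^+ 2 + box2 c d xi ^+ 2) + (h1 xi ^+ 2 + h2 xi ^+ 2).
have lG : L1 G by apply: L1D; [exact: box_L2|exact: FT_sum_L1].
have le xi : `|box1 c d xi * h1 xi - box2 c d xi * h2 xi| <= G xi.
  rewrite /G ler_norml; have := sqr_ge0 (box1 c d xi - h1 xi); have := sqr_ge0 (box2 c d xi - h2 xi).
  have := sqr_ge0 (box1 c d xi + h1 xi); have := sqr_ge0 (box2 c d xi + h2 xi).
  by have := sqr_ge0 (h1 xi); have := sqr_ge0 (h2 xi); have := sqr_ge0 (box1 c d xi); have := sqr_ge0 (box2 c d xi); nra.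
have lP : L1 (fun xi => box1 c d xi * h1 xi - box2 c d xi * h2 xi).
  by apply: (L1_le _ le lG); mf.
split => //.
have w1 n xi : 0 <= w n xi <= 1.
  by rewrite expR_ge0 -expR0 ler_expR mulNr oppr_le0 mulr_ge0 ?sqr_ge0// ltW.
have [||||_ C1] := @dct R (fun n xi => w n xi * (box1 c d xi * h1 xi - box2 c d xi * h2 xi))
  (fun xi => box1 c d xi * h1 xi - box2 c d xi * h2 xi) G.
- by move=> n; rewrite /w; mf.
- move=> xi; rewrite -[X in _ --> X]mul1r; apply: cvgM; last exact: cvg_cst.
  rewrite -expR0; apply: continuous_cvg; first exact: continuous_expR.
  rewrite -[X in _ --> X](mul0r (xi ^+ 2)); apply: cvgM; last exact: cvg_cst.
  by rewrite -oppr0; apply: cvgN; exact: cvg_harmonic.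
- exact: lG.
- move=> n xi; rewrite normrM ger0_norm ?expR_ge0//; apply: le_trans (le xi).
  by rewrite ler_piMl//; case/andP: (w1 n xi).
have mf1 := L1_meas l1.
have C2 : \int[mu]_x (f1 x * Phi n x) @[n --> \oo] --> \int[mu]_x (f1 x * (2 * pi * \1_I x)).
  apply: (@dct_ae R _ _ (fun x => 2 * pi * `|f1 x|) _ _ _ _ _).2.
  - by move=> n; case: (smoothed n) => /L1_meas.
  - apply: m_mul => //; apply: m_mul; [exact: m_cst|apply: m_indic; exact: measurable_itv].
  - apply: (aeS _ (aeI (ae_neq c) (ae_neq d))) => x [xc xd].
    by apply: cvgM; [exact: cvg_cst|exact: Phi_cvg].
  - by apply: L1Z; exact: L1_norm.
  - apply: aeW => x n; have /andP[p0 p1] := Phi_bd n x.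
    by rewrite normrM mulrC (ger0_norm p0) ler_wpM2r.
have E : (fun n => \int[mu]_xi (w n xi * (box1 c d xi * h1 xi - box2 c d xi * h2 xi))) =
   (fun n => \int[mu]_x (f1 x * Phi n x)).
  by apply/funext => n; case: (smoothed n).
rewrite E in C1; transitivity (\int[mu]_x (f1 x * (2 * pi * \1_I x))).
  exact: (cvg_unique _ C1 C2).
rewrite [in RHS]i_set -iZ; last by apply: L1_indic => //; exact: measurable_itv.
by apply: i_eq => x; ring.
Qed.
End box_parseval.
End Parseval.

(** * Fourier inversion *)

Section FourierRelation.
Variable R : realType.
Local Notation mu := (@lebesgue_measure R).
Implicit Types f g : R -> R.

Lemma trig_bound (j p q z : R) :
  `|j * (cos z * p + sin z * q)| <= `|j * p| + `|j * q|.
Proof.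
rewrite mulrDr; apply: (le_trans (ler_normD _ _)).
rewrite (mulrCA j) (mulrCA j) [leLHS](_ : _ = `|cos z| * `|j * p| + `|sin z| * `|j * q|).
  by apply: lerD; rewrite ler_piMl// ?cos_le1n ?sin_le1n.
by rewrite -!normrM.
Qed.

Lemma L1_cosM (p f : R -> R) : measurable_fun setT p -> L1 f -> L1 (fun x => cos (p x) * f x).
Proof.
move=> mp lf; have mf := L1_meas lf; apply: (L1_le _ _ (L1_norm lf)); first by mf.
by move=> x; rewrite normrM ler_piMl// cos_le1n.
Qed.

Lemma L1_sinM (p f : R -> R) : measurable_fun setT p -> L1 f -> L1 (fun x => sin (p x) * f x).
Proof.
move=> mp lf; have mf := L1_meas lf; apply: (L1_le _ _ (L1_norm lf)); first by mf.
by move=> x; rewrite normrM ler_piMl// sin_le1n.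
Qed.

Definition sq f1 f2 (x : R) := f1 x ^+ 2 + f2 x ^+ 2.

Lemma sq_ge0 f1 f2 x : 0 <= sq f1 f2 x.
Proof. by rewrite addr_ge0 ?sqr_ge0. Qed.

Lemma m_sq f1 f2 : measurable_fun setT f1 -> measurable_fun setT f2 ->
  measurable_fun setT (sq f1 f2).
Proof. by move=> m1 m2; rewrite /sq; mf. Qed.

Lemma sqB_L1 f1 f2 g1 g2 : measurable_fun setT f1 -> measurable_fun setT f2 ->
  measurable_fun setT g1 -> measurable_fun setT g2 ->
  L1 (sq f1 f2) -> L1 (sq g1 g2) ->
  L1 (fun x => (f1 x - g1 x) ^+ 2 + (f2 x - g2 x) ^+ 2).
Proof.
move=> m1 m2 n1 n2 lf lg.
apply: (L1_le (g := fun x => 2 * sq f1 f2 x + 2 * sq g1 g2 x)); first by mf.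
  move=> x; rewrite ger0_norm ?addr_ge0 ?sqr_ge0// /sq.
  by have := sqr_ge0 (f1 x + g1 x); have := sqr_ge0 (f2 x + g2 x); nra.
by apply: L1D; exact: L1Z.
Qed.

Lemma cauchy_schwarz b1 b2 u1 u2 : measurable_fun setT b1 -> measurable_fun setT b2 ->
  measurable_fun setT u1 -> measurable_fun setT u2 ->
  L1 (sq b1 b2) -> L1 (sq u1 u2) ->
  L1 (fun x => b1 x * u1 x + b2 x * u2 x) /\
  (\int[mu]_x (b1 x * u1 x + b2 x * u2 x)) ^+ 2 <=
  (\int[mu]_x sq b1 b2 x) * (\int[mu]_x sq u1 u2 x).
Proof.
move=> m1 m2 n1 n2 lb lu.
have lp : L1 (fun x => b1 x * u1 x + b2 x * u2 x).
  apply: (L1_le (g := fun x => sq b1 b2 x + sq u1 u2 x)); [by mf| |exact: L1D].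
  move=> x; rewrite /sq ler_norml.
  have := sqr_ge0 (b1 x - u1 x); have := sqr_ge0 (b2 x - u2 x).
  have := sqr_ge0 (b1 x + u1 x); have := sqr_ge0 (b2 x + u2 x).
  have := sqr_ge0 (b1 x); have := sqr_ge0 (b2 x); have := sqr_ge0 (u1 x); have := sqr_ge0 (u2 x).
  by nra.
split => //.
set B := \int[mu]_x sq b1 b2 x; set U := \int[mu]_x sq u1 u2 x; set p := \int[mu]_x _.
have H t : 0 <= t ^+ 2 * B + 2 * t * p + U.
  rewrite /B /U /p -iZ// -iZ// -iD; [|exact: L1Z|exact: L1Z].
  rewrite -iD//; last by apply: L1D; exact: L1Z.
  apply: i_ge0 => x; rewrite /sq.
  have -> : t ^+ 2 * (b1 x ^+ 2 + b2 x ^+ 2) + 2 * t * (b1 x * u1 x + b2 x * u2 x) + (u1 x ^+ 2 + u2 x ^+ 2)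
    = (t * b1 x + u1 x) ^+ 2 + (t * b2 x + u2 x) ^+ 2 by ring.
  by rewrite addr_ge0 ?sqr_ge0.
have B0 : 0 <= B by apply: i_ge0 => x; exact: sq_ge0.
have U0 : 0 <= U by apply: i_ge0 => x; exact: sq_ge0.
have [B00|Bn0] := eqVneq B 0.
  rewrite B00 mul0r; rewrite B00 in H.
  have [->|pn0] := eqVneq p 0; first by rewrite expr0n.
  (* The quadratic form has degenerated to an affine function of t; this t gives it the value -1. *)
  have := H (- ((U + 1) / (2 * p))).
  have -> : (- ((U + 1) / (2 * p))) ^+ 2 * 0 + 2 * - ((U + 1) / (2 * p)) * p + U = -1 by field.
  by lra.
have := H (- (p / B)).
have -> : (- (p / B)) ^+ 2 * B + 2 * - (p / B) * p + U = (B * U - p ^+ 2) / B by field.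
by rewrite pmulr_lge0 ?invr_gt0 ?subr_ge0// lt_neqAle eq_sym Bn0.
Qed.

Lemma L2P f1 f2 : L2 f1 f2 <-> [/\ measurable_fun setT f1, measurable_fun setT f2 & L1 (sq f1 f2)].
Proof. by split=> [[? [? ?]]|[]]. Qed.

Local Notation J n := (`[- n%:R, n%:R]%classic : set R).

Lemma L1_ind (n : nat) : L1 (\1_(J n) : R -> R).
Proof. exact: integrable_indic_itv. Qed.

Section trunc.
Variables (f1 f2 : R -> R) (n : nat).
Hypotheses (m1 : measurable_fun setT f1) (m2 : measurable_fun setT f2) (l : L1 (sq f1 f2)).
Let mJ : measurable_fun setT (\1_(J n) : R -> R).
Proof. by apply: m_indic; exact: measurable_itv. Qed.

Lemma trunc_L1 : L1 (fun x => \1_(J n) x * f1 x) /\ L1 (fun x => \1_(J n) x * f2 x).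
Proof.
have l' : L1 (fun x => \1_(J n) x + sq f1 f2 x) by apply: L1D => //; exact: L1_ind.
split; apply: (L1_le _ _ l'); do ?[by apply: m_mul] => x; rewrite indicE /sq;
  case: (x \in _) => /=; rewrite ?mul0r ?mul1r ?normr0 ?add0r ?addr_ge0 ?sqr_ge0//.
- have := sqr_ge0 (`|f1 x| - 1); have := sqr_ge0 (f2 x); have := sqr_ge0 (f1 x).
  by have := real_normK (num_real (f1 x)); nra.
- have := sqr_ge0 (`|f2 x| - 1); have := sqr_ge0 (f1 x); have := sqr_ge0 (f2 x).
  by have := real_normK (num_real (f2 x)); nra.
Qed.

Lemma trunc_sq x : sq (fun x => \1_(J n) x * f1 x) (fun x => \1_(J n) x * f2 x) x = \1_(J n) x * sq f1 f2 x.
Proof.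
by rewrite /sq !exprMn -mulrDr indicE; case: (x \in _); rewrite /= ?expr1n ?expr0n.
Qed.

Lemma trunc_L2 : L1 (sq (fun x => \1_(J n) x * f1 x) (fun x => \1_(J n) x * f2 x)).
Proof.
have h : L1 (fun x => \1_(J n) x * sq f1 f2 x) by apply: L1_indic => //; exact: measurable_itv.
by apply: L1_eq h => x; rewrite trunc_sq.
Qed.

Lemma FT_truncE xi :
  FT_trunc_re f1 f2 n xi = FT1 (fun x => \1_(J n) x * f1 x) (fun x => \1_(J n) x * f2 x) xi /\
  FT_trunc_im f1 f2 n xi = FT2 (fun x => \1_(J n) x * f1 x) (fun x => \1_(J n) x * f2 x) xi.
Proof.
by split; rewrite [LHS]i_set; apply: i_eq => x; ring.
Qed.

Lemma FT_trunc_meas : measurable_fun setT (FT_trunc_re f1 f2 n) /\ measurable_fun setT (FT_trunc_im f1 f2 n).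
Proof.
have [t1 t2] := trunc_L1; have [h1 h2] := FT_meas t1 t2.
by split; [apply: eq_measurable_fun h1|apply: eq_measurable_fun h2] => xi _; case: (FT_truncE xi).
Qed.

Lemma FT_trunc_L2 : L1 (sq (FT_trunc_re f1 f2 n) (FT_trunc_im f1 f2 n)) /\
  \int[mu]_xi sq (FT_trunc_re f1 f2 n) (FT_trunc_im f1 f2 n) xi <= 2 * pi * \int[mu]_x (\1_(J n) x * sq f1 f2 x).
Proof.
have [t1 t2] := trunc_L1; have [h1 h2] := plancherel_le t1 t2 trunc_L2.
have e xi : FT1 (fun x => \1_(J n) x * f1 x) (fun x => \1_(J n) x * f2 x) xi ^+ 2 +
  FT2 (fun x => \1_(J n) x * f1 x) (fun x => \1_(J n) x * f2 x) xi ^+ 2 = sq (FT_trunc_re f1 f2 n) (FT_trunc_im f1 f2 n) xi.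
  by rewrite /sq; have [-> ->] := FT_truncE xi.
split; first by apply: L1_eq h1.
by move: h2; rewrite (i_eq e) (i_eq trunc_sq).
Qed.
End trunc.

Lemma fourier_cvgP f1 f2 g1 g2 : L2 f1 f2 -> L2 g1 g2 ->
  is_fourier f1 f2 g1 g2 <->
  \int[mu]_xi ((FT_trunc_re f1 f2 N xi - g1 xi) ^+ 2 + (FT_trunc_im f1 f2 N xi - g2 xi) ^+ 2) @[N --> \oo] --> (0:R).
Proof.
move=> lf lg; have /L2P[m1 m2 l] := lf; have /L2P[n1 n2 k] := lg.
have lN N : L1 (fun xi => (FT_trunc_re f1 f2 N xi - g1 xi) ^+ 2 + (FT_trunc_im f1 f2 N xi - g2 xi) ^+ 2).
  have [q1 q2] := FT_trunc_meas N m1 m2 l.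
  by apply: sqB_L1 => //; case: (FT_trunc_L2 N m1 m2 l).
have E : (fun N => (\int[mu]_xi ((FT_trunc_re f1 f2 N xi - g1 xi) ^+ 2 + (FT_trunc_im f1 f2 N xi - g2 xi) ^+ 2)%:E)%E) =
   EFin \o (fun N => \int[mu]_xi ((FT_trunc_re f1 f2 N xi - g1 xi) ^+ 2 + (FT_trunc_im f1 f2 N xi - g2 xi) ^+ 2)).
  by apply/funext => N /=; rewrite i_fin.
split.
- by move=> [_ [_]]; rewrite E => /fine_cvg.
- move=> h; split => //; split => //; rewrite E; apply: cvg_EFin; [exact: nearW|exact: h].
Qed.

(** This recovers f from its L^2 transform in the weak form used to identify limits. The truncated
    pairings are eventually constant in N, and by Cauchy-Schwarz they converge to the pairing with
    g. *)
Lemma fourier_box f1 f2 g1 g2 (c d : R) : c < d -> is_fourier f1 f2 g1 g2 ->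
  L1 (fun xi => box1 c d xi * g1 xi - box2 c d xi * g2 xi) /\
  \int[mu]_xi (box1 c d xi * g1 xi - box2 c d xi * g2 xi) = 2 * pi * \int[mu]_(x in `[c, d]) f1 x.
Proof.
move=> cd F; have [lf [lg _]] := F; have /L2P[m1 m2 l] := lf; have /L2P[n1 n2 k] := lg.
have /(fourier_cvgP lf lg) C := F.
have [b1 b2] := FT_meas (L1_itv c d) (L1_0 R).
have mb1 : measurable_fun setT (box1 c d) by apply: eq_measurable_fun b1 => xi _; rewrite box1E.
have mb2 : measurable_fun setT (box2 c d) by apply: eq_measurable_fun (m_opp b2) => xi _; rewrite box2E.
have lb : L1 (sq (box1 c d) (fun xi => - box2 c d xi)).
  by apply: L1_eq (box_L2 c d) => xi; rewrite /sq sqrrN.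
have [lp _] := cauchy_schwarz mb1 (m_opp mb2) n1 n2 lb k.
have lp' : L1 (fun xi => box1 c d xi * g1 xi - box2 c d xi * g2 xi).
  by apply: L1_eq lp => xi; rewrite mulNr.
split => //.
pose q N := \int[mu]_xi (box1 c d xi * FT_trunc_re f1 f2 N xi - box2 c d xi * FT_trunc_im f1 f2 N xi).
have qE N : L1 (fun xi => box1 c d xi * FT_trunc_re f1 f2 N xi - box2 c d xi * FT_trunc_im f1 f2 N xi) /\
   q N = 2 * pi * \int[mu]_(x in `[c, d]) (\1_(J N) x * f1 x).
  have [t1 t2] := trunc_L1 N m1 m2 l.
  have [P1 P2] := parseval_box cd t1 t2 (trunc_L2 N l).
  split; first by apply: L1_eq P1 => xi; have [-> ->] := FT_truncE f1 f2 N xi.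
  by rewrite -P2; apply: i_eq => xi; have [-> ->] := FT_truncE f1 f2 N xi.
have q1 N : `|c| + `|d| <= N%:R -> q N = 2 * pi * \int[mu]_(x in `[c, d]) f1 x.
  move=> hN; rewrite (qE N).2; apply: (congr1 (fun z => 2 * pi * z)).
  apply: eq_Rintegral => x; rewrite inE /= in_itv /= => /andP[cx xd].
  rewrite indicE mem_set ?mul1r//= in_itv/=.
  have := ler_norm d; have := ler_norm (- c); rewrite normrN.
  by have := normr_ge0 c; have := normr_ge0 d; lra.
have C1 : q N @[N --> \oo] --> 2 * pi * \int[mu]_(x in `[c, d]) f1 x.
  by apply: cvg_near_cst; near=> N; apply: q1; near: N; exact: nbhs_infty_ger.
have C2 : q N @[N --> \oo] --> \int[mu]_xi (box1 c d xi * g1 xi - box2 c d xi * g2 xi).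
  apply: cvg_zero; apply: norm_cvg0.
  set u := fun N => \int[mu]_xi ((FT_trunc_re f1 f2 N xi - g1 xi) ^+ 2 + (FT_trunc_im f1 f2 N xi - g2 xi) ^+ 2).
  pose B := \int[mu]_xi sq (box1 c d) (fun xi => - box2 c d xi) xi.
  have S : Num.sqrt (B * u N) @[N --> \oo] --> (0:R).
    rewrite -sqrtr0; apply: continuous_cvg; first exact: sqrt_continuous.
    by rewrite -[X in _ --> X](mulr0 B); apply: cvgM; [exact: cvg_cst|exact: C].
  apply: (squeeze_cvgr _ (cvg_cst (0:R)) S); near=> N.
  rewrite normr_ge0 /=.
  have [r1 r2] := FT_trunc_meas N m1 m2 l.
  have lu := sqB_L1 r1 r2 n1 n2 (FT_trunc_L2 N m1 m2 l).1 k.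
  have mu1 : measurable_fun setT (fun xi => FT_trunc_re f1 f2 N xi - g1 xi) by mf.
  have mu2 : measurable_fun setT (fun xi => FT_trunc_im f1 f2 N xi - g2 xi) by mf.
  have [_ H] := cauchy_schwarz mb1 (m_opp mb2) mu1 mu2 lb lu.
  have := ler_wsqrtr H; rewrite sqrtr_sqr; apply: le_trans.
  rewrite le_eqVlt; apply/orP; left; apply/eqP; congr (`| _ |).
  rewrite -[LHS]/(q N - _) /q -iB//; last by case: (qE N).
  by apply: i_eq => xi; ring.
exact: (cvg_unique _ C2 C1).
Unshelve. all: by end_near. Qed.

(** For real G the inverse transform is the conjugate of the direct one divided by 2 pi; hence the
    minus sign in [inv2]. *)
Definition inv1 (G : R -> R) x := (2 * pi)^-1 * FT1 G (fun=> 0) x.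
Definition inv2 (G : R -> R) x := - ((2 * pi)^-1 * FT2 G (fun=> 0) x).

(* Real functions satisfying Parseval's identity against every test function. *)
Definition inversive (G : R -> R) := [/\ L1 G, L1 (fun x => G x ^+ 2) &
  forall f1 f2, L1 f1 -> L1 f2 -> L1 (sq f1 f2) ->
  \int[mu]_xi (FT1 G (fun=> 0) xi * FT1 f1 f2 xi + FT2 G (fun=> 0) xi * FT2 f1 f2 xi) = 2 * pi * \int[mu]_x (G x * f1 x)].

Lemma inversive_itv (c d : R) : c < d -> inversive \1_(`[c, d]%classic).
Proof.
move=> cd; split.
- exact: L1_itv.
- by apply: L1_eq (L1_itv c d) => x; rewrite sqr_indic.
- move=> f1 f2 l1 l2 l; have [_] := parseval_box cd l1 l2 l.
  rewrite [X in _ = _ * X -> _]i_set => <-; apply: i_eq => xi.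
  by rewrite box1E box2E; ring.
Qed.

Lemma FT_lin G H (k : R) xi : L1 G -> L1 H ->
  FT1 (fun x => G x + k * H x) (fun=> 0) xi = FT1 G (fun=> 0) xi + k * FT1 H (fun=> 0) xi /\
  FT2 (fun x => G x + k * H x) (fun=> 0) xi = FT2 G (fun=> 0) xi + k * FT2 H (fun=> 0) xi.
Proof.
move=> lG lH.
have l f : L1 f -> L1 (fun x => cos (x * xi) * f x + sin (x * xi) * 0) /\ L1 (fun x => cos (x * xi) * 0 - sin (x * xi) * f x).
  move=> lf; have mf := L1_meas lf; split; apply: (L1_le _ _ (L1_norm lf)); try by mf.
  - by move=> x; rewrite mulr0 addr0 normrM ler_piMl// cos_le1n.
  - by move=> x; rewrite mulr0 sub0r normrN normrM ler_piMl// sin_le1n.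
have [l1 l2] := l _ lG; have [l3 l4] := l _ lH.
split; rewrite /FT1 /FT2 -iZ// -iD//; try (exact: L1Z); apply: i_eq => x; ring.
Qed.

Lemma inversive_lin G H (k : R) : inversive G -> inversive H -> inversive (fun x => G x + k * H x).
Proof.
move=> [lG lG2 PG] [lH lH2 PH].
have mG := L1_meas lG; have mH := L1_meas lH.
split.
- by apply: L1D => //; exact: L1Z.
- apply: (L1_le (g := fun x => 2 * G x ^+ 2 + 2 * k ^+ 2 * H x ^+ 2)); first by mf.
    by move=> x; rewrite ger0_norm ?sqr_ge0//; have := sqr_ge0 (G x - k * H x); nra.
  by apply: L1D; exact: L1Z.
- move=> f1 f2 l1 l2 l.
  have key K : L1 K -> L1 (fun x => K x ^+ 2) ->
     L1 (fun xi => FT1 K (fun=> 0) xi * FT1 f1 f2 xi + FT2 K (fun=> 0) xi * FT2 f1 f2 xi) /\ L1 (fun x => K x * f1 x).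
    move=> lK lK2; have [a1 a2] := FT_meas lK (L1_0 R); have [b1 b2] := FT_meas l1 l2.
    have lK3 : L1 (fun x => K x ^+ 2 + (fun=> 0) x ^+ 2) by apply: L1_eq lK2 => x; rewrite expr0n addr0.
    have [lFK _] := plancherel_le lK (L1_0 R) lK3.
    have [lFf _] := plancherel_le l1 l2 l.
    split; first by case: (cauchy_schwarz a1 a2 b1 b2 lFK lFf).
    have mK := L1_meas lK; have mf1 := L1_meas l1.
    have [h _] := cauchy_schwarz mK (@m_zero R) mf1 (L1_meas l2) lK3 l.
    by apply: L1_eq h => x; rewrite mul0r addr0.
  have [G1 G2] := key _ lG lG2; have [H1 H2] := key _ lH lH2.
  transitivity (2 * pi * \int[mu]_x (G x * f1 x) + k * (2 * pi * \int[mu]_x (H x * f1 x))).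
    rewrite -(PG f1 f2)// -(PH f1 f2)// -iZ// -iD//; last exact: L1Z.
    by apply: i_eq => xi; have [-> ->] := FT_lin k xi lG lH; ring.
  rewrite mulrCA -mulrDr; congr (_ * _); rewrite -iZ// -iD//; last exact: L1Z.
  by apply: i_eq => x; ring.
Qed.

Lemma inversive_0 : inversive (fun=> 0).
Proof.
have h := inversive_lin (-1) (inversive_itv (@ltr01 R)) (inversive_itv (@ltr01 R)).
rewrite (_ : (fun=> 0) = fun x => \1_(`[0, 1]%classic) x + -1 * \1_(`[0, 1]%classic) x)//.
by apply/funext => x; ring.
Qed.

Section inversion.
Variable G : R -> R.
Hypothesis IG : inversive G.
Let lG : L1 G. Proof. by case: IG. Qed.
Let lG2 : L1 (sq G (fun=> 0)).
Proof. by case: IG => _ h _; apply: L1_eq h => x; rewrite /sq expr0n addr0. Qed.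
Let p0 : 0 < 2 * pi :> R. Proof. by rewrite mulr_gt0// pi_gt0. Qed.

Lemma inv_meas : measurable_fun setT (inv1 G) /\ measurable_fun setT (inv2 G).
Proof. by have [a b] := FT_meas lG (L1_0 R); rewrite /inv1 /inv2; split; mf. Qed.

Lemma inv_sq x : sq (inv1 G) (inv2 G) x = (2 * pi)^-1 ^+ 2 * sq (FT1 G (fun=> 0)) (FT2 G (fun=> 0)) x.
Proof. by rewrite /sq /inv1 /inv2; set k := (2 * pi)^-1; ring. Qed.

Lemma inv_L2 : L1 (sq (inv1 G) (inv2 G)) /\
  \int[mu]_x sq (inv1 G) (inv2 G) x = (2 * pi)^-1 * \int[mu]_x G x ^+ 2.
Proof.
have [h _] := plancherel_le lG (L1_0 R) lG2.
split; first by apply: L1_eq (L1Z ((2 * pi)^-1 ^+ 2) h) => x; rewrite inv_sq.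
rewrite (i_eq inv_sq) iZ//; have [_ _ P] := IG.
have := P _ _ lG (L1_0 R) lG2.
rewrite (i_eq (g := sq (FT1 G (fun=> 0)) (FT2 G (fun=> 0)))) => [->|xi]; last by rewrite /sq !expr2.
rewrite (i_eq (f := fun x => G x * G x) (g := fun x => G x ^+ 2)); last by move=> x; rewrite expr2.
set k := (2 * pi)^-1; have k1 : k * (2 * pi) = 1 by rewrite mulVf ?gt_eqF.
by transitivity (k * (2 * pi) * (k * \int[mu]_x G x ^+ 2)); [ring|rewrite k1 mul1r].
Qed.

Let pK (z : R) : 2 * pi * ((2 * pi)^-1 * z) = z.
Proof. by rewrite mulrA mulfV ?mul1r// gt_eqF. Qed.

Lemma int_cos x : \int[mu]_xi (cos (x * xi) * G xi) = 2 * pi * inv1 G x.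
Proof. by rewrite pK; apply: i_eq => xi; rewrite mulr0 addr0 (mulrC x). Qed.

Lemma int_sin x : \int[mu]_xi (sin (x * xi) * G xi) = 2 * pi * inv2 G x.
Proof.
have ls : L1 (fun xi => sin (xi * x) * G xi) by apply: L1_sinM lG; mf.
rewrite mulrN pK (i_eq (g := fun xi => sin (xi * x) * G xi)); last by move=> xi; rewrite mulrC (mulrC x) mulrC.
have -> : FT2 G (fun=> 0) x = \int[mu]_xi (- (sin (xi * x) * G xi)).
  by apply: i_eq => xi; rewrite mulr0 sub0r.
by rewrite iN// opprK.
Qed.

(** Expand the squared distance of the truncated transform (A, B) to G. Fubini gives <A, G> = 2 pi
    m(N), with m(N) the mass of the truncated inverse, and Plancherel's inequality bounds the norm
    of (A, B) by the same quantity. What remains is |G|^2 - 2 pi m(N), which tends to 0 by the exact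
    identity [inv_L2]. *)
Lemma fourier_inv : is_fourier (inv1 G) (inv2 G) G (fun=> 0).
Proof.
have [m1 m2] := inv_meas; have [l i] := inv_L2.
have mG := L1_meas lG.
have lf : L2 (inv1 G) (inv2 G) by apply/L2P; split.
have lg : L2 G (fun=> 0) by apply/L2P; split => //; exact: m_cst.
apply/(fourier_cvgP lf lg).
pose m N := \int[mu]_x (\1_(J N) x * sq (inv1 G) (inv2 G) x).
have Cm : \int[mu]_x G x ^+ 2 - 2 * pi * m N @[N --> \oo] --> (0:R).
  have -> : 0 = \int[mu]_x G x ^+ 2 - 2 * pi * \int[mu]_x sq (inv1 G) (inv2 G) x.
    by rewrite i mulrA mulfV ?gt_eqF// mul1r subrr.
  apply: cvgB; first exact: cvg_cst.
  apply: cvgM; first exact: cvg_cst.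
  by have := i_trunc l; under eq_fun do rewrite i_set.
apply: (squeeze_cvgr _ (cvg_cst (0:R)) Cm); near=> N.
apply/andP; split; first by apply: i_ge0 => xi; rewrite addr_ge0 ?sqr_ge0.
have [q1 q2] := FT_trunc_meas N m1 m2 l.
have [k1 k2] := FT_trunc_L2 N m1 m2 l.
have [t1 t2] := trunc_L1 N m1 m2 l.
set A := FT_trunc_re _ _ N; set B := FT_trunc_im _ _ N.
have [lAG _] := cauchy_schwarz q1 q2 mG (@m_zero R) k1 lG2.
have lAG' : L1 (fun xi => A xi * G xi) by apply: L1_eq lAG => xi; rewrite mulr0 addr0.
have lGG : L1 (fun x => G x ^+ 2) by case: IG.
have -> : \int[mu]_xi ((A xi - G xi) ^+ 2 + (B xi - 0) ^+ 2) =
   \int[mu]_xi sq A B xi - 2 * \int[mu]_xi (A xi * G xi) + \int[mu]_xi G xi ^+ 2.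
  rewrite -iZ// -iB//; last exact: L1Z.
  rewrite -iD//; last by apply: L1B => //; exact: L1Z.
  by apply: i_eq => xi; rewrite /sq; ring.
have -> : \int[mu]_xi (A xi * G xi) = 2 * pi * m N.
  pose F (p : R * R) := G p.1 * (\1_(J N) p.2 * (cos (p.2 * p.1) * inv1 G p.2 + sin (p.2 * p.1) * inv2 G p.2)).
  have mJ : measurable_fun setT (\1_(J N) : R -> R) by apply: m_indic; exact: measurable_itv.
  have mF : measurable_fun setT F by rewrite /F; mf.
  have lGn := L1_norm lG.
  have lv := L1D (L1_norm t1) (L1_norm t2).
  have [|_ _ _ _ E] := fubini_dom mF lGn lv.
    by move=> xi x; rewrite /F /= normrM ler_wpM2l//; exact: trig_bound.
  transitivity (\int[mu]_xi \int[mu]_x F (xi, x)).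
    apply: i_eq => xi; rewrite /A; have [-> _] := FT_truncE (inv1 G) (inv2 G) N xi.
    have lh : L1 (fun x => \1_(J N) x * (cos (x * xi) * inv1 G x + sin (x * xi) * inv2 G x)).
      apply: (L1_le _ _ lv); first by mf.
      by move=> x; exact: trig_bound.
    rewrite /F /= (iZ _ lh) mulrC; congr (_ * _); apply: i_eq => x.
    by move: (inv1 G x) (inv2 G x) (\1_(J N) x) => p q j; ring.
  rewrite E /m -iZ; last by apply: L1_indic => //; exact: measurable_itv.
  apply: i_eq => x; rewrite /F /=.
  have lc : L1 (fun xi => cos (x * xi) * G xi) by apply: L1_cosM lG; mf.
  have ls : L1 (fun xi => sin (x * xi) * G xi) by apply: L1_sinM lG; mf.
  transitivity (\1_(J N) x * inv1 G x * \int[mu]_xi (cos (x * xi) * G xi) + \1_(J N) x * inv2 G x * \int[mu]_xi (sin (x * xi) * G xi)).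
    rewrite -(iZ (\1_(J N) x * inv1 G x) lc) -(iZ (\1_(J N) x * inv2 G x) ls) -iD; [|exact: L1Z|exact: L1Z].
    apply: i_eq => xi; move: (inv1 G x) (inv2 G x) (\1_(J N) x) (G xi) => p q j g; ring.
  by rewrite int_cos int_sin /sq; move: (inv1 G x) (inv2 G x) (\1_(J N) x) => p q j; ring.
by move: k2; rewrite -/A -/B -/(m N); lra.
Unshelve. all: by end_near. Qed.
End inversion.
End FourierRelation.

(** * Almost everywhere limits and L^2 limits of Fourier pairs *)

Section Limits.
Variable R : realType.
Local Notation mu := (@lebesgue_measure R).
Implicit Types f g : R -> R.

(** The upper limit is measurable everywhere and equals the limit wherever there is one; elsewhere
    its value is arbitrary. *)
Lemma measurable_limit (f_ : nat -> R -> R) : (forall n, measurable_fun setT (f_ n)) ->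
  exists2 v : R -> R, measurable_fun setT v & forall x (l : R), f_ n x @[n --> \oo] --> l -> v x = l.
Proof.
move=> mf; exists (fun x => fine (limn_esup (fun n => (f_ n x)%:E))).
  apply: (measurableT_comp (@fine_measurable _ setT measurableT)).
  by apply: measurable_fun_limn_esup => n; apply/measurable_EFinP.
move=> x l h; have h' : (f_ n x)%:E @[n --> \oo] --> l%:E by apply: cvg_EFin; [exact: nearW|exact: h].
have -> : limn_esup (fun n => (f_ n x)%:E) = l%:E.
  by rewrite limn_esup_lim; apply: cvg_lim => //; exact: cvg_esups.
by [].
Qed.

Lemma fatou_ae (f_ : nat -> R -> R) f (M : R) : (forall n, L1 (f_ n)) ->
  (forall n x, 0 <= f_ n x) -> measurable_fun setT f -> (forall x, 0 <= f x) ->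
  {ae mu, forall x, f_ n x @[n --> \oo] --> f x} ->
  (forall n, \int[mu]_x f_ n x <= M) ->
  L1 f /\ \int[mu]_x f x <= M.
Proof.
move=> lf f0 mf fp cf fM; apply: L1_of_le => //.
have mE n : measurable_fun setT (fun x => (f_ n x)%:E).
  by apply/measurable_EFinP; exact: L1_meas.
have -> : (\int[mu]_x (f x)%:E)%E = (\int[mu]_x limn_einf (fun n => (f_ n x)%:E))%E.
  apply: ae_eq_integral => //.
  - by apply/measurable_EFinP.
  - apply: (emeasurable_fun_cvg (fun n x => einfs (fun m => (f_ m x)%:E) n)) => [n|x _].
      exact: (measurable_fun_einfs mE).
    by rewrite limn_einf_lim; exact: is_cvg_einfs.
  - apply: aeS cf => x h _; apply/esym.
    rewrite limn_einf_lim; apply: cvg_lim => //.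
    by apply: cvg_einfs; apply: cvg_EFin; [exact: nearW|exact: h].
apply: (le_trans (fatou mu measurableT mE _)).
- by move=> n x _; rewrite lee_fin.
rewrite limn_einf_lim; apply: lime_le; first exact: is_cvg_einfs.
near=> n; apply: ereal_inf_le => /=.
exists (\int[mu]_x (f_ n x)%:E)%E; last by rewrite i_fin// lee_fin.
by exists n => /=.
Unshelve. all: by end_near. Qed.

(** By monotone convergence the supremum is integrable, hence finite almost everywhere. This turns
    maximal inequalities into pointwise bounds. *)
Lemma mono_ae_dominated (T : nat -> R -> R) (M : R) : (forall n, L1 (T n)) ->
  (forall n x, 0 <= T n x) -> (forall n x, T n x <= T n.+1 x) ->
  (forall n, \int[mu]_x T n x <= M) ->
  exists2 S : R -> R, L1 S & {ae mu, forall x n, T n x <= S x}.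
Proof.
move=> lT T0 Tm TM.
pose U x := limn (fun n => (T n x)%:E).
have mT n : measurable_fun setT (fun x => (T n x)%:E).
  by apply/measurable_EFinP; exact: L1_meas.
have hm x : {homo (fun n => (T n x)%:E) : n m / (n <= m)%N >-> (n <= m)%E}.
  by apply/nondecreasing_seqP => n; rewrite lee_fin.
have cU x : (fun n => (T n x)%:E) n @[n --> \oo] --> U x.
  by apply: ereal_nondecreasing_is_cvgn; exact: hm.
have iU : (\int[mu]_x U x <= M%:E)%E.
  have C := @cvg_monotone_convergence _ _ _ mu setT measurableT (fun n x => (T n x)%:E) mT
    (fun n x _ => T0 n x) (fun x _ => hm x).
  rewrite -(cvg_lim _ C)//; apply: lime_le; first by apply/cvg_ex; eexists; exact: C.
  by near=> n; rewrite i_fin// lee_fin.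
have U0 x : (0 <= U x)%E.
  by apply: lime_ge; [apply/cvg_ex; eexists; exact: cU|near=> n; rewrite lee_fin].
have lU : mu.-integrable setT U.
  apply/integrableP; split; first by apply: (emeasurable_fun_cvg _ _ mT) => x _; exact: cU.
  under eq_integral do rewrite gee0_abs//.
  by apply: (le_lt_trans iU); rewrite ltry.
exists (fun x => fine (U x)).
  have mS : measurable_fun setT (fun x => fine (U x)).
    apply: (measurableT_comp (@fine_measurable _ setT measurableT)).
    by have /integrableP[] := lU.
  have [] // := @L1_of_le R (fun x => fine (U x)) M mS (fun x => fine_ge0 (U0 x)).
  apply: (le_trans _ iU); apply: ge0_le_integral => //.
  - by move=> x _; rewrite lee_fin fine_ge0.
  - by apply/measurable_EFinP.
  - by have /integrableP[] := lU.
  - by move=> x _; have := U0 x; case: (U x) => //= _; exact: leey.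
have := integrable_ae measurableT lU; apply: aeS => x /(_ Logic.I) Ux n.
rewrite -lee_fin fineK//.
apply: lime_ge; first by apply/cvg_ex; eexists; exact: cU.
by near=> m; apply: (hm x); near: m; exact: nbhs_infty_ge.
Unshelve. all: by end_near. Qed.

(** Iterate (a + b)^2 <= 2 a^2 + 2 b^2, splitting off the first term each time. *)
Lemma sq_sum_le (u : nat -> R) n j :
  (\sum_(i < j) u (n + i)%N) ^+ 2 <= \sum_(i < j) 2 ^+ i.+1 * u (n + i)%N ^+ 2.
Proof.
elim: j n => [|j IH] n; first by rewrite !big_ord0 expr0n.
rewrite !big_ord_recl /= addn0 expr1.
set S := \sum_(i < j) _.
have -> : \sum_(i < j) 2 ^+ (bump 0 i).+1 * u (n + bump 0 i)%N ^+ 2 = 2 * \sum_(i < j) 2 ^+ i.+1 * u (n.+1 + i)%N ^+ 2.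
  by rewrite mulr_sumr; apply: eq_bigr => i _; rewrite /bump leq0n add1n addnS addSn exprS mulrA.
have -> : S = \sum_(i < j) u (n.+1 + i)%N.
  by apply: eq_bigr => i _; rewrite /bump leq0n add1n addnS addSn.
have := IH n.+1; set S' := \sum_(i < j) u _; set Q := \sum_(i < j) _.
by have := sqr_ge0 (u n - S'); nra.
Qed.

Lemma geo_sum_le (q : R) n : 0 <= q <= 2^-1 -> \sum_(i < n) q ^+ i <= 2.
Proof.
move=> /andP[q0 q1].
have h : \sum_(i < n) q ^+ i <= 2 - 2 * q ^+ n.
  elim: n => [|n IH]; first by rewrite big_ord0 expr0; lra.
  rewrite big_ord_recr /= exprS; have := exprn_ge0 n q0; move: IH; set S := \sum_(i < n) _ => IH h.
  have := ler_wpM2r h q1; lra.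
by apply: (le_trans h); rewrite gerBl mulr_ge0// exprn_ge0.
Qed.

Section L2series.
Variables (u : nat -> R -> R) (c : R).
Hypotheses (c0 : 0 <= c) (mu_ : forall k, measurable_fun setT (u k)) (lu : forall k, L1 (fun x => u k x ^+ 2))
  (iu : forall k, \int[mu]_x u k x ^+ 2 <= c * (8^-1) ^+ k).
Let S n x := \sum_(k < n) u k x.

Let mS n : measurable_fun setT (S n).
Proof. by rewrite /S; apply: measurable_sum. Qed.

Lemma L1_sum (h : nat -> R -> R) n : (forall k, L1 (h k)) ->
  L1 (fun x => \sum_(k < n) h k x) /\
  \int[mu]_x (\sum_(k < n) h k x) = \sum_(k < n) \int[mu]_x h k x.
Proof.
move=> lh; elim: n => [|n [IH1 IH2]].
  split; first by apply: L1_eq (L1_0 R) => x; rewrite big_ord0.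
  rewrite big_ord0 (i_eq (g := fun=> 0)); first by rewrite /Rintegral integral0.
  by move=> x; rewrite big_ord0.
have E x : \sum_(k < n.+1) h k x = \sum_(k < n) h k x + h n x by rewrite big_ord_recr.
split; first by apply: L1_eq (L1D IH1 (lh n)) => x; rewrite E.
by rewrite (i_eq E) iD// IH2 big_ord_recr.
Qed.

Let diff n j : L1 (fun x => (S (n + j) x - S n x) ^+ 2) /\
  \int[mu]_x (S (n + j) x - S n x) ^+ 2 <= 4 * c * (8^-1) ^+ n.
Proof.
have E x : S (n + j) x - S n x = \sum_(i < j) u (n + i)%N x.
  rewrite /S big_split_ord /=; ring.
have [l i] := @L1_sum (fun k x => 2 ^+ k.+1 * u (n + k)%N x ^+ 2) j (fun k => L1Z _ (lu _)).
have le x : (S (n + j) x - S n x) ^+ 2 <= \sum_(k < j) 2 ^+ k.+1 * u (n + k)%N x ^+ 2.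
  by rewrite E; exact: (sq_sum_le (u ^~ x)).
have l' : L1 (fun x => (S (n + j) x - S n x) ^+ 2).
  apply: (L1_le _ _ l); first by have h1 := mS (n + j); have h2 := mS n; mf.
  by move=> x; rewrite ger0_norm ?sqr_ge0.
split => //; apply: (le_trans (i_le l' l le)); rewrite i.
apply: (@le_trans _ _ (\sum_(k < j) 2 * c * 8^-1 ^+ n * (4^-1) ^+ k)).
  apply: ler_sum => k _; rewrite iZ//.
  apply: (le_trans (ler_wpM2l _ (iu _))); first by rewrite exprn_ge0.
  rewrite le_eqVlt; apply/orP; left; apply/eqP.
  have -> : 4^-1 ^+ k = 2 ^+ k * 8^-1 ^+ k :> R by rewrite -exprMn; congr (_ ^+ _); lra.
  by rewrite exprS exprD; ring.
rewrite -mulr_sumr.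
have h := @geo_sum_le (4^-1) j _; have {}h := h ltac:(lra).
have : 0 <= 2 * c * 8^-1 ^+ n by rewrite !mulr_ge0 ?exprn_ge0.
by move=> p; apply: (le_trans (ler_wpM2l p h)); lra.
Qed.

Let bounded : {ae mu, forall x, exists B, forall n, \sum_(k < n) 2 ^+ k * u k x ^+ 2 <= B}.
Proof.
have h n := @L1_sum (fun k x => 2 ^+ k * u k x ^+ 2) n (fun k => L1Z _ (lu _)).
have [||||U _ hU] := @mono_ae_dominated (fun n x => \sum_(k < n) 2 ^+ k * u k x ^+ 2) (2 * c); last by apply: aeS hU => x hx; exists (U x).
- by move=> n; case: (h n).
- by move=> n x; apply: sumr_ge0 => k _; apply: mulr_ge0; [exact: exprn_ge0|exact: sqr_ge0].
- by move=> n x; rewrite big_ord_recr /= lerDl; apply: mulr_ge0; [exact: exprn_ge0|exact: sqr_ge0].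
- move=> n; rewrite (h n).2.
  apply: (@le_trans _ _ (\sum_(k < n) c * (4^-1) ^+ k)).
    apply: ler_sum => k _; rewrite iZ//.
    apply: (le_trans (ler_wpM2l _ (iu _))); first by rewrite exprn_ge0.
    rewrite le_eqVlt; apply/orP; left; apply/eqP.
    have -> : 4^-1 ^+ k = 2 ^+ k * 8^-1 ^+ k :> R by rewrite -exprMn; congr (_ ^+ _); lra.
    by ring.
  rewrite -mulr_sumr.
  have hh := @geo_sum_le (4^-1) n _; have {}hh := hh ltac:(lra).
  by apply: (le_trans (ler_wpM2l c0 hh)); lra.
Qed.

Lemma series_cvg_of_bound (a : nat -> R) (B : R) : (forall n, \sum_(k < n) `|a k| <= B) ->
  cvgn (fun n => \sum_(k < n) a k).
Proof.
move=> h.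
have E (b : nat -> R) : (fun n => \sum_(k < n) b k) = series b.
  by apply/funext => n; rewrite /series /= big_mkord.
rewrite E; apply: normed_cvg; rewrite /normed_series_of /=.
have -> : [series `|a n|]_n = (fun n => \sum_(k < n) `|a k|) by rewrite -(E (fun k => `|a k|)).
apply: nondecreasing_is_cvgn.
  by apply/nondecreasing_seqP => n; rewrite big_ord_recr /= lerDl.
by exists B => _ [n _ <-].
Qed.

Let u_cvg : {ae mu, forall x, cvgn (S ^~ x)}.
Proof.
apply: aeS bounded => x [B hB].
apply: (@series_cvg_of_bound (u ^~ x) (2 + B)) => n.
apply: (@le_trans _ _ (\sum_(k < n) (2^-1 ^+ k + 2 ^+ k * u k x ^+ 2))).
  apply: ler_sum => k _.
  have k0 : 0 < 2 ^+ k :> R by rewrite exprn_gt0.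
  rewrite exprVn; set q := 2 ^+ k in k0 *.
  have -> : q^-1 + q * u k x ^+ 2 = `|u k x| + q^-1 * ((1 - q * `|u k x| / 2) ^+ 2 + 3 / 4 * (q * `|u k x|) ^+ 2).
    by rewrite -(real_normK (num_real (u k x))); field; rewrite gt_eqF.
  rewrite lerDl; apply: mulr_ge0; first by rewrite invr_ge0 ltW.
  by rewrite addr_ge0 ?sqr_ge0// mulr_ge0 ?sqr_ge0.
rewrite big_split /=; apply: lerD; [apply: geo_sum_le; lra|exact: hB].
Qed.

(** The rate 8^(-k) leaves room for weights 2^k: with them, |u| <= 2^(-k) + 2^k u^2 gives pointwise
    absolute convergence almost everywhere, and [sq_sum_le] gives the norms of the tails, which
    Fatou's lemma passes to the limit. *)
Lemma L2_series : exists v : R -> R, [/\ measurable_fun setT v, L1 (fun x => v x ^+ 2) &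
  forall n, L1 (fun x => (v x - S n x) ^+ 2) /\ \int[mu]_x (v x - S n x) ^+ 2 <= 4 * c * (8^-1) ^+ n].
Proof.
have [v mv vE] := measurable_limit mS.
have cv : {ae mu, forall x, S n x @[n --> \oo] --> v x}.
  by apply: aeS u_cvg => x cx; rewrite (vE x _ cx).
have D n : L1 (fun x => (v x - S n x) ^+ 2) /\ \int[mu]_x (v x - S n x) ^+ 2 <= 4 * c * (8^-1) ^+ n.
  have mSn := mS n.
  apply: (@fatou_ae (fun j x => (S (n + j) x - S n x) ^+ 2)).
  - by move=> j; case: (diff n j).
  - by move=> j x; rewrite sqr_ge0.
  - by mf.
  - by move=> x; rewrite sqr_ge0.
  - apply: aeS cv => x h; rewrite expr2; under eq_fun do rewrite expr2.
    have hh : S (n + j) x - S n x @[j --> \oo] --> v x - S n x.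
      apply: cvgB; last exact: cvg_cst.
      rewrite (_ : (fun j => S (n + j) x) = (fun j => S (j + n) x)).
        by rewrite (cvg_shiftn n (S ^~ x)).
      by apply/funext => j; rewrite addnC.
    exact: cvgM.
  - by move=> j; case: (diff n j).
exists v; split => //.
by have [l _] := D 0; apply: L1_eq l => x; rewrite /S big_ord0 subr0.
Qed.
End L2series.

Local Notation sqd f1 f2 g1 g2 := (fun x => (f1 x - g1 x) ^+ 2 + (f2 x - g2 x) ^+ 2).

(** Fourier pairs are closed under L^2 limits, because truncated transforms are bounded on L^2
    uniformly in the truncation. *)
Lemma fourier_lim (F1 F2 G1 G2 : nat -> R -> R) f1 f2 g1 g2 :
  (forall k, is_fourier (F1 k) (F2 k) (G1 k) (G2 k)) -> L2 f1 f2 -> L2 g1 g2 ->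
  \int[mu]_x sqd f1 f2 (F1 k) (F2 k) x @[k --> \oo] --> (0:R) ->
  \int[mu]_x sqd g1 g2 (G1 k) (G2 k) x @[k --> \oo] --> (0:R) ->
  is_fourier f1 f2 g1 g2.
Proof.
move=> FG lf lg CF CG; apply/(fourier_cvgP lf lg).
have /L2P[m1 m2 l] := lf; have /L2P[n1 n2 k] := lg.
apply/cvgrPdist_le => e e0.
(* Three errors of e/9 each, times the factor 3 from squaring a sum of three terms; the first error
   pays Plancherel's constant 2 pi. *)
have c1 : 0 < e / (9 * (2 * pi)) by rewrite divr_gt0// !mulr_gt0// pi_gt0.
have c2 : 0 < e / 9 by rewrite divr_gt0.
have /cvgrPdist_le/(_ _ c1) A1 := CF.
have /cvgrPdist_le/(_ _ c2) A2 := CG.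
have [K [K1 K2]] : exists K, \int[mu]_x sqd f1 f2 (F1 K) (F2 K) x <= e / (9 * (2 * pi)) /\
    \int[mu]_x sqd g1 g2 (G1 K) (G2 K) x <= e / 9.
  near \oo => K; exists K; split.
  - have : `|0 - \int[mu]_x sqd f1 f2 (F1 K) (F2 K) x| <= e / (9 * (2 * pi)) by near: K.
    by rewrite sub0r normrN; apply: le_trans; exact: ler_norm.
  - have : `|0 - \int[mu]_x sqd g1 g2 (G1 K) (G2 K) x| <= e / 9 by near: K.
    by rewrite sub0r normrN; apply: le_trans; exact: ler_norm.
have [lF [lG _]] := FG K; have /L2P[M1 M2 L] := lF; have /L2P[N1 N2 LG] := lG.
have /(fourier_cvgP lF lG)/cvgrPdist_le/(_ _ c2) A3 := FG K.
have mF1 : measurable_fun setT (fun x => f1 x - F1 K x) by mf.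
have mF2 : measurable_fun setT (fun x => f2 x - F2 K x) by mf.
have ld : L1 (sq (fun x => f1 x - F1 K x) (fun x => f2 x - F2 K x)) by exact: sqB_L1.
near=> N.
rewrite sub0r normrN ger0_norm; last by apply: i_ge0 => xi; rewrite addr_ge0 ?sqr_ge0.
have B3 : \int[mu]_xi sqd (FT_trunc_re (F1 K) (F2 K) N) (FT_trunc_im (F1 K) (F2 K) N) (G1 K) (G2 K) xi <= e / 9.
  have : `|0 - \int[mu]_xi sqd (FT_trunc_re (F1 K) (F2 K) N) (FT_trunc_im (F1 K) (F2 K) N) (G1 K) (G2 K) xi| <= e / 9 by near: N.
  by rewrite sub0r normrN; apply: le_trans; exact: ler_norm.
have [a1 a2] := FT_trunc_meas N m1 m2 l; have [b1 b2] := FT_trunc_meas N M1 M2 L.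
have [la _] := FT_trunc_L2 N m1 m2 l; have [lb _] := FT_trunc_L2 N M1 M2 L.
have [d1 d2] := FT_trunc_meas N mF1 mF2 ld.
have [lt it] := FT_trunc_L2 N mF1 mF2 ld.
have lin xi : FT_trunc_re (fun x => f1 x - F1 K x) (fun x => f2 x - F2 K x) N xi =
     FT_trunc_re f1 f2 N xi - FT_trunc_re (F1 K) (F2 K) N xi /\
   FT_trunc_im (fun x => f1 x - F1 K x) (fun x => f2 x - F2 K x) N xi =
     FT_trunc_im f1 f2 N xi - FT_trunc_im (F1 K) (F2 K) N xi.
  have [p1 p2] := trunc_L1 N m1 m2 l; have [q1 q2] := trunc_L1 N M1 M2 L.
  have mc : measurable_fun setT (fun x : R => x * xi) by mf.
  have [-> ->] := FT_truncE f1 f2 N xi; have [-> ->] := FT_truncE (F1 K) (F2 K) N xi.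
  have [-> ->] := FT_truncE (fun x => f1 x - F1 K x) (fun x => f2 x - F2 K x) N xi.
  split; rewrite /FT1 /FT2 -iB.
  - by apply: i_eq => x; ring.
  - by apply: L1D; [exact: L1_cosM|exact: L1_sinM].
  - by apply: L1D; [exact: L1_cosM|exact: L1_sinM].
  - by apply: i_eq => x; ring.
  - by apply: L1B; [exact: L1_cosM|exact: L1_sinM].
  - by apply: L1B; [exact: L1_cosM|exact: L1_sinM].
have B1 : \int[mu]_xi sqd (FT_trunc_re f1 f2 N) (FT_trunc_im f1 f2 N) (FT_trunc_re (F1 K) (F2 K) N) (FT_trunc_im (F1 K) (F2 K) N) xi <= e / 9.
  rewrite (i_eq (g := sq (FT_trunc_re (fun x => f1 x - F1 K x) (fun x => f2 x - F2 K x) N)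
     (FT_trunc_im (fun x => f1 x - F1 K x) (fun x => f2 x - F2 K x) N))); last first.
    by move=> xi; rewrite /sq; have [-> ->] := lin xi.
  apply: (le_trans it).
  have h : \int[mu]_x (\1_(`[- N%:R, N%:R]%classic) x * sq (fun x => f1 x - F1 K x) (fun x => f2 x - F2 K x) x) <= e / (9 * (2 * pi)).
    apply: le_trans K1; apply: i_le => //.
      by apply: L1_indic => //; exact: measurable_itv.
    move=> x; have /andP[i0 i1] := indic_le1 `[- N%:R, N%:R]%classic x.
    by rewrite ler_piMl// sq_ge0.
  have p0 : 0 < 2 * pi :> R by rewrite mulr_gt0// pi_gt0.
  apply: (le_trans (ler_wpM2l (ltW p0) h)); rewrite le_eqVlt; apply/orP; left; apply/eqP.
  set P := 2 * pi in p0 *; by field; rewrite gt_eqF.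
have l1 : L1 (sqd (FT_trunc_re f1 f2 N) (FT_trunc_im f1 f2 N) (FT_trunc_re (F1 K) (F2 K) N) (FT_trunc_im (F1 K) (F2 K) N)) by exact: sqB_L1.
have l2 : L1 (sqd (FT_trunc_re (F1 K) (F2 K) N) (FT_trunc_im (F1 K) (F2 K) N) (G1 K) (G2 K)) by exact: sqB_L1.
have l3 : L1 (sqd g1 g2 (G1 K) (G2 K)) by exact: sqB_L1.
have l4 : L1 (sqd (FT_trunc_re f1 f2 N) (FT_trunc_im f1 f2 N) g1 g2) by exact: sqB_L1.
apply: (@le_trans _ _ (3 * (\int[mu]_xi sqd (FT_trunc_re f1 f2 N) (FT_trunc_im f1 f2 N) (FT_trunc_re (F1 K) (F2 K) N) (FT_trunc_im (F1 K) (F2 K) N) xi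
  + \int[mu]_xi sqd (FT_trunc_re (F1 K) (F2 K) N) (FT_trunc_im (F1 K) (F2 K) N) (G1 K) (G2 K) xi
  + \int[mu]_xi sqd g1 g2 (G1 K) (G2 K) xi))); last by lra.
rewrite -iD// -iD//; last exact: L1D.
rewrite -iZ; last by apply: L1D => //; exact: L1D.
apply: i_le => //; first by apply: L1Z; apply: L1D => //; exact: L1D.
move=> xi.
have key (p q r s : R) : (p - q) ^+ 2 <= 3 * ((p - r) ^+ 2 + (r - s) ^+ 2 + (q - s) ^+ 2).
  have := sqr_ge0 ((p - r) - (r - s)); have := sqr_ge0 ((p - r) + (q - s)); have := sqr_ge0 ((r - s) + (q - s)).
  by nra.
have := key (FT_trunc_re f1 f2 N xi) (g1 xi) (FT_trunc_re (F1 K) (F2 K) N xi) (G1 K xi).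
have := key (FT_trunc_im f1 f2 N xi) (g2 xi) (FT_trunc_im (F1 K) (F2 K) N xi) (G2 K xi).
by lra.
Unshelve. all: by end_near. Qed.

(** The inverse transforms of the terms inherit the geometric decay, as [inv_L2] only loses the
    factor (2 pi)^(-1) <= 1; hence they also sum in L^2, and [fourier_lim] applies to the partial
    sums. *)
Lemma fourier_series (h : nat -> R -> R) (c : R) g : 0 <= c ->
  (forall k, inversive (h k)) -> (forall k, \int[mu]_x h k x ^+ 2 <= c * (8^-1) ^+ k) ->
  measurable_fun setT g -> L1 (fun x => g x ^+ 2) ->
  \int[mu]_x (g x - \sum_(k < n) h k x) ^+ 2 @[n --> \oo] --> (0:R) ->
  exists f1 f2, is_fourier f1 f2 g (fun=> 0).
Proof.
move=> c0 Ih ih mg lg Cg.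
have p0 : 0 < 2 * pi :> R by rewrite mulr_gt0// pi_gt0.
have ISn n : inversive (fun x => \sum_(k < n) h k x).
  elim: n => [|n IH].
    by rewrite (_ : (fun x => _) = fun=> 0); [exact: inversive_0|apply/funext => x; rewrite big_ord0].
  rewrite (_ : (fun x => _) = fun x => \sum_(k < n) h k x + 1 * h n x); first exact: inversive_lin.
  by apply/funext => x; rewrite big_ord_recr /= mul1r.
have invS n x : inv1 (fun x => \sum_(k < n) h k x) x = \sum_(k < n) inv1 (h k) x /\
   inv2 (fun x => \sum_(k < n) h k x) x = \sum_(k < n) inv2 (h k) x.
  elim: n => [|n [IH1 IH2]].
    rewrite !big_ord0 (_ : (fun x => _) = fun=> 0); last by apply/funext => y; rewrite big_ord0.
    have z : FT1 (fun=> 0) (fun=> 0) x = 0 /\ FT2 (fun=> 0) (fun=> 0) x = 0.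
      split; rewrite -[RHS](_ : \int[mu]_y 0 = 0 :> R); try (by rewrite /Rintegral integral0);
      apply: i_eq => y; ring.
    by rewrite /inv1 /inv2; have [-> ->] := z; rewrite mulr0 oppr0.
  rewrite !big_ord_recr /= -IH1 -IH2.
  rewrite (_ : (fun x => \sum_(k < n.+1) _) = fun x => \sum_(k < n) h k x + 1 * h n x); last first.
    by apply/funext => y; rewrite big_ord_recr /= mul1r.
  have [lS _ _] := ISn n; have [lh _ _] := Ih n.
  have [e1 e2] := FT_lin 1 x lS lh.
  by rewrite /inv1 /inv2 e1 e2 !mul1r; split; ring.
have bd (w : (R -> R) -> R -> R) : (forall G, inversive G -> measurable_fun setT (w G)) ->
    (forall G x, w G x ^+ 2 <= sq (inv1 G) (inv2 G) x) ->
    forall k, [/\ measurable_fun setT (w (h k)), L1 (fun x => w (h k) x ^+ 2) & \int[mu]_x w (h k) x ^+ 2 <= c * (8^-1) ^+ k].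
  move=> mw ws k; have [l i] := inv_L2 (Ih k).
  have lw : L1 (fun x => w (h k) x ^+ 2).
    apply: (L1_le _ _ l); first by have h1 := mw _ (Ih k); mf.
    by move=> x; rewrite ger0_norm ?sqr_ge0.
  split => //; first exact: mw.
  apply: (le_trans (i_le lw l (ws _))); rewrite i; apply: le_trans (ih k).
  rewrite ler_piMl//; first by apply: i_ge0 => x; rewrite sqr_ge0.
  by rewrite invf_le1//; have := @pi_ge2 R; lra.
have b1 := bd (@inv1 R) (fun G IG => (inv_meas IG).1) _.
have {}b1 : forall k, [/\ measurable_fun setT (inv1 (h k)), L1 (fun x => inv1 (h k) x ^+ 2) & \int[mu]_x inv1 (h k) x ^+ 2 <= c * (8^-1) ^+ k].
  by apply: b1 => G x; rewrite /sq lerDl sqr_ge0.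
have b2 : forall k, [/\ measurable_fun setT (inv2 (h k)), L1 (fun x => inv2 (h k) x ^+ 2) & \int[mu]_x inv2 (h k) x ^+ 2 <= c * (8^-1) ^+ k].
  by apply: (bd (@inv2 R) (fun G IG => (inv_meas IG).2)) => G x; rewrite /sq lerDr sqr_ge0.
have [v1 [mv1 lv1 V1]] := @L2_series (fun k => inv1 (h k)) c c0 (fun k => let: And3 a _ _ := b1 k in a)
   (fun k => let: And3 _ a _ := b1 k in a) (fun k => let: And3 _ _ a := b1 k in a).
have [v2 [mv2 lv2 V2]] := @L2_series (fun k => inv2 (h k)) c c0 (fun k => let: And3 a _ _ := b2 k in a)
   (fun k => let: And3 _ a _ := b2 k in a) (fun k => let: And3 _ _ a := b2 k in a).
exists v1, v2.
apply: (@fourier_lim (fun n => inv1 (fun x => \sum_(k < n) h k x)) (fun n => inv2 (fun x => \sum_(k < n) h k x))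
  (fun n x => \sum_(k < n) h k x) (fun n => fun=> 0)).
- by move=> n; exact: fourier_inv.
- by apply/L2P; split => //; exact: L1D.
- apply/L2P; split; [exact: mg|exact: m_cst|].
  by apply: L1_eq lg => x; rewrite /sq expr0n addr0.
- have z : 8 * c * (8^-1) ^+ n @[n --> \oo] --> (0:R).
    rewrite -[X in _ --> X](mulr0 (8 * c)); apply: cvgM; first exact: cvg_cst.
    by apply: cvg_expr; rewrite ger0_norm; lra.
  apply: (squeeze_cvgr _ (cvg_cst (0:R)) z); near=> n; apply/andP; split.
    by apply: i_ge0 => x; rewrite addr_ge0 ?sqr_ge0.
  have [p1 p2] := V1 n; have [q1 q2] := V2 n.
  rewrite (i_eq (g := fun x => (v1 x - \sum_(k < n) inv1 (h k) x) ^+ 2 + (v2 x - \sum_(k < n) inv2 (h k) x) ^+ 2)).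
    by rewrite iD//; lra.
  by move=> x; have [-> ->] := invS n x.
- by under eq_fun => n do (under i_eq do rewrite subr0 expr0n addr0).
Unshelve. all: by end_near. Qed.
End Limits.

(** * Kernel estimates *)

Section KernelLog.
Variable R : realType.

Lemma powR_pos_ln (x p : R) : 0 < x -> x `^ p = expR (p * ln x).
Proof. by move=> x0; rewrite /powR gt_eqF. Qed.

Lemma ln_sqr (x : R) : 0 < x -> ln (x ^+ 2) = 2 * ln x.
Proof. by move=> x0; rewrite lnXn// mulr_natl. Qed.

Lemma lnMp (x y : R) : 0 < x -> 0 < y -> ln (x * y) = ln x + ln y.
Proof. by move=> x0 y0; rewrite lnM. Qed.

Lemma lnDp (x y : R) : 0 < x -> 0 < y -> ln (x / y) = ln x - ln y.
Proof. by move=> x0 y0; rewrite ln_div. Qed.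

Lemma sqrtE_ln (x : R) : 0 < x -> Num.sqrt x = expR (ln x / 2).
Proof.
move=> x0; apply/eqP; rewrite -(@eqrXn2 _ 2)// ?sqrtr_ge0 ?expR_ge0//.
by rewrite sqr_sqrtr ?ltW// expr2 -expRD -splitr lnK.
Qed.

(* [expR l] is the frequency, [gt] stands for [min gamma 1], and [tau] is the time
   separation, which dominates the distance [r] in this regime. *)
Lemma kernel_near (a tau l r c sigma alpha gt : R) :
  0 < a -> 0 < sigma < 2^-1 -> 0 < alpha -> 0 < gt -> 0 < r -> 0 < c ->
  tau != 0 -> - (2 * l) <= ln a -> gt * ln `|tau| <= ln a \/ gt * ln `|tau| <= ln `|tau| ->
  ln (c * r) <= alpha * ln `|tau| ->
  pi / Num.sqrt (a ^+ 2 + tau ^+ 2) <=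
  (Num.sqrt pi * expR (2 * sigma * l) * (c * r) `^ (- (gt * (1 - 2 * sigma) / (2 * alpha)))) ^+ 2.
Proof.
move=> a0 /andP[s0 s1] al0 gt0 r0 c0 t0 la lt lr.
have D0 : 0 < a ^+ 2 + tau ^+ 2 by apply: ltr_pwDl; rewrite ?exprn_gt0 ?sqr_ge0.
rewrite 2!exprMn sqr_sqrtr ?pi_ge0// -mulrA ler_pM2l ?pi_gt0//.
rewrite (sqrtE_ln D0) -expRN (powR_pos_ln _ (mulr_gt0 c0 r0)) !expr2 -!expRD ler_expR.
(* Split -d as - 2 sigma d - (1 - 2 sigma) d. In the first part d >= ln a >= - 2 l produces the
   frequency factor; in the second d >= gt ln |tau| produces the power of r. *)
set d := ln (a ^+ 2 + tau ^+ 2) / 2.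
have d1 : ln a <= d.
  by rewrite ler_pdivlMr// mulrC -ln_sqr// ler_ln ?posrE ?exprn_gt0// lerDl sqr_ge0.
have d2 : ln `|tau| <= d.
  rewrite ler_pdivlMr// mulrC -ln_sqr ?normr_gt0//.
  by rewrite ler_ln ?posrE ?exprn_gt0 ?normr_gt0// real_normK ?num_real// lerDr sqr_ge0.
have d3 : gt * ln `|tau| <= d by case: lt => h; apply: (le_trans h).
have q0 : 0 <= gt * (1 - 2 * sigma) / (2 * alpha).
  by rewrite divr_ge0 ?mulr_ge0// ?subr_ge0; lra.
have q1 : gt * (1 - 2 * sigma) / (2 * alpha) * ln (c * r) <= (1 - 2 * sigma) * (gt * ln `|tau|) / 2.
  apply: (le_trans (ler_wpM2l q0 lr)); rewrite le_eqVlt; apply/orP; left; apply/eqP.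
  by field; lra.
have q2 : (1 - 2 * sigma) * (gt * ln `|tau|) <= (1 - 2 * sigma) * d by rewrite ler_wpM2l//; lra.
have q3 : sigma * - (2 * l) <= sigma * d by apply: ler_wpM2l; [exact: ltW|clear -la d1; lra].
move: (gt * (1 - 2 * sigma) / (2 * alpha)) q1 => q q1.
move: (ln (c*r)) (gt * ln `|tau|) q1 q2 => z w q1 q2.
by lra.
Qed.

(** This is e^(-u) <= u^(-th), written so that the kernel estimate becomes linear in logarithms. *)
Lemma expN_powR (u th : R) : 0 < u -> 0 <= th <= 1 -> expR (- u) <= expR (- (th * ln u)).
Proof.
move=> u0 /andP[h0 h1]; rewrite ler_expR lerN2.
have lu : ln u <= u - 1.
  by have := expR_ge1Dx (ln u); rewrite lnK// => h; lra.
by case: (lerP (ln u) 0) => h; nra.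
Qed.

(* The complementary regime, where the separation [y] of the curves dominates [r];
   the Gaussian factor is estimated by [expN_powR]. *)
Lemma kernel_far (a tau l r c sigma gamma th y : R) :
  0 < a -> 0 < gamma -> 0 < sigma -> 2^-1 <= th < 1 -> 0 < r -> 0 < c -> 0 <= l ->
  1 - th <= 2 * sigma -> th - (2 * th - 1) / gamma <= 2 * sigma ->
  `|tau| <= 1 -> - (2 * l) <= ln a -> (tau != 0 -> gamma * ln `|tau| <= ln a) ->
  c * r <= `|y| ->
  pi / Num.sqrt (a ^+ 2 + tau ^+ 2) * expR (- (y ^+ 2 * a / (2 * (a ^+ 2 + tau ^+ 2)))) <=
  (Num.sqrt pi * 4 * expR (2 * sigma * l) * (c * r) `^ (- th)) ^+ 2.
Proof.
move=> a0 g0 s0 /andP[th0 th1] r0 c0 l0 e1 e2 tle la ltau ry.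
have D0 : 0 < a ^+ 2 + tau ^+ 2 by apply: ltr_pwDl; rewrite ?exprn_gt0 ?sqr_ge0.
have cr0 := mulr_gt0 c0 r0.
have y0 : 0 < `|y| by apply: lt_le_trans ry.
have y20 : 0 < y ^+ 2 by rewrite -(real_normK (num_real y)) exprn_gt0.
set D := a ^+ 2 + tau ^+ 2 in D0 *.
have u0 : 0 < y ^+ 2 * a / (2 * D) by rewrite divr_gt0// mulr_gt0.
have := expN_powR u0 (_ : 0 <= th <= 1) => /(_ ltac:(lra)) E.
apply: (le_trans (ler_wpM2l _ E)); first by rewrite divr_ge0 ?pi_ge0 ?sqrtr_ge0.
have -> : (Num.sqrt pi * 4 * expR (2 * sigma * l) * (c * r) `^ (- th)) ^+ 2 =
  pi * (16 * expR (2 * (2 * sigma * l) + 2 * (- th * ln (c * r)))).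
  rewrite (powR_pos_ln _ cr0) expRD !exprMn sqr_sqrtr ?pi_ge0// !mulr2n !mulrDl !mul1r !expRD; ring.
rewrite -(mulrA pi) ler_pM2l ?pi_gt0// (sqrtE_ln D0) -expRN -expRD.
have l2 : 0 < ln 2 :> R by apply: ln_gt0; lra.
have -> : 16 = expR (4 * ln 2) :> R.
  by rewrite (_ : 4 * ln 2 = ln (2 ^+ 4)) ?lnK ?posrE//; [ring|rewrite lnXn// mulr_natl].
rewrite -expRD ler_expR.
have -> : ln (y ^+ 2 * a / (2 * D)) = 2 * ln `|y| + ln a - ln 2 - ln D.
  rewrite (lnDp (mulr_gt0 y20 a0) (mulr_gt0 _ D0))// (lnMp y20 a0) (lnMp _ D0)//.
  by rewrite -(real_normK (num_real y)) ln_sqr//; ring.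
have ly : ln (c * r) <= ln `|y| by rewrite ler_ln ?posrE.
have lym : th * ln (c * r) <= th * ln `|y| by rewrite ler_wpM2l//; lra.
(* D is at most twice the square of the larger of a and |tau|. *)
have lD : ln D <= ln 2 + 2 * ln a \/ tau != 0 /\ ln a < ln `|tau| /\ ln D <= ln 2 + 2 * ln `|tau|.
  case: (lerP `|tau| a) => h.
    left; rewrite -ln_sqr// -lnM ?posrE ?exprn_gt0// ler_ln ?posrE ?mulr_gt0 ?exprn_gt0//.
    rewrite /D -(real_normK (num_real tau)) (_ : 2 * _ = a ^+ 2 + a ^+ 2); last by ring.
    by rewrite lerD2l lerXn2r ?nnegrE// ltW.
  have t0 : 0 < `|tau| by apply: lt_trans h.
  right; split; first by rewrite -normr_gt0.
  split; first by rewrite ltr_ln ?posrE.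
  rewrite -ln_sqr// -lnM ?posrE ?exprn_gt0// ler_ln ?posrE ?mulr_gt0 ?exprn_gt0//.
  rewrite /D -(real_normK (num_real tau)) (_ : 2 * _ = `|tau| ^+ 2 + `|tau| ^+ 2); last by ring.
  by rewrite lerD2r lerXn2r ?nnegrE// ltW.
have lT : ln `|tau| <= 0 by exact: ln_le0.
(* What is left of the kernel is D^(th - 1/2) a^(-th). If a dominates, this is about a^(th - 1),
   controlled through [e1]; if |tau| dominates, |tau| <= a^(1/gamma) gives the exponent in [e2]. The
   sign needs th >= 1/2. *)
have thD : (th - 2^-1) * ln D - th * ln a <= ln 2 / 2 + 4 * sigma * l.
  case: lD => [h|[t0 [h1 h]]].
    have k1 : (th - 2^-1) * ln D <= (th - 2^-1) * (ln 2 + 2 * ln a) by rewrite ler_wpM2l//; lra.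
    have k2 : (1 - th) * - (2 * l) <= (1 - th) * ln a by rewrite ler_wpM2l//; lra.
    have k3 : (1 - th) * l <= 2 * sigma * l by rewrite ler_wpM2r.
    have k4 : (th - 2^-1) * ln 2 <= 2^-1 * ln 2 by apply: ler_wpM2r; [exact: ltW|clear -th1; lra].
    by move: (ln D) (ln a) (ln 2) k1 k2 k4 {h la ltau lym} => D' a' z k1 k2 k4; clear -k1 k2 k3 k4; lra.
  have k1 : (th - 2^-1) * ln D <= (th - 2^-1) * (ln 2 + 2 * ln `|tau|) by rewrite ler_wpM2l//; lra.
  have k4 : (th - 2^-1) * ln 2 <= 2^-1 * ln 2 by apply: ler_wpM2r; [exact: ltW|clear -th1; lra].
  have k5 : ln `|tau| <= ln a / gamma by rewrite ler_pdivlMr// mulrC ltau.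
  have k6 : (2 * th - 1) * ln `|tau| <= (2 * th - 1) * (ln a / gamma) by rewrite ler_wpM2l//; lra.
  have k7 : ((2 * th - 1) / gamma - th) * ln a <= 2 * sigma * (2 * l).
    have aN : ln a < 0 by exact: lt_le_trans lT.
    apply: (@le_trans _ _ (- (2 * sigma) * ln a)).
      by apply: ler_wnM2r; [exact: ltW|rewrite lerNl opprB].
    rewrite mulNr -mulrN; apply: ler_wpM2l; last by rewrite lerNl.
    by apply: mulr_ge0; [clear|exact: ltW].
  have E6 : (2 * th - 1) * (ln a / gamma) = (2 * th - 1) / gamma * ln a by ring.
  rewrite E6 in k6; move: ((2 * th - 1) / gamma) k6 k7 {E6 e2} => e k6 k7.
  by move: (ln D) (ln a) (ln 2) (ln `|tau|) k1 k4 k6 k7 => D' a' z t' k1 k4 k6 k7; clear -k1 k4 k6 k7; lra.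
have th2 : th * ln 2 <= 1 * ln 2 by apply: ler_wpM2r; exact: ltW.
move: (ln D) (ln a) (ln 2) (ln (c * r)) (ln `|y|) lym thD l2 th2 => D' a' z cr yy lym thD l2 th2.
clear -lym thD l2 th2; lra.
Qed.
End KernelLog.

(** * Integrals of the singular weights *)

Section PowInt.
Variable R : realType.
Local Notation mu := (@lebesgue_measure R).

Lemma d_ln (f : R -> R) (x df : R) : 0 < f x -> isD f x df -> isD (fun z => ln (f z)) x ((f x)^-1 * df).
Proof. by move=> f0 fd; have /= := is_derive1_comp (is_derive1_ln f0) fd. Qed.

Lemma L1_cont_itv (c d : R) (g : R -> R) : continuous g -> L1 (fun y => \1_(`[c, d]%classic) y * g y).
Proof.
move=> cg; have h : mu.-integrable `[c, d]%classic (EFin \o g).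
  by apply: continuous_compact_integrable; [exact: segment_compact|exact: continuous_subspaceT].
have := (@integrable_mkcond _ _ _ mu `[c, d]%classic (EFin \o g) (measurable_itv _)).1 h.
apply: eq_integrable => [|y _] //=.
by rewrite patchE indicE /=; case: (_ \in _); rewrite /= ?mul1r ?mul0r.
Qed.

Section smooth.
Variables (p L x e : R).
Hypotheses (p0 : 0 <= p < 1) (L0 : 0 < L) (e0 : 0 < e).

Let phi (y : R) := expR (- (p / 2) * ln (e + (y - x) ^+ 2)).
Let dphi (y : R) := phi y * (- (p / 2) * ((e + (y - x) ^+ 2)^-1 * (2 * (y - x)))).

Let q0 y : 0 < e + (y - x) ^+ 2. Proof. by rewrite ltr_pwDl ?sqr_ge0. Qed.

Let Dphi y : isD phi y (dphi y).
Proof.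
apply: d_expR; apply: eq_d; first by apply: d_mul; [exact: d_cst|apply: d_ln; [exact: q0|dv]].
by rewrite /=; move: (ln _) ((e + (y - x) ^+ 2)^-1) => A B; ring.
Qed.

Let cphi : continuous phi. Proof. exact: d_cont Dphi. Qed.

Let I := `[x - L, x + L]%classic.

(* The derivative of [(y - x) * phi y] is at least [(1 - p) * phi y]. *)
Lemma pow_smooth : L1 (fun y => \1_I y * phi y) /\
  \int[mu]_y (\1_I y * phi y) <= 2 * L * L `^ (- p) / (1 - p).
Proof.
have [p1 p2] := andP p0.
have mphi : measurable_fun setT phi by apply: continuous_measurable_fun.
have lI : L1 (\1_I : R -> R) by exact: L1_itv.
have phi0 y : 0 <= phi y by exact: expR_ge0.
have l1 : L1 (fun y => \1_I y * phi y).
  have mI := L1_meas lI.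
  apply: (@L1_le _ _ (fun y => expR (- (p / 2) * ln e) * \1_I y)).
  - by mf.
  - move=> y; rewrite normrM (ger0_norm (phi0 y)) ger0_norm ?indicE// mulrC ler_wpM2r//.
    rewrite ler_expR ler_wnM2l ?oppr_le0 ?divr_ge0// ler_ln ?posrE// lerDl sqr_ge0 //.
  - exact: L1Z.
split=> //.
pose G y := (y - x) * phi y.
pose g y := phi y + (y - x) * dphi y.
have DG y : isD G y (g y).
  apply: eq_d; first by apply: d_mul; [dv|exact: Dphi].
  by rewrite /g /=; ring.
have cG : continuous g.
  move=> y; have mc : {for y, continuous (fun z : R => z - x)} by apply: d_cont => z; dv.
  apply: cvgD; first exact: cphi.
  apply: cvgM => //; apply: cvgM; first exact: cphi.
  apply: cvgM; first exact: cvg_cst.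
  apply: cvgM; last by apply: cvgM => //; exact: cvg_cst.
  apply: cvgV; first by rewrite gt_eqF.
  by apply: cvgD; [exact: cvg_cst|rewrite expr2; under eq_fun do rewrite expr2; exact: cvgM].
have gphi y : (1 - p) * phi y <= g y.
  rewrite /g /dphi.
  have : (y - x) ^+ 2 * (e + (y - x) ^+ 2)^-1 <= 1.
    by rewrite ler_pdivrMr// mul1r lerDr ltW.
  move: (phi0 y) ((e + (y - x) ^+ 2)^-1) => ph V h.
  have : p * phi y * ((y - x) ^+ 2 * V) <= p * phi y * 1 by rewrite ler_wpM2l ?mulr_ge0.
  move: (phi y) => P h2; lra.
have xL : x - L <= x + L by rewrite lerD2l ge0_cp// ltW.
have := ftc_R xL DG cG; rewrite [LHS]i_set => E.
have lg : L1 (fun y => \1_I y * g y) by exact: L1_cont_itv.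
rewrite ler_pdivlMr ?subr_gt0// mulrC -iZ//.
apply: (le_trans (i_le _ lg _)).
- exact: L1Z.
- by move=> y; rewrite mulrCA ler_wpM2l// indic_ge0.
rewrite E /G -mulrA.
have -> : x + L - x = L by ring.
have -> : x - L - x = - L by ring.
have -> : phi (x - L) = phi (x + L) by rewrite /phi; congr (expR (_ * ln _)); ring.
rewrite (_ : _ - _ = 2 * (L * phi (x + L))); last by ring.
rewrite !ler_pM2l// /powR gt_eqF// /phi ler_expR (_ : x + L - x = L); last by ring.
rewrite !mulNr lerN2 -mulrA ler_wpM2l// mulrC ler_pdivlMr// mulrC -ln_sqr//.
by rewrite ler_ln ?posrE ?exprn_gt0// ?ltr_pwDl ?sqr_ge0// lerDr ltW.
Qed.
End smooth.

(** The regularised weights are smooth across the singularity and their bound does not depend on the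
    regularisation, so Fatou's lemma gives the singular case. *)
Lemma pow_int (p L x : R) : 0 <= p < 1 -> 0 < L ->
  L1 (fun y => \1_(`[x - L, x + L]%classic) y * `|y - x| `^ (- p)) /\
  \int[mu]_y (\1_(`[x - L, x + L]%classic) y * `|y - x| `^ (- p)) <= 2 * L * L `^ (- p) / (1 - p).
Proof.
move=> p0 L0; pose I := `[x - L, x + L]%classic.
apply: (@fatou_ae _ (fun n y => \1_I y * expR (- (p / 2) * ln (harmonic n + (y - x) ^+ 2)))).
- by move=> n; have [] := pow_smooth x p0 L0 (harmonic_gt0 n).
- by move=> n y; rewrite mulr_ge0 ?expR_ge0// indic_ge0.
- by apply: m_mul; [exact: m_indic|apply: m_powR; mf].
- by move=> y; rewrite mulr_ge0 ?powR_ge0// indic_ge0.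
- apply: (aeS _ (ae_neq x)) => y yx.
  have y0 : 0 < `|y - x| by rewrite normr_gt0 subr_eq0.
  have y2 : 0 < (y - x) ^+ 2 by rewrite -(real_normK (num_real _)) exprn_gt0.
  rewrite (powR_pos_ln _ y0).
  rewrite (_ : - p * ln _ = - (p / 2) * ln (0 + (y - x) ^+ 2)); last first.
    by rewrite add0r -(real_normK (num_real (y - x))) ln_sqr//; field.
  apply: cvgM; first exact: cvg_cst.
  apply: continuous_cvg; first exact: continuous_expR.
  apply: cvgM; first exact: cvg_cst.
  apply: continuous_cvg; first by apply: continuous_ln; rewrite add0r.
  by apply: cvgD; [exact: cvg_harmonic|exact: cvg_cst].
- by move=> n; have [] := pow_smooth x p0 L0 (harmonic_gt0 n).
Qed.

Lemma itv_sym (x y L : R) : (- L <= x - y <= L) = (x - L <= y <= x + L).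
Proof. by apply/idP/idP => /andP[h1 h2]; apply/andP; split; lra. Qed.

Lemma indic_ge0 (D : set R) x : 0 <= \1_D x :> R.
Proof. by have /andP[] := indic_le1 D x. Qed.

Section kap.
Variables (p q L A Z : R).
Hypotheses (p0 : 0 <= p < 1) (q0 : 0 <= q < 1) (L0 : 0 < L) (A0 : 0 <= A) (Z0 : 0 <= Z).

(* the value at 0 is prescribed separately, since [0 `^ (- p)] is a junk value *)
Definition kap r := \1_(`[- L, L]%classic) r * (A * (`|r| `^ (- p) + `|r| `^ (- q))) + Z * \1_[set 0] r.

Definition kap_mass := A * (2 * L * L `^ (- p) / (1 - p) + 2 * L * L `^ (- q) / (1 - q)).

Lemma kap_meas : measurable_fun setT kap.
Proof.
apply: m_add; apply: m_mul.
- exact: m_indic.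
- by apply: m_mul; [exact: m_cst|apply: m_add; apply: m_powR; mf].
- exact: m_cst.
- exact: m_indic.
Qed.

Lemma kap_ge0 r : 0 <= kap r.
Proof. by rewrite /kap addr_ge0 ?mulr_ge0 ?addr_ge0 ?powR_ge0// indicE. Qed.

Lemma kapN r : kap (- r) = kap r.
Proof.
rewrite /kap normrN; congr (_ * _ + _ * _); rewrite !indicE; congr (_%:R); congr nat_of_bool.
  by apply/idP/idP; rewrite !inE/= !in_itv/= lerN2 lerNl => /andP[-> ->].
apply/idP/idP => /set_mem/= h; apply: mem_set => /=; last by rewrite h oppr0.
by rewrite -[r]opprK h oppr0.
Qed.

Lemma kap_int x : (\int[mu]_x' (kap (x - x'))%:E <= kap_mass%:E)%E.
Proof.
have [lp ip] := pow_int x p0 L0; have [lq iq] := pow_int x q0 L0.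
set I := `[x - L, x + L]%classic in lp ip lq iq.
pose f y := A * (\1_I y * `|y - x| `^ (- p) + \1_I y * `|y - x| `^ (- q)).
have lf : L1 f by apply: L1Z; apply: L1D.
have -> : (\int[mu]_x' (kap (x - x'))%:E = \int[mu]_x' (f x')%:E)%E.
  apply: ge0_ae_eq_integral => //.
  - by apply/measurable_EFinP; apply: (measurableT_comp kap_meas); mf.
  - by apply/measurable_EFinP; exact: L1_meas.
  - by move=> y _; rewrite lee_fin kap_ge0.
  - by move=> y _; rewrite lee_fin /f mulr_ge0 ?addr_ge0 ?mulr_ge0 ?powR_ge0// indic_ge0.
  - apply: (aeS _ (ae_neq x)) => y yx _; congr (_%:E).
    rewrite /kap /f (_ : \1_[set 0] (x - y) = 0); last first.
      by rewrite indicE memNset//= => /eqP; rewrite subr_eq0 eq_sym (negbTE yx).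
    rewrite mulr0 addr0 distrC (_ : \1__ (x - y) = \1_I y); first by ring.
    rewrite !indicE; congr (_%:R); congr nat_of_bool.
    by apply/idP/idP; rewrite !inE/= !in_itv/= itv_sym.
rewrite i_fin// lee_fin /kap_mass iZ//; last exact: L1D.
by rewrite ler_wpM2l// iD// lerD.
Qed.
End kap.
End PowInt.

Section KernelKap.
Variable R : realType.
Local Notation mu := (@lebesgue_measure R).
Variables (alpha gamma sigma th C1 C3 : R).
Hypotheses (al0 : 0 < alpha) (g0 : 0 < gamma) (s01 : 0 < sigma < 2^-1)
  (th01 : 2^-1 <= th < 1) (C10 : 0 < C1) (C30 : 0 < C3)
  (e1 : 1 - th <= 2 * sigma) (e2 : th - (2 * th - 1) / gamma <= 2 * sigma).

(** For |tau| <= 1, the larger of the damping |tau|^gamma and the dispersion |tau| has this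
    exponent. *)
Definition gmin := Num.min gamma 1.
Definition near_exp := gmin * (1 - 2 * sigma) / (2 * alpha).
Definition near_far_const := Num.sqrt pi * ((C1 / (2 * C3)) `^ (- near_exp) + 4 * (C1 / 2) `^ (- th)) : R.

Lemma near_far_const_ge0 : 0 <= near_far_const.
Proof. by rewrite mulr_ge0 ?sqrtr_ge0// addr_ge0 ?mulr_ge0 ?powR_ge0. Qed.

Lemma gmin_gt0 : 0 < gmin.
Proof. by rewrite lt_min g0 ltr01. Qed.

Lemma near_exp_ge0 : 0 <= near_exp.
Proof.
have [s0 s1] := andP s01; have := gmin_gt0 => h.
by rewrite /near_exp divr_ge0 ?mulr_ge0 ?(ltW h) ?(ltW al0)// subr_ge0; lra.
Qed.

Lemma sqr_le (u v : R) : 0 <= u -> u <= v -> u ^+ 2 <= v ^+ 2.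
Proof. by move=> u0 uv; rewrite lerXn2r// nnegrE// (le_trans u0). Qed.

Section pt.
Variables (lam L t t' x x' y : R).
Hypotheses (lam1 : 1 <= lam) (t01 : 0 < t <= 1) (t'01 : 0 < t' <= 1)
  (ry : C1 * `|x - x'| - C3 * `|t - t'| `^ alpha <= `|y|)
  (xx : x = x' -> t = t') (xL : `|x - x'| <= L).

Let a := t `^ gamma + t' `^ gamma + lam ^- 2.
Let l := ln lam.

Let lam0 : 0 < lam. Proof. exact: lt_le_trans lam1. Qed.
Let a1 : lam ^- 2 <= a. Proof. by rewrite /a lerDr addr_ge0 ?powR_ge0. Qed.
Let a0 : 0 < a. Proof. by apply: lt_le_trans a1; rewrite invr_gt0 exprn_gt0. Qed.
Let la : - (2 * l) <= ln a.
Proof. by rewrite -ln_sqr// -lnV ?posrE ?exprn_gt0// ler_ln ?posrE ?invr_gt0 ?exprn_gt0. Qed.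

Let ltau : t - t' != 0 -> gamma * ln `|t - t'| <= ln a.
Proof.
move=> n; have n0 : 0 < `|t - t'| by rewrite normr_gt0.
rewrite -ln_powR ler_ln ?posrE ?powR_gt0//.
have [t0 _] := andP t01; have [t'0 _] := andP t'01.
have mono z : `|t - t'| <= z -> `|t - t'| `^ gamma <= z `^ gamma.
  by move=> h; apply: ge0_ler_powR => //; [exact: ltW|rewrite nnegrE (le_trans _ h)].
have h0 : 0 <= lam ^- 2 by rewrite invr_ge0 exprn_ge0// ltW.
case/orP: (le_total t' t) => h.
  apply: (le_trans (mono t _)).
    by rewrite ger0_norm ?subr_ge0// lerBlDr lerDl ltW.
  by rewrite /a -addrA lerDl addr_ge0 ?powR_ge0.
apply: (le_trans (mono t' _)).
  by rewrite ler0_norm ?subr_le0// opprB lerBlDr lerDl ltW.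
by rewrite /a (addrC (t `^ gamma)) -addrA lerDl addr_ge0 ?powR_ge0.
Qed.

Let tau1 : `|t - t'| <= 1.
Proof.
have [t0 t1] := andP t01; have [t'0 t'1] := andP t'01.
by rewrite ler_norml; apply/andP; split; lra.
Qed.

(** Schur's test wants one even function of x - x' for all choices of times, so both powers are
    added although each regime uses only one. *)
Lemma kernel_kap : Kc a (t - t') y ^+ 2 + Ks a (t - t') y ^+ 2 <=
  kap near_exp th L (near_far_const * expR (2 * sigma * l)) (Num.sqrt pi * lam) (x - x') ^+ 2.
Proof.
have Z0 : 0 <= Num.sqrt pi * lam by rewrite mulr_ge0 ?sqrtr_ge0// ltW.
have A0 : 0 <= near_far_const * expR (2 * sigma * l) by rewrite mulr_ge0 ?near_far_const_ge0 ?expR_ge0.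
have sp0 : (0 : R) <= Num.sqrt pi by exact: sqrtr_ge0.
apply: (le_trans (gauss_kernel_le (t - t') y a0)).
(* On the diagonal only a >= lam^(-2) is available, which gives pi lam^2; this is the prescribed
   value of [kap] at 0. *)
have [E|n] := eqVneq x x'.
  rewrite (xx E) E !subrr expr0n addr0 sqrtr_sqr gtr0_norm//.
  apply: (@le_trans _ _ ((Num.sqrt pi * lam) ^+ 2)); last first.
    apply: (sqr_le Z0); rewrite /kap (_ : \1_[set 0] 0 = 1) ?mulr1 ?lerDr.
      by apply: mulr_ge0; [exact: indic_ge0|rewrite mulr_ge0 ?addr_ge0 ?powR_ge0].
    by rewrite indicE mem_set.
  apply: (@le_trans _ _ (pi / a * 1)).
    rewrite ler_wpM2l ?divr_ge0 ?pi_ge0 ?(ltW a0)// -[leRHS]expR0 ler_expR oppr_le0.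
    by rewrite divr_ge0// mulr_ge0 ?sqr_ge0 ?(ltW a0).
  rewrite mulr1 exprMn sqr_sqrtr ?pi_ge0// ler_wpM2l ?pi_ge0// -[leRHS]invrK lef_pV2 ?posrE//.
  by rewrite invr_gt0 exprn_gt0.
have r0 : 0 < `|x - x'| by rewrite normr_gt0 subr_eq0.
move: ry xL => ry' xL'; set r := `|x - x'| in ry' xL' r0 *.
have [s0 s1] := andP s01.
have l0 : 0 <= l by exact: ln_ge0.
have kapE : near_far_const * expR (2 * sigma * l) * (r `^ (- near_exp) + r `^ (- th)) <=
    kap near_exp th L (near_far_const * expR (2 * sigma * l)) (Num.sqrt pi * lam) (x - x').
  rewrite /kap -/r (_ : \1_(`[- L, L]%classic) (x - x') = 1); last first.
    by rewrite indicE mem_set//= in_itv/= -ler_norml -/r.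
  by rewrite mul1r lerDl mulr_ge0// indicE.
have spl c q : 0 < c -> (c * r) `^ (- q) = c `^ (- q) * r `^ (- q).
  by move=> c0; rewrite powRM// ltW.
have p1 := powR_ge0 r (- near_exp); have p2 := powR_ge0 r (- th).
have p3 := powR_ge0 (C1 / (2 * C3)) (- near_exp); have p4 := powR_ge0 (C1 / 2) (- th).
have ex0 := expR_ge0 (2 * sigma * l).
(* Below this threshold the displacement in time uses up at most half of C1 r, and [|y|] keeps the
   other half. *)
case: (lerP (C1 / (2 * C3) * r) (`|t - t'| `^ alpha)) => h.
  have cc : 0 < C1 / (2 * C3) by rewrite divr_gt0// mulr_gt0.
  have tau0 : t - t' != 0.
    apply/eqP => E; move: h; rewrite E normr0 powR0 ?gt_eqF//.
    by rewrite leNgt mulr_gt0.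
  have n0 : 0 < `|t - t'| by rewrite normr_gt0.
  have lr : ln (C1 / (2 * C3) * r) <= alpha * ln `|t - t'|.
    by rewrite -ln_powR ler_ln ?posrE ?powR_gt0// mulr_gt0.
  have gl : gmin * ln `|t - t'| <= ln a \/ gmin * ln `|t - t'| <= ln `|t - t'|.
    rewrite /gmin; case: (lerP gamma 1) => _; first by left; exact: ltau.
    by right; rewrite mul1r.
  have := kernel_near a0 s01 al0 gmin_gt0 r0 cc tau0 la gl lr.
  rewrite -/near_exp => H; apply: (@le_trans _ _ (pi / Num.sqrt (a ^+ 2 + (t - t') ^+ 2) * 1)).
    rewrite ler_wpM2l ?divr_ge0 ?pi_ge0 ?sqrtr_ge0// -[leRHS]expR0 ler_expR oppr_le0.
    exact: (divr_ge0 (mulr_ge0 (sqr_ge0 _) (ltW a0)) (mulr_ge0 (ler0n _ 2) (addr_ge0 (sqr_ge0 _) (sqr_ge0 _)))).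
  rewrite mulr1; apply: (le_trans H).
  apply: sqr_le; first by rewrite !mulr_ge0 ?powR_ge0.
  apply: (le_trans _ kapE); rewrite spl// /near_far_const.
  move: (_ `^ (- near_exp)) (_ `^ (- th)) p3 p4 (r `^ (- near_exp)) (r `^ (- th)) p1 p2 => u v u0 v0 u' v' u'0 v'0.
  have -> : Num.sqrt pi * expR (2 * sigma * l) * (u * u') = Num.sqrt pi * u * expR (2 * sigma * l) * u' by ring.
  rewrite ler_pM ?mulr_ge0//; last by rewrite lerDl.
  by rewrite ler_wpM2r// ler_wpM2l// lerDl mulr_ge0.
have cc : 0 < C1 / 2 by rewrite divr_gt0.
have cy : C1 / 2 * r <= `|y|.
  apply: (le_trans _ ry'); rewrite lerBrDr.
  have : C3 * `|t - t'| `^ alpha <= C3 * (C1 / (2 * C3) * r) by rewrite ler_pM2l// ltW.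
  have -> : C3 * (C1 / (2 * C3) * r) = C1 / 2 * r by field; rewrite gt_eqF.
  move=> h2; have -> : C1 * r = C1 / 2 * r + C1 / 2 * r by field.
  by rewrite lerD2l.
have := kernel_far a0 g0 s0 th01 r0 cc l0 e1 e2 tau1 la ltau cy.
move=> H; apply: (le_trans H).
apply: sqr_le; first by rewrite !mulr_ge0 ?powR_ge0.
apply: (le_trans _ kapE); rewrite spl// /near_far_const.
move: ((C1 / (2 * C3)) `^ (- near_exp)) ((C1 / 2) `^ (- th)) p3 p4 (r `^ (- near_exp)) (r `^ (- th)) p1 p2 => u v u0 v0 u' v' u'0 v'0.
have -> : Num.sqrt pi * 4 * expR (2 * sigma * l) * (v * v') = Num.sqrt pi * (4 * v) * expR (2 * sigma * l) * v' by ring.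
rewrite ler_pM ?mulr_ge0//; last by rewrite lerDr.
by rewrite ler_wpM2r// ler_wpM2l// lerDr.
Qed.
End pt.
End KernelKap.

(** * Maximal estimates *)

Section MaxEst.
Variable R : realType.
Local Notation mu := (@lebesgue_measure R).

(** The real part of P_gamma without its factor 1/(2 pi). The imaginary part is the same operator
    applied to g2 - i g1. *)
Definition Fop (gamma : R) (g1 g2 : R -> R) (y t : R) :=
  \int[mu]_xi (expR (- (t `^ gamma) * xi ^+ 2) *
    (cos (y * xi + t * xi ^+ 2) * g1 xi - sin (y * xi + t * xi ^+ 2) * g2 xi)).

Lemma L2supp_L1 (lam : R) (g : R -> R) : 0 < lam -> measurable_fun setT g ->
  L1 (fun xi => g xi ^+ 2) -> (forall xi, lam < `|xi| -> g xi = 0) -> L1 g.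
Proof.
move=> l0 mg lg sg; apply: (L1_le mg _ (L1D (L1_itv (- lam) lam) lg)) => xi /=.
case: (lerP `|xi| lam) => h.
  rewrite indicE mem_set/=; last by rewrite in_itv/= -ler_norml.
  by rewrite -(real_normK (num_real (g xi))); have := sqr_ge0 (`|g xi| - 1); nra.
by rewrite sg// normr0 addr_ge0 ?sqr_ge0 ?indic_ge0.
Qed.

Lemma sq_L1l (f1 f2 : R -> R) : measurable_fun setT f1 -> L1 (sq f1 f2) -> L1 (fun x => f1 x ^+ 2).
Proof.
move=> m1 l; apply: (L1_le (m_sqr m1) _ l) => x.
by rewrite ger0_norm ?sqr_ge0// /sq lerDl sqr_ge0.
Qed.

Lemma sq_L1r (f1 f2 : R -> R) : measurable_fun setT f2 -> L1 (sq f1 f2) -> L1 (fun x => f2 x ^+ 2).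
Proof.
move=> m1 l; apply: (L1_le (m_sqr m1) _ l) => x.
by rewrite ger0_norm ?sqr_ge0// /sq lerDr sqr_ge0.
Qed.

Lemma Fop_integrand_le (gamma : R) (g1 g2 : R -> R) (y t xi : R) :
  `|expR (- (t `^ gamma) * xi ^+ 2) *
    (cos (y * xi + t * xi ^+ 2) * g1 xi - sin (y * xi + t * xi ^+ 2) * g2 xi)| <= `|g1 xi| + `|g2 xi|.
Proof.
rewrite normrM ger0_norm ?expR_ge0// -[leRHS]mul1r; apply: ler_pM => //.
- by rewrite -[leRHS]expR0 ler_expR mulNr oppr_le0 mulr_ge0 ?powR_ge0 ?sqr_ge0.
- apply: (le_trans (ler_normB _ _)); rewrite !normrM; apply: lerD.
    by rewrite ler_piMl// cos_le1n.
  by rewrite ler_piMl// sin_le1n.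
Qed.

Section max.
Variables (alpha gamma sigma th C1 C3 : R).
Hypotheses (al0 : 0 < alpha) (g0 : 0 < gamma) (s01 : 0 < sigma < 2^-1)
  (th01 : 2^-1 <= th < 1) (C10 : 0 < C1) (C30 : 0 < C3)
  (e1 : 1 - th <= 2 * sigma) (e2 : th - (2 * th - 1) / gamma <= 2 * sigma)
  (q11 : near_exp alpha gamma sigma < 1).
Variables (Gam : R -> R -> R) (rho lam : R).
Hypotheses (bil : forall t x x', 0 < t <= 1 -> C1 * `|x - x'| <= `|Gam x t - Gam x' t|)
  (hol : forall x t t', 0 < t <= 1 -> 0 < t' <= 1 -> `|Gam x t - Gam x t'| <= C3 * `|t - t'| `^ alpha)
  (rho0 : 0 < rho) (lam1 : 1 <= lam).

Let B := `[- rho, rho]%classic.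

(** The last factor is the price of undoing the Gaussian on frequencies up to [lam]; the exponential
    inside is lam^(2 sigma). Differences of points of the ball have size at most 2 rho. *)
Definition max_const := kap_mass (near_exp alpha gamma sigma) th (2 * rho)
  (near_far_const alpha gamma sigma th C1 C3 * expR (2 * sigma * ln lam)) * expR 1.

Variables (g1 g2 T : R -> R).
Hypotheses (m1 : measurable_fun setT g1) (m2 : measurable_fun setT g2) (lg : L1 (sq g1 g2))
  (s1 : forall xi, lam < `|xi| -> g1 xi = 0) (s2 : forall xi, lam < `|xi| -> g2 xi = 0)
  (mT : measurable_fun setT T) (T01 : forall x, 0 < T x <= 1)
  (mY : measurable_fun setT (fun x => Gam x (T x))).

Let lam0 : 0 < lam. Proof. exact: lt_le_trans lam1. Qed.
Let l1 : L1 g1. Proof. by apply: (L2supp_L1 lam0) => //; exact: sq_L1l lg. Qed.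
Let l2 : L1 g2. Proof. by apply: (L2supp_L1 lam0) => //; exact: sq_L1r lg. Qed.

Let w x := \1_B x * Fop gamma g1 g2 (Gam x (T x)) (T x).
Let Y x := Gam x (T x).
Let b x := T x `^ gamma.
Let eps : R := lam ^- 2.
Let eps0 : 0 < eps. Proof. by rewrite invr_gt0 exprn_gt0. Qed.
Let mb : measurable_fun setT b. Proof. exact: m_powR. Qed.
Let b0 x : 0 <= b x. Proof. exact: powR_ge0. Qed.

Let wL1 : L1 w.
Proof.
have lv : L1 (fun xi => `|g1 xi| + `|g2 xi|) by apply: L1D; exact: L1_norm.
pose F (p : R * R) := \1_B p.1 * (expR (- (b p.1) * p.2 ^+ 2) *
    (cos (Y p.1 * p.2 + T p.1 * p.2 ^+ 2) * g1 p.2 - sin (Y p.1 * p.2 + T p.1 * p.2 ^+ 2) * g2 p.2)).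
have lI : L1 (\1_B : R -> R) by exact: L1_itv.
have mI := L1_meas lI.
have [||_ _ h _ _] := fubini_dom (F := F) _ lI lv.
- by rewrite /F; mf.
- move=> x xi; rewrite /F /= normrM (ger0_norm (indic_ge0 _ _)) ler_wpM2l ?indic_ge0//.
  exact: Fop_integrand_le.
apply: L1_eq h => x; rewrite /F /= iZ//.
by apply: (L1_le _ _ lv) => [|xi]; [by mf|exact: Fop_integrand_le].
Qed.

Let w_le x : `|w x| <= \int[mu]_xi (`|g1 xi| + `|g2 xi|).
Proof.
have lv : L1 (fun xi => `|g1 xi| + `|g2 xi|) by apply: L1D; exact: L1_norm.
have /andP[i0 i1] := indic_le1 B x.
rewrite /w normrM (ger0_norm i0) -[leRHS]mul1r ler_pM//.
apply: i_norm_le => //; last by move=> xi; exact: Fop_integrand_le.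
by apply: (L1_le _ _ lv) => [|xi]; [by mf|exact: Fop_integrand_le].
Qed.

Let w2L1 : L1 (fun x => w x ^+ 2 + 0 ^+ 2).
Proof.
have mw := L1_meas wL1.
apply: (L1_le _ _ (L1Z (\int[mu]_xi (`|g1 xi| + `|g2 xi|)) (L1_norm wL1))) => [|x].
  by apply: m_add; [exact: m_sqr|exact: m_cst].
rewrite expr0n addr0 normrX expr2 ler_wpM2r//.
Qed.

Let HK x x' : w x ^+ 2 + 0 ^+ 2 != 0 -> w x' ^+ 2 + 0 ^+ 2 != 0 ->
  Kc (b x + b x' + eps) (T x - T x') (Y x - Y x') ^+ 2 +
  Ks (b x + b x' + eps) (T x - T x') (Y x - Y x') ^+ 2 <=
  kap (near_exp alpha gamma sigma) th (2 * rho)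
  (near_far_const alpha gamma sigma th C1 C3 * expR (2 * sigma * ln lam))
  (Num.sqrt pi * lam) (x - x') ^+ 2.
Proof.
have inB z : w z ^+ 2 + 0 ^+ 2 != 0 -> `|z| <= rho.
  rewrite expr0n addr0 /w indicE; case: (boolP (z \in B)) => [/set_mem h _|_]; last by rewrite mul0r expr0n eqxx.
  by rewrite ler_norml; move: h; rewrite /B/= in_itv.
move=> /inB hx /inB hx'.
apply: (kernel_kap al0 g0 s01 th01 C10 C30 e1 e2 lam1 (T01 x) (T01 x')).
- apply: (@le_trans _ _ (`|Gam x (T x) - Gam x' (T x)| - `|Gam x' (T x') - Gam x' (T x)|)).
    by apply: lerB; [exact: bil|rewrite (distrC (T x)); exact: hol].
  rewrite lerBlDr; apply: le_trans (ler_normD _ _); rewrite le_eqVlt; apply/orP; left.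
  by apply/eqP; congr (`|_|); rewrite /Y; ring.
- by move=> ->.
- apply: (le_trans (ler_normB _ _)); rewrite mulr_natl mulr2n; exact: lerD.
Qed.

(** Let S be the integral of w^2. It is the pairing of g, freed of the Gaussian, with the dual
    operator at w, so S^2 <= e |g|^2 M S by Cauchy-Schwarz and [dual_bound]; divide by S. *)
Lemma max_est : L1 (fun x => w x ^+ 2) /\ \int[mu]_x w x ^+ 2 <= max_const * \int[mu]_xi sq g1 g2 xi.
Proof.
pose K := kap (near_exp alpha gamma sigma) th (2 * rho)
  (near_far_const alpha gamma sigma th C1 C3 * expR (2 * sigma * ln lam)) (Num.sqrt pi * lam).
pose M := kap_mass (near_exp alpha gamma sigma) th (2 * rho)
  (near_far_const alpha gamma sigma th C1 C3 * expR (2 * sigma * ln lam)).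
have p01 : 0 <= near_exp alpha gamma sigma < 1 by rewrite q11 (near_exp_ge0 al0 g0 s01).
have t01 : 0 <= th < 1 by have /andP[h ->] := th01; rewrite andbT (le_trans _ h).
have L0 : 0 < 2 * rho by rewrite mulr_gt0.
have A0 : 0 <= near_far_const alpha gamma sigma th C1 C3 * expR (2 * sigma * ln lam).
  by rewrite mulr_ge0 ?near_far_const_ge0 ?expR_ge0.
have Z0 : 0 <= Num.sqrt pi * lam by rewrite mulr_ge0 ?sqrtr_ge0// ltW.
have [D1 D2] := dual_bound mY mT mb b0 eps0 wL1 (L1_0 R) w2L1 (kap_meas _ _ _ _ _)
   (kap_ge0 _ _ _ A0 Z0) (kapN _ _ _ _ _) (kap_int p01 t01 L0 A0 Z0) HK.
have lw2 : L1 (fun x => w x ^+ 2) by apply: L1_eq w2L1 => x; rewrite expr0n addr0.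
split => //.
(* [E] cancels the Gaussian in [damp]. As eps = lam^(-2), its square is at most e where g lives. *)
pose E xi := expR (eps / 2 * xi ^+ 2).
pose G1 xi := E xi * g1 xi; pose G2 xi := E xi * g2 xi.
have mE : measurable_fun setT E by rewrite /E; mf.
have mG1 : measurable_fun setT G1 by apply: m_mul.
have mG2 : measurable_fun setT G2 by apply: m_mul.
have E0 xi : 0 <= E xi by exact: expR_ge0.
have sqG xi : sq G1 G2 xi = E xi ^+ 2 * sq g1 g2 xi by rewrite /sq /G1 /G2; ring.
have sqG_le xi : sq G1 G2 xi <= expR 1 * sq g1 g2 xi.
  rewrite sqG; case: (lerP `|xi| lam) => h; last first.
    by rewrite /sq s1// s2// expr0n addr0 !mulr0.
  rewrite ler_wpM2r ?sq_ge0// /E expr2 -expRD ler_expR -mulrDl -splitr.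
  rewrite mulrC ler_pdivrMr ?exprn_gt0// mul1r -(real_normK (num_real xi)).
  by rewrite lerXn2r ?nnegrE// ltW.
have lsG : L1 (sq G1 G2).
  apply: (L1_le (m_sq mG1 mG2) _ (L1Z (expR 1) lg)) => xi.
  by rewrite ger0_norm ?sq_ge0.
have dE x xi : E xi * damp b eps x xi = expR (- (T x `^ gamma) * xi ^+ 2).
  by rewrite /E /damp -expRD; congr expR; rewrite /b; ring.
have [|||P1 P2] := dual_pair mY mT mb b0 eps0 wL1 (L1_0 R) (C := fun xi => E xi * (`|g1 xi| + `|g2 xi|)) mG1 mG2.
- by move=> xi; rewrite normrM (ger0_norm (E0 _)) ler_wpM2l// lerDl.
- by move=> xi; rewrite normrM (ger0_norm (E0 _)) ler_wpM2l// lerDr.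
- apply: (L1_eq (f := fun xi => `|g1 xi| + `|g2 xi|)); last by apply: L1D; exact: L1_norm.
  move=> xi; rewrite /E mulrAC -expRD (_ : eps / 2 * xi ^+ 2 + _ = 0) ?expR0 ?mul1r//.
  by rewrite mulNr addrN.
have inner x : \int[mu]_xi (G1 xi * (damp b eps x xi * (w x * cos (phase Y T x xi) + 0 * sin (phase Y T x xi))) +
    G2 xi * (damp b eps x xi * (0 * cos (phase Y T x xi) - w x * sin (phase Y T x xi)))) = w x ^+ 2.
  transitivity (w x * Fop gamma g1 g2 (Y x) (T x)).
    rewrite /Fop -iZ; last first.
      apply: (L1_le _ _ (L1D (L1_norm l1) (L1_norm l2))) => [|xi]; [by mf|exact: Fop_integrand_le].
    apply: i_eq => xi; rewrite -dE /G1 /G2 /phase.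
    move: (E xi) (damp b eps x xi) (cos _) (sin _) (w x) (g1 xi) (g2 xi) => e d c s ww a1 a2; ring.
  rewrite /w indicE; case: (x \in B); rewrite ?mul1r ?mul0r ?expr0n//.
rewrite (_ : (fun x => \int[mu]_xi _) = fun x => w x ^+ 2) in P2; last by apply/funext => x; exact: inner.
have [_ CS] := cauchy_schwarz mG1 mG2 (L1_meas (dualA_L1 mY mT mb b0 eps0 wL1 (L1_0 R)))
  (L1_meas (dualB_L1 mY mT mb b0 eps0 wL1 (L1_0 R))) lsG D1.
rewrite P2 in CS.
rewrite (_ : \int[mu]_x (w x ^+ 2 + 0 ^+ 2) = \int[mu]_x (w x ^+ 2)) in D2; last first.
  by apply: i_eq => x; rewrite expr0n addr0.
have IG : \int[mu]_xi sq G1 G2 xi <= expR 1 * \int[mu]_xi sq g1 g2 xi.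
  by rewrite -(iZ (expR 1) lg); apply: i_le; [exact: lsG|exact: L1Z|exact: sqG_le].
have S0 : 0 <= \int[mu]_x w x ^+ 2 by apply: i_ge0 => x; exact: sqr_ge0.
have N0 : 0 <= \int[mu]_xi sq g1 g2 xi by apply: i_ge0 => x; exact: sq_ge0.
have NG0 : 0 <= \int[mu]_xi sq G1 G2 xi by apply: i_ge0 => x; exact: sq_ge0.
have M0 : 0 <= M.
  have := kap_int p01 t01 L0 A0 Z0 0; rewrite -lee_fin; apply: le_trans.
  by apply: integral_ge0 => x _; rewrite lee_fin kap_ge0.
rewrite /max_const -/M -mulrA.
move: (\int[mu]_x w x ^+ 2) S0 D2 CS => S S0 D2 CS.
have R0 : 0 <= M * (expR 1 * \int[mu]_xi sq g1 g2 xi) by exact: (mulr_ge0 M0 (mulr_ge0 (expR_ge0 _) N0)).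
have [Sn|Sp] := leP S 0; first exact: (le_trans Sn).
have : S * S <= S * (M * (expR 1 * \int[mu]_xi sq g1 g2 xi)).
  rewrite -expr2; apply: (le_trans CS).
  apply: (@le_trans _ _ (expR 1 * (\int[mu]_xi sq g1 g2 xi) * (M * S))).
    by apply: ler_pM; [exact: NG0|apply: i_ge0 => x; exact: sq_ge0|exact: IG|exact: D2].
  by rewrite le_eqVlt; apply/orP; left; apply/eqP; ring.
by rewrite ler_pM2l.
Qed.
End max.
End MaxEst.

(** * Maxima over finite lists of times *)

Section Select.
Variable R : realType.
Local Notation mu := (@lebesgue_measure R).

(** The last clause covers the selected time and the selected curve point alike. *)
Lemma argmax_select (h : nat -> R -> R) n : (forall k, measurable_fun setT (h k)) ->
  exists idx : R -> nat, [/\ forall x, (idx x <= n)%N,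
    forall k x, (k <= n)%N -> h k x <= h (idx x) x &
    forall u : nat -> R -> R, (forall k, measurable_fun setT (u k)) ->
      measurable_fun setT (fun x => u (idx x) x)].
Proof.
move=> mh; elim: n => [|n [idx [i1 i2 i3]]].
  by exists (fun=> 0%N); split=> // k x; rewrite leqn0 => /eqP->.
exists (fun x => if h (idx x) x < h n.+1 x then n.+1 else idx x); split.
- by move=> x; case: ifP => _ //; exact: leqW.
- move=> k x; rewrite leq_eqVlt => /orP[/eqP->|kn]; case: ifPn => //.
  + by rewrite -leNgt.
  + by move=> /ltW; apply: le_trans; exact: i2.
  + by move=> _; exact: i2.
- move=> u mu'.
  rewrite (_ : (fun x => _) = (fun x => if h (idx x) x < h n.+1 x then u n.+1 x else u (idx x) x)); last first.
    by apply/funext => x; case: ifP.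
  apply: measurable_fun_ifT; [|exact: mu'|exact: i3].
  by apply: measurable_fun_ltr; [exact: i3|exact: mh].
Qed.

(** A Gaussian weight in x makes the integrand jointly integrable; Fubini gives measurability and
    the weight is divided out. *)
Lemma Fop_meas (gamma : R) (g1 g2 Y T : R -> R) : measurable_fun setT Y -> measurable_fun setT T ->
  L1 g1 -> L1 g2 -> measurable_fun setT (fun x => Fop gamma g1 g2 (Y x) (T x)).
Proof.
move=> mY mT l1 l2; have m1 := L1_meas l1; have m2 := L1_meas l2.
have lv : L1 (fun xi => `|g1 xi| + `|g2 xi|) by apply: L1D; exact: L1_norm.
pose g (x : R) := expR (- 1 * x ^+ 2).
have lg : L1 g by apply: gauss_L1.
have mg := L1_meas lg.
pose F (p : R * R) := g p.1 * (expR (- (T p.1 `^ gamma) * p.2 ^+ 2) *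
    (cos (Y p.1 * p.2 + T p.1 * p.2 ^+ 2) * g1 p.2 - sin (Y p.1 * p.2 + T p.1 * p.2 ^+ 2) * g2 p.2)).
have mTg : measurable_fun setT (fun x => T x `^ gamma) by exact: m_powR.
have [||_ _ h _ _] := fubini_dom (F := F) _ lg lv.
- by rewrite /F; mf.
- move=> x xi; rewrite /F /= normrM (ger0_norm (expR_ge0 _)) ler_wpM2l ?expR_ge0//.
  exact: Fop_integrand_le.
have mh := L1_meas h.
have : measurable_fun setT (fun x : R => expR (x ^+ 2) * \int[mu]_y F (x, y)) by mf.
rewrite (_ : (fun x => _ * _) = (fun x => Fop gamma g1 g2 (Y x) (T x))).
  exact.
apply/funext => x; rewrite /F /= iZ; last first.
  by apply: (L1_le _ _ lv) => [|xi]; [by mf|exact: Fop_integrand_le].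
by rewrite mulrA -expRD mulN1r addrN expR0 mul1r.
Qed.

Section maxlist.
Variables (alpha gamma sigma th C1 C3 : R).
Hypotheses (al0 : 0 < alpha) (g0 : 0 < gamma) (s01 : 0 < sigma < 2^-1)
  (th01 : 2^-1 <= th < 1) (C10 : 0 < C1) (C30 : 0 < C3)
  (e1 : 1 - th <= 2 * sigma) (e2 : th - (2 * th - 1) / gamma <= 2 * sigma)
  (q11 : near_exp alpha gamma sigma < 1).
Variables (Gam : R -> R -> R) (rho lam : R).
Hypotheses (bil : forall t x x', 0 < t <= 1 -> C1 * `|x - x'| <= `|Gam x t - Gam x' t|)
  (hol : forall x t t', 0 < t <= 1 -> 0 < t' <= 1 -> `|Gam x t - Gam x t'| <= C3 * `|t - t'| `^ alpha)
  (mG : forall t, 0 < t <= 1 -> measurable_fun setT (Gam ^~ t))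
  (rho0 : 0 < rho) (lam1 : 1 <= lam).
Variables (g1 g2 : R -> R).
Hypotheses (m1 : measurable_fun setT g1) (m2 : measurable_fun setT g2) (lg : L1 (sq g1 g2))
  (s1 : forall xi, lam < `|xi| -> g1 xi = 0) (s2 : forall xi, lam < `|xi| -> g2 xi = 0).
Variable t : nat -> R.
Hypothesis t01 : forall j, 0 < t j <= 1.

Let B := `[- rho, rho]%classic.

Definition maxF n x := \big[Num.max/0]_(j < n.+1) `|Fop gamma g1 g2 (Gam x (t j)) (t j)|.

Lemma maxF_est n : measurable_fun setT (maxF n) /\ L1 (fun x => \1_B x * maxF n x ^+ 2) /\
  \int[mu]_x (\1_B x * maxF n x ^+ 2) <=
    max_const alpha gamma sigma th C1 C3 rho lam * \int[mu]_xi sq g1 g2 xi.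
Proof.
have lam0 : 0 < lam by exact: lt_le_trans lam1.
have l1 : L1 g1 by apply: (L2supp_L1 lam0) => //; exact: sq_L1l lg.
have l2 : L1 g2 by apply: (L2supp_L1 lam0) => //; exact: sq_L1r lg.
pose h k x := `|Fop gamma g1 g2 (Gam x (t k)) (t k)|.
have mh k : measurable_fun setT (h k).
  by apply: m_norm; exact: (Fop_meas _ (mG (t01 k)) (m_cst _) l1 l2).
have [idx [i1 i2 i3]] := argmax_select n mh.
have E x : maxF n x = h (idx x) x.
  apply/eqP; rewrite eq_le; apply/andP; split.
    apply/bigmax_leP; split; first exact: normr_ge0.
    by move=> j _; apply: i2; rewrite -ltnS.
  have ii : (idx x < n.+1)%N by rewrite ltnS.
  exact: (le_bigmax_cond _ (fun j : 'I_n.+1 => h j x) (isT : predT (Ordinal ii))).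
split; first by apply: eq_measurable_fun (i3 h mh) => x _; rewrite E.
have [] := max_est al0 g0 s01 th01 C10 C30 e1 e2 q11 bil hol rho0 lam1 m1 m2 lg s1 s2
  (T := fun x => t (idx x)) (i3 (fun k _ => t k) (fun k => m_cst _)) (fun x => t01 _)
  (i3 (fun k x => Gam x (t k)) (fun k => mG (t01 k))).
have E2 x : (\1_B x * Fop gamma g1 g2 (Gam x (t (idx x))) (t (idx x))) ^+ 2 = \1_B x * maxF n x ^+ 2.
  by rewrite exprMn sqr_indic E /h real_normK ?num_real.
rewrite (_ : (fun x => _) = (fun x => \1_B x * maxF n x ^+ 2)); last by apply/funext => x; exact: E2.
by move=> a b; split.
Qed.

Lemma maxF_homo x n m : (n <= m)%N -> maxF n x <= maxF m x.
Proof.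
move=> nm; apply/bigmax_leP; split; first exact: bigmax_ge_id.
move=> j _; have jm : (j < m.+1)%N by exact: (leq_trans (ltn_ord j)).
exact: (le_bigmax_cond _ (fun j : 'I_m.+1 => `|Fop gamma g1 g2 (Gam x (t j)) (t j)|) (isT : predT (Ordinal jm))).
Qed.

Lemma maxF_ge x n : `|Fop gamma g1 g2 (Gam x (t n)) (t n)| <= maxF n x.
Proof.
exact: (le_bigmax_cond _ (fun j : 'I_n.+1 => `|Fop gamma g1 g2 (Gam x (t j)) (t j)|) (isT : predT (@ord_max n))).
Qed.

Lemma maxF_ge0 x n : 0 <= maxF n x.
Proof. exact: bigmax_ge_id. Qed.
End maxlist.
End Select.

(** * Choice of the exponents *)

Section Exponents.
Variable R : realType.

(** These are the limiting forms, at sigma = s(gamma), of what the near regime and the far regime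
    with theta = 1 or theta = 1/2 demand. *)
Lemma s_crit_bounds (alpha gamma : R) : 0 < gamma -> 4^-1 < alpha < 2^-1 ->
  [/\ 0 <= s_crit alpha gamma < 2^-1, gmin gamma * (1 - 2 * s_crit alpha gamma) <= 2 * alpha,
    (gamma < 2 -> 1 - gamma^-1 <= 2 * s_crit alpha gamma) &
    (2 <= gamma -> 2^-1 <= 2 * s_crit alpha gamma)].
Proof.
move=> g0 /andP[a1 a2].
have V0 : 0 < gamma^-1 by rewrite invr_gt0.
have E : gamma * gamma^-1 = 1 by rewrite divff ?gt_eqF.
have aV : (2 * alpha)^-1 * (2 * alpha) = 1 by rewrite mulVf ?gt_eqF//; lra.
rewrite /s_crit; set V := gamma^-1 in V0 E *; set W := (2 * alpha)^-1 in aV *.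
have al0 : 0 < alpha by lra.
have gmin1 : gamma < 1 -> gmin gamma = gamma by move=> h; rewrite /gmin min_l// ltW.
have gmin2 : 1 <= gamma -> gmin gamma = 1 by move=> h; rewrite /gmin min_r.
have [h1|h1] := ltP gamma (2 * alpha).
  rewrite gmin1; [split; nra|lra].
have [h2|h2] := ltP gamma 1.
  have aV1 : alpha * V <= 2^-1 by nra.
  have aV2 : 0 < alpha * V by nra.
  rewrite gmin1//; split; [lra| | |].
  - have -> : gamma * (1 - 2 * (2^-1 - alpha * V)) = 2 * alpha * (gamma * V) by field.
    by rewrite E; lra.
  - by move=> _; nra.
  - by lra.
rewrite gmin2//.
have [h3|h3] := ltP gamma W.
  have wV : 2 * alpha <= V.
    rewrite -(ler_pM2l g0) E; nra.
  split; [lra|lra|move=> _; lra|].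
  move=> h4; nra.
have wV : V <= 2 * alpha.
  rewrite -(ler_pM2l g0) E; nra.
have V1 : V <= 1 by nra.
have [h4|h4] := ltP gamma 2.
  split; [lra|lra|move=> _; lra|lra].
by split; [lra|lra|lra|lra].
Qed.

(** Placing sigma strictly between s(gamma) and min(s, 1/2) makes the near exponent strictly less
    than 1 and leaves a gain s - sigma for summing the pieces. *)
Lemma exponents (alpha gamma s : R) : 0 < gamma -> 4^-1 < alpha < 2^-1 -> s_crit alpha gamma < s ->
  exists sigma th, [/\ 0 < sigma < 2^-1, sigma < s, 2^-1 <= th < 1 &
    [/\ 1 - th <= 2 * sigma, th - (2 * th - 1) / gamma <= 2 * sigma & near_exp alpha gamma sigma < 1]].
Proof.
move=> g0 al01 ss; have [/andP[c0 c1] c2 c3 c4] := s_crit_bounds g0 al01.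
have /andP[a1 a2] := al01.
set c := s_crit _ _ in ss c0 c1 c2 c3 c4.
pose m := Num.min s (2^-1); have cm : c < m by rewrite lt_min ss c1.
have ms : m <= s by rewrite ge_min lexx.
have m2 : m <= 2^-1 by rewrite ge_min lexx orbT.
pose sigma := (c + m) / 2.
have cs : c < sigma by rewrite /sigma; lra.
have sm : sigma < m by rewrite /sigma; lra.
have q11 : near_exp alpha gamma sigma < 1.
  rewrite /near_exp ltr_pdivrMr ?mul1r; last by lra.
  apply: (lt_le_trans _ c2); rewrite ltr_pM2l ?gmin_gt0//; lra.
have V0 : 0 < gamma^-1 by rewrite invr_gt0.
have s01 : 0 < sigma < 2^-1 by apply/andP; split; lra.
have ssl : sigma < s by lra.
exists sigma; have [h|h] := ltP gamma 2; last first.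
  have := c4 h => c4'.
  by exists 2^-1; split => //; [apply/andP; split; lra|split => //; lra].
have := c3 h => c3'; set V := gamma^-1 in V0 c3' *.
(* [z] is the slack of the second far condition at theta = 1; moving to theta = 1 - eta costs at
   most 2 eta V. *)
pose z := 2 * sigma - 1 + V; have z0 : 0 < z by rewrite /z; lra.
pose eta := Num.min (Num.min (2^-1) (2 * sigma)) (z / (2 * V)).
have eta0 : 0 < eta by rewrite !lt_min; apply/andP; split; [apply/andP; split; lra|rewrite divr_gt0// mulr_gt0].
have e1 : eta <= 2^-1 by rewrite /eta !ge_min lexx.
have e2 : eta <= 2 * sigma by rewrite /eta !ge_min lexx orbT.
have e3 : eta * (2 * V) <= z.
  rewrite -ler_pdivlMr ?mulr_gt0//. by rewrite /eta !ge_min lexx !orbT.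
exists (1 - eta); split => //; first by apply/andP; split; lra.
split => //; first by lra.
by move: e3; rewrite /z; nra.
Qed.
End Exponents.

(** * Continuity in time and interchange of limits *)

Section Continuity.
Variable R : realType.
Local Notation mu := (@lebesgue_measure R).

Lemma powR_cvg_seq0 (a : R) (u : nat -> R) : 0 < a -> (forall n, 0 <= u n) ->
  u n @[n --> \oo] --> (0 : R) -> u n `^ a @[n --> \oo] --> (0 : R).
Proof.
move=> a0 u0 cu; apply/cvgrPdist_le => e e0.
have ea : 0 < e `^ a^-1 by exact: powR_gt0.
near=> n; rewrite sub0r normrN ger0_norm ?powR_ge0//.
have -> : e = (e `^ a^-1) `^ a by rewrite -powRrM mulVf ?gt_eqF// powRr1// ltW.
apply: ge0_ler_powR; rewrite ?nnegrE ?(ltW a0) ?(ltW ea)//.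
rewrite -(ger0_norm (u0 n)) -(normrN (u n)) -(sub0r (u n)).
by near: n; move/cvgrPdist_le : cu; apply.
Unshelve. all: by end_near. Qed.

Lemma powR_cvg_seq (a t : R) (u : nat -> R) : 0 < a -> 0 <= t -> (forall n, 0 < u n) ->
  u n @[n --> \oo] --> t -> u n `^ a @[n --> \oo] --> t `^ a.
Proof.
move=> a0; rewrite le_eqVlt => /orP[/eqP<-|t0] u0 cu.
  rewrite powR0 ?gt_eqF//; by apply: powR_cvg_seq0 => // n; exact: ltW.
rewrite powR_pos_ln//.
rewrite (_ : (fun n => u n `^ a) = (fun n => expR (a * ln (u n)))); last first.
  by apply/funext => n; rewrite powR_pos_ln.
apply: continuous_cvg; first exact: continuous_expR.
by apply: cvgM; [exact: cvg_cst|apply: continuous_cvg => //; exact: continuous_ln].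
Qed.

Lemma Fop_cvg (gamma : R) (g1 g2 : R -> R) (y t : nat -> R) (y0 t0 : R) : 0 < gamma ->
  L1 g1 -> L1 g2 -> 0 <= t0 -> (forall n, 0 < t n) ->
  y n @[n --> \oo] --> y0 -> t n @[n --> \oo] --> t0 ->
  Fop gamma g1 g2 (y n) (t n) @[n --> \oo] --> Fop gamma g1 g2 y0 t0.
Proof.
move=> g0 l1 l2 t00 tn0 cy ct; have m1 := L1_meas l1; have m2 := L1_meas l2.
have lv : L1 (fun xi => `|g1 xi| + `|g2 xi|) by apply: L1D; exact: L1_norm.
have [|||_] := @dct R (fun n xi => expR (- (t n `^ gamma) * xi ^+ 2) *
    (cos (y n * xi + t n * xi ^+ 2) * g1 xi - sin (y n * xi + t n * xi ^+ 2) * g2 xi))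
  (fun xi => expR (- (t0 `^ gamma) * xi ^+ 2) *
    (cos (y0 * xi + t0 * xi ^+ 2) * g1 xi - sin (y0 * xi + t0 * xi ^+ 2) * g2 xi)) _ _ _ lv.
- by move=> n; mf.
- move=> xi.
  have cp : y n * xi + t n * xi ^+ 2 @[n --> \oo] --> y0 * xi + t0 * xi ^+ 2.
    by apply: cvgD; apply: cvgM => //; exact: cvg_cst.
  apply: cvgM.
    apply: continuous_cvg; first exact: continuous_expR.
    apply: cvgM; last exact: cvg_cst.
    by apply: cvgN; exact: powR_cvg_seq.
  apply: cvgB; apply: cvgM; try exact: cvg_cst.
    by apply: continuous_cvg => //; exact: continuous_cos.
  by apply: continuous_cvg => //; exact: continuous_sin.
- by move=> n xi; exact: Fop_integrand_le.
exact.
Qed.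

Section tannery.
Variables (F : nat -> R -> R) (F0 S : nat -> R) (P : R -> R) (M : R).
Hypotheses (S0 : forall k, 0 <= S k) (SM : forall n, \sum_(k < n) S k <= M)
  (FS : forall k t, 0 < t <= 1 -> `|F k t| <= S k)
  (cF : forall k, F k t @[t --> 0^'+] --> F0 k)
  (FP : forall t, 0 < t <= 1 -> \sum_(k < n) F k t @[n --> \oo] --> P t).

(** The tail of every series dominated by [S] is at most the tail of [S], uniformly in t, so only
    finitely many terms have to be passed to the limit. *)
Lemma tannery : exists2 V : R, \sum_(k < n) F0 k @[n --> \oo] --> V & P t @[t --> 0^'+] --> V.
Proof.
have FS0 k : `|F0 k| <= S k.
  have h : `|F k t| @[t --> 0^'+] --> `|F0 k| by apply: cvg_norm; exact: cF.
  apply: (cvgr_to_le h); near=> t; apply: FS; apply/andP; split.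
    by near: t; exact: nbhs_right_gt.
  by near: t; apply: nbhs_right_le.
have cS : cvgn (fun n => \sum_(k < n) S k).
  apply: (@series_cvg_of_bound _ S M) => n.
  by apply: le_trans (SM n); apply: ler_sum => k _; rewrite ger0_norm.
have cV : cvgn (fun n => \sum_(k < n) F0 k).
  apply: (@series_cvg_of_bound _ F0 M) => n.
  by apply: le_trans (SM n); apply: ler_sum => k _; exact: FS0.
set s := limn (fun n => \sum_(k < n) S k) in cS.
set V := limn (fun n => \sum_(k < n) F0 k) in cV.
have tail (u : nat -> R) n l : (forall k, `|u k| <= S k) ->
    \sum_(k < n) u k @[n --> \oo] --> l -> `|l - \sum_(k < n) u k| <= s - \sum_(k < n) S k.
  move=> uS cu.
  have h : `|\sum_(k < m) u k - \sum_(k < n) u k| @[m --> \oo] --> `|l - \sum_(k < n) u k|.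
    by apply: cvg_norm; apply: cvgB => //; exact: cvg_cst.
  apply: (cvgr_to_le h); near=> m.
  have nm : (n <= m)%N by near: m; exact: nbhs_infty_ge.
  apply: (@le_trans _ _ (\sum_(k < m) S k - \sum_(k < n) S k)).
    rewrite -!(big_mkord xpredT) (big_cat_nat (leq0n n) nm)//= addrAC subrr add0r.
    rewrite [leRHS](_ : _ = \sum_(n <= k < m) S k).
      by apply: (le_trans (ler_norm_sum _ _ _)); apply: ler_sum.
    by rewrite (big_cat_nat (leq0n n) nm)//= addrAC subrr add0r.
  rewrite lerB//; apply: nondecreasing_cvgn_le; last exact: cS.
  by apply/nondecreasing_seqP => j; rewrite big_ord_recr /= lerDl.
exists V => //; apply/cvgrPdist_le => e e0.
have e4 : 0 < e / 4 by rewrite divr_gt0.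
have [n hn] : exists n, s - \sum_(k < n) S k <= e / 4.
  have /cvgrPdist_le/(_ _ e4) [n _ h] := cS.
  by exists n; apply: (le_trans (ler_norm _)); apply: h => /=.
have cn : \sum_(k < n) F k t @[t --> 0^'+] --> \sum_(k < n) F0 k.
  elim: (n) => [|j IH].
    by rewrite big_ord0; under eq_fun do rewrite big_ord0; exact: cvg_cst.
  rewrite big_ord_recr /=; under eq_fun do rewrite big_ord_recr /=.
  by apply: cvgD.
near=> t.
have t01 : 0 < t <= 1.
  apply/andP; split; first by near: t; exact: nbhs_right_gt.
  by near: t; apply: nbhs_right_le.
have h1 := tail F0 n V FS0 cV.
have h2 := tail (F ^~ t) n (P t) (fun k => FS k t01) (FP t01).
have h3 : `|\sum_(k < n) F0 k - \sum_(k < n) F k t| <= e / 4.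
  by near: t; move/cvgrPdist_le : cn; apply.
move: h1 h2 h3; move: (\sum_(k < n) F0 k) (\sum_(k < n) F k t) => A B h1 h2 h3.
have -> : V - P t = (V - A) + (A - B) - (P t - B) by ring.
apply: (le_trans (ler_normB _ _)); apply: (@le_trans _ _ (e / 4 + e / 4 + e / 4)); last by lra.
apply: lerD; last exact: (le_trans h2).
by apply: (le_trans (ler_normD _ _)); apply: lerD => //; exact: (le_trans h1).
Unshelve. all: by end_near. Qed.
End tannery.
End Continuity.

(** * Almost everywhere convergence *)

Section AeZero.
Variable R : realType.
Local Notation mu := (@lebesgue_measure R).

Lemma L1_loc (h : R -> R) : L1 h -> locally_integrable setT h.
Proof. by move=> lh; rewrite -(patch_setT (fun=> point) h); apply: integrable_locally. Qed.

(** The primitive of h vanishes on each half-line, and by Lebesgue differentiation its derivative is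
    h almost everywhere. *)
Lemma ae_zero_itv (h : R -> R) : L1 h ->
  (forall a b, a < b -> \int[mu]_(x in `[a, b]) h x = 0) -> {ae mu, forall x, h x = 0}.
Proof.
move=> lh h0.
have F n : {ae mu, forall x, - n%:R < x -> h x = 0}.
  have FT := @FTC1 R h (BLeft (- n%:R : R)).
  have hI y : mu.-integrable `[- n%:R, y]%classic (EFin \o h).
    by apply: (integrableS measurableT _ _ lh) => //; exact: measurable_itv.
  have := FT hI (L1_loc lh).
  set F := fun x => _; rewrite /= => H.
  apply: aeS H => x H nx.
  have [|_ <-] := H; first by rewrite lte_fin.
  rewrite (_ : F = cst 0) ?derive1_cst//.
  apply/funext => y; rewrite /F /=; case: (ltgtP (- n%:R) y) => yn.
  - exact: h0.
  - by rewrite set_itv_ge ?Rintegral_set0// bnd_simp -ltNge.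
  - by rewrite yn set_itv1 Rintegral_set1.
have := ae_foralln F; apply: aeS => x H.
apply: (H (Num.bound `|x|)); rewrite ltrNl; apply: (le_lt_trans (ler_norm _)).
by rewrite normrN; apply: archi_boundP.
Qed.

(** Each piece is continuous in time, so a countable dense list of times sees its supremum over (0,
    1]. *)
Lemma rat_times : exists t : nat -> R, (forall j, 0 < t j <= 1) /\
  (forall tau : R, 0 < tau <= 1 -> exists phi : nat -> nat, t (phi n) @[n --> \oo] --> tau).
Proof.
pose t j : R := if unpickle j is Some q then (if 0 < (ratr q : R) <= 1 then ratr q else 1) else 1.
exists t; split.
  move=> j; rewrite /t; case: (unpickle j) => [q|]; last by rewrite ltr01 lexx.
  by case: ifP => // _; rewrite ltr01 lexx.
move=> tau /andP[t0 t1].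
(* The bound tau/2 keeps the rational positive, so that its code does not fall back to the default
   time 1. *)
have H n : exists j, Num.max (tau / 2) (tau - harmonic n) <= t j <= tau.
  have lt : Num.max (tau / 2) (tau - harmonic n) < tau.
    by rewrite gt_max ltrBlDr ltrDl harmonic_gt0 andbT; lra.
  have [q] := rat_in_itvoo lt; rewrite in_itv/= => /andP[q1 q2].
  exists (pickle q); rewrite /t pickleK.
  have q0 : 0 < ratr q :> R.
    by apply: lt_trans q1; rewrite lt_max divr_gt0.
  by rewrite q0 (le_trans (ltW q2) t1)/= (ltW q1) (ltW q2).
have [phi hphi] := choice H; exists phi.
have c1 : tau - harmonic n @[n --> \oo] --> tau.
  rewrite -[X in _ --> X]subr0; apply: cvgB; [exact: cvg_cst|exact: cvg_harmonic].
apply: (squeeze_cvgr _ c1 (cvg_cst tau)); near=> n.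
have /andP[h ->] := hphi n; rewrite andbT.
by move: h; rewrite ge_max => /andP[].
Unshelve. all: by end_near. Qed.
End AeZero.

(** * Dyadic frequency pieces *)

Section Pieces.
Variable R : realType.
Local Notation mu := (@lebesgue_measure R).

Definition dball n : set R := `[- 2 ^+ n, 2 ^+ n]%classic.
Definition dyad k : set R := if k is k'.+1 then dball k `\` dball k' else dball 0.

Lemma dball_meas n : measurable (dball n). Proof. exact: measurable_itv. Qed.

Lemma dyad_meas k : measurable (dyad k).
Proof. by case: k => [|k]; [exact: dball_meas|apply: measurableD; exact: dball_meas]. Qed.

Lemma dballP n x : dball n x <-> `|x| <= 2 ^+ n.
Proof. by rewrite /dball /= in_itv /= ler_norml. Qed.

Lemma dball_sub n : dball n `<=` dball n.+1.
Proof.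
move=> x /dballP h; apply/dballP; apply: (le_trans h).
by rewrite ler_eXn2l// ltr1n.
Qed.

Lemma dyad_ball k : dyad k `<=` dball k.
Proof. by case: k => [|k] x //= []. Qed.

Lemma dyad_telescope n x : \sum_(k < n.+1) \1_(dyad k) x = \1_(dball n) x :> R.
Proof.
elim: n => [|n IH]; first by rewrite big_ord1.
rewrite big_ord_recr/= IH !indicE.
have [h|h] := pselect (dball n x).
  by rewrite (mem_set h) (mem_set (dball_sub h)) memNset ?addr0// => -[].
rewrite (memNset h) add0r; have [h'|h'] := pselect (dball n.+1 x).
  by rewrite !mem_set.
by rewrite !memNset// => -[].
Qed.

Lemma dball_cvg (x : R) : \1_(dball n) x @[n --> \oo] --> (1 : R).
Proof.
apply: cvg_near_cst; near=> n.
rewrite indicE mem_set//; apply/dballP.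
apply: (@le_trans _ _ n%:R); first by near: n; exact: nbhs_infty_ger.
by rewrite -natrX ler_nat ltnW// ltn_expl.
Unshelve. all: by end_near. Qed.

(** In the k-th annulus |xi| > 2^(k-1), so the weight is at least 2^(2 s (k-1)); the first factor
    makes up for the shift by one. *)
Lemma dyad_weight (s : R) k xi : 0 <= s -> dyad k xi ->
  1 <= expR (2 * s * ln 2) * expR (- (2 * s * ln 2) * k%:R) * (1 + xi ^+ 2) `^ s.
Proof.
move=> s0; rewrite -expRD powR_pos_ln ?ltr_pwDl ?sqr_ge0// -expRD => dk.
apply: le_trans (expR_ge1Dx _); rewrite lerDl; move: dk.
have l2 : 0 < ln 2 :> R by apply: ln_gt0; rewrite ltr1n.
have x0 : 0 <= ln (1 + xi ^+ 2) by apply: ln_ge0; rewrite lerDl sqr_ge0.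
case: k => [|k] /=.
  by move=> _; rewrite mulr0 addr0 addr_ge0 ?mulr_ge0// ltW.
move=> [_ /dballP/negP]; rewrite -ltNge => h.
have : 2 * ln 2 * k%:R <= ln (1 + xi ^+ 2).
  have -> : 2 * ln 2 * k%:R = ln ((2 ^+ k) ^+ 2) :> R.
    by rewrite ln_sqr ?exprn_gt0// lnXn// -mulr_natl; ring.
  rewrite ler_ln ?posrE ?exprn_gt0 ?exprn_gt0 ?ltr_pwDl ?sqr_ge0//.
  rewrite -(real_normK (num_real xi)); apply: (@le_trans _ _ (`|xi| ^+ 2)); last by rewrite lerDr.
  by rewrite lerXn2r ?nnegrE// ltW.
move=> /(ler_wpM2l s0); rewrite -[k.+1]addn1 natrD; move: (ln (1 + xi ^+ 2)) x0 => L x0.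
by move: (ln 2) l2 (k%:R) => z z0 kk h2; lra.
Qed.

Lemma ln2X k : ln (2 ^+ k) = k%:R * ln 2 :> R.
Proof. by rewrite lnXn// mulr_natl. Qed.

Lemma kap_massM (p q L A x : R) : kap_mass p q L (A * x) = kap_mass p q L A * x.
Proof. by rewrite /kap_mass; ring. Qed.

Lemma indic01 (D : set R) (x : R) : (\1_D x : R) = 0 \/ (\1_D x : R) = 1.
Proof. by rewrite indicE; case: (x \in D); [right|left]. Qed.

Lemma itv_indic_int (a b c d : R) (f : R -> R) : a < b ->
  (forall a' b', a' < b' -> c <= a' -> b' <= d -> \int[mu]_(x in `[a', b']) f x = 0) ->
  \int[mu]_(x in `[a, b]) (\1_(`[c, d]%classic) x * f x) = 0.
Proof.
move=> ab h; rewrite [LHS]i_set.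
have E x : \1_(`[a, b]%classic) x * (\1_(`[c, d]%classic) x * f x) =
    \1_(`[Num.max a c, Num.min b d]%classic) x * f x.
  rewrite mulrA; congr (_ * _); rewrite !indicE -natrM mulnb; congr (_%:R); congr nat_of_bool.
  apply/idP/idP.
    move=> /andP[]; rewrite !inE /= !in_itv /= => /andP[h1 h2] /andP[h3 h4].
    by rewrite ge_max le_min h1 h2 h3 h4.
  rewrite !inE /= !in_itv /= ge_max le_min => /andP[/andP[h1 h2] /andP[h3 h4]].
  by apply/andP; split; apply: mem_set; rewrite /= in_itv/= ?h1 ?h2 ?h3 ?h4.
rewrite (i_eq E) -[LHS]i_set; case: (ltgtP (Num.max a c) (Num.min b d)) => m.
- by apply: h => //; [rewrite le_max lexx orbT|rewrite ge_min lexx orbT].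
- by rewrite set_itv_ge ?Rintegral_set0// bnd_simp -ltNge.
- by rewrite m set_itv1 Rintegral_set1.
Qed.

Lemma int_itv_osc (a b : R) (h1 h2 : R -> R) : L1 h1 -> L1 h2 ->
  \int[mu]_(x in `[a, b]) \int[mu]_xi (cos (x * xi) * h1 xi - sin (x * xi) * h2 xi) =
  \int[mu]_xi (box1 a b xi * h1 xi - box2 a b xi * h2 xi).
Proof.
move=> l1 l2; pose C := `[a, b]%classic.
have mh1 := L1_meas l1; have mh2 := L1_meas l2.
have lC : L1 (\1_C : R -> R) := L1_itv a b; have mC := L1_meas lC.
have i0 x := indic_ge0 C x.
pose F (p : R * R) := \1_C p.1 * (cos (p.1 * p.2) * h1 p.2 - sin (p.1 * p.2) * h2 p.2).
have le x xi : `|cos (x * xi) * h1 xi - sin (x * xi) * h2 xi| <= `|h1 xi| + `|h2 xi|.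
  apply: (le_trans (ler_normB _ _)); rewrite !(normrM (cos _)) !(normrM (sin _)); apply: lerD.
    by rewrite ler_piMl// cos_le1n.
  by rewrite ler_piMl// sin_le1n.
have [||_ _ _ _ h5] := fubini_dom (F := F) _ lC (L1D (L1_norm l1) (L1_norm l2)).
- by rewrite /F; mf.
- by move=> x xi; rewrite /F /= normrM (ger0_norm (i0 _)) ler_wpM2l.
rewrite [LHS]i_set.
have -> : \int[mu]_x (\1_C x * \int[mu]_xi (cos (x * xi) * h1 xi - sin (x * xi) * h2 xi)) =
    \int[mu]_x \int[mu]_xi F (x, xi).
  apply: i_eq => x; rewrite -iZ//.
  by apply: (L1_le _ (le x) (L1D (L1_norm l1) (L1_norm l2))); mf.
rewrite h5; apply: i_eq => xi.
rewrite /box1 /box2 [X in (X * _ - _)]i_set [X in (_ - X * _)]i_set.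
have lc : L1 (fun x => \1_C x * cos (x * xi)).
  apply: (L1_le _ _ lC) => [|x]; first by mf.
  by rewrite normrM (ger0_norm (i0 x)) ler_piMr// cos_le1n.
have ls : L1 (fun x => \1_C x * sin (x * xi)).
  apply: (L1_le _ _ lC) => [|x]; first by mf.
  by rewrite normrM (ger0_norm (i0 x)) ler_piMr// sin_le1n.
transitivity (\int[mu]_x (h1 xi * (\1_C x * cos (x * xi)) - h2 xi * (\1_C x * sin (x * xi)))).
  by apply: i_eq => x; rewrite /F /=; ring.
rewrite (iB (L1Z _ lc) (L1Z _ ls)) (iZ _ lc) (iZ _ ls).
by rewrite mulrC (mulrC (h2 xi)).
Qed.

Lemma dball_trunc n (g : R -> R) : measurable_fun setT g -> L1 (fun xi => g xi ^+ 2) ->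
  L1 (fun xi => \1_(dball n) xi * g xi).
Proof.
move=> mg l; have md : measurable_fun setT (\1_(dball n) : R -> R) := m_indic (dball_meas n).
have k0 : (0 : R) < 2 ^+ n by rewrite exprn_gt0.
apply: (L2supp_L1 k0).
- by mf.
- apply: L1_eq (L1_indic (dball_meas n) l) => xi.
  by rewrite exprMn sqr_indic.
- by move=> xi h; rewrite indicE memNset ?mul0r// => /dballP; rewrite leNgt h.
Qed.

Lemma dball_int_cvg (f : R -> R) : L1 f ->
  \int[mu]_xi (\1_(dball n) xi * f xi) @[n --> \oo] --> \int[mu]_xi f xi.
Proof.
move=> lf; have [|||_ h] := @dct R (fun n xi => \1_(dball n) xi * f xi) f _ _ _ (L1_norm lf).
- by move=> n; apply: m_mul; [exact: m_indic (dball_meas n)|exact: L1_meas lf].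
- by move=> xi; rewrite -[X in _ --> X]mul1r; apply: cvgM; [exact: dball_cvg|exact: cvg_cst].
- move=> n xi; rewrite normrM -[leRHS]mul1r ler_pM// (ger0_norm (indic_ge0 _ _)).
  by have /andP[] := indic_le1 (dball n) xi.
exact: h.
Qed.
End Pieces.

Section ConvRe.
Variable R : realType.
Local Notation mu := (@lebesgue_measure R).
Variables (alpha gamma sigma th C1 C3 s : R).
Hypotheses (al0 : 0 < alpha) (g0 : 0 < gamma) (s01 : 0 < sigma < 2^-1)
  (th01 : 2^-1 <= th < 1) (C10 : 0 < C1) (C30 : 0 < C3)
  (e1 : 1 - th <= 2 * sigma) (e2 : th - (2 * th - 1) / gamma <= 2 * sigma)
  (q11 : near_exp alpha gamma sigma < 1) (sig_s : sigma < s).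
Variable Gam : R -> R -> R.
Hypotheses (bil : forall t x x', 0 < t <= 1 -> C1 * `|x - x'| <= `|Gam x t - Gam x' t|)
  (hol : forall x t t', 0 <= t <= 1 -> 0 <= t' <= 1 -> `|Gam x t - Gam x t'| <= C3 * `|t - t'| `^ alpha)
  (Gam0 : forall x, Gam x 0 = x)
  (mG : forall t, 0 < t <= 1 -> measurable_fun setT (Gam ^~ t)).
Variables (f1 f2 g1 g2 : R -> R).
Hypotheses (Ff : is_fourier f1 f2 g1 g2)
  (lW : L1 (fun xi => sq g1 g2 xi * (1 + xi ^+ 2) `^ s)).

Let s0 : 0 <= s. Proof. by have /andP[h _] := s01; apply: ltW; exact: lt_trans sig_s. Qed.

Let L2g : [/\ measurable_fun setT g1, measurable_fun setT g2 & L1 (sq g1 g2)].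
Proof. by have [_ [/L2P ? _]] := Ff. Qed.
Let L2f : [/\ measurable_fun setT f1, measurable_fun setT f2 & L1 (sq f1 f2)].
Proof. by have [/L2P ? _] := Ff. Qed.

Let a1 k xi := \1_(dyad k) xi * g1 xi.
Let a2 k xi := \1_(dyad k) xi * g2 xi.

Let ma k : measurable_fun setT (a1 k) /\ measurable_fun setT (a2 k).
Proof.
have [h1 h2 _] := L2g.
by split; apply: m_mul => //; apply: m_indic; exact: dyad_meas.
Qed.

Let sqa k xi : sq (a1 k) (a2 k) xi = \1_(dyad k) xi * sq g1 g2 xi.
Proof. by rewrite /sq !exprMn sqr_indic mulrDr. Qed.

Let la k : L1 (sq (a1 k) (a2 k)).
Proof.
have [_ _ h] := L2g.
by apply: L1_eq (L1_indic (dyad_meas k) h) => xi; rewrite sqa.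
Qed.

Let supp k (g : R -> R) xi : 2 ^+ k < `|xi| -> \1_(dyad k) xi * g xi = 0.
Proof.
move=> h; rewrite indicE memNset ?mul0r// => /dyad_ball/dballP.
by rewrite leNgt h.
Qed.

Let la1 k : L1 (a1 k) /\ L1 (a2 k).
Proof.
have [h1 h2] := ma k; have k0 : (0 : R) < 2 ^+ k by rewrite exprn_gt0.
split; apply: (L2supp_L1 k0) => //.
- exact: (sq_L1l h1 (la k)).
- exact: supp.
- exact: (sq_L1r h2 (la k)).
- exact: supp.
Qed.

Let N := \int[mu]_xi (sq g1 g2 xi * (1 + xi ^+ 2) `^ s).

Let energy k : \int[mu]_xi sq (a1 k) (a2 k) xi <=
  expR (2 * s * ln 2) * expR (- (2 * s * ln 2) * k%:R) * N.
Proof.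
rewrite -(iZ _ lW); apply: i_le; [exact: la|exact: L1Z|] => xi.
rewrite sqa; case: (indic01 (dyad k) xi) => E; rewrite E.
  by rewrite mul0r !mulr_ge0 ?expR_ge0 ?sq_ge0 ?powR_ge0.
have dk : dyad k xi.
  by apply: contrapT => h; move: E; rewrite indicE memNset// => /eqP; rewrite eq_sym oner_eq0.
have := dyad_weight s0 dk; have := sq_ge0 g1 g2 xi.
by rewrite mul1r => h1 h2; rewrite mulrCA -[leLHS]mulr1 ler_wpM2l.
Qed.

Let c (rho : R) := max_const alpha gamma sigma th C1 C3 rho 1.

Let max_constE rho k : max_const alpha gamma sigma th C1 C3 rho (2 ^+ k) =
  c rho * expR (2 * sigma * ln 2 * k%:R).
Proof.
rewrite /c /max_const !kap_massM ln1 mulr0 expR0 ln2X mulr1 mulrAC; congr (_ * _).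
by congr expR; ring.
Qed.

Variable rho : R.
Hypothesis rho0 : 0 < rho.
Let B := `[- rho, rho]%classic.

Variable t : nat -> R.
Hypothesis t01 : forall j, 0 < t j <= 1.
Hypothesis td : forall tau : R, 0 < tau <= 1 -> exists phi : nat -> nat, t (phi n) @[n --> \oo] --> tau.

Let m k n x := maxF gamma Gam (a1 k) (a2 k) t n x.

Let K := c rho * expR (2 * s * ln 2) * N.
(** q = 2^(sigma - s): the k-th piece has energy of order 2^(-2 s k), and the maximal bound costs
    2^(2 sigma k). *)
Let q := expR (- ((s - sigma) * ln 2)).

Let l2 : 0 < ln 2 :> R. Proof. by apply: ln_gt0; rewrite ltr1n. Qed.
Let q0 : 0 < q. Proof. exact: expR_gt0. Qed.
Let qlt1 : q < 1.
Proof. by rewrite -expR0 ltr_expR oppr_lt0 mulr_gt0// subr_gt0. Qed.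

Let mest k n : measurable_fun setT (m k n) /\ L1 (fun x => \1_B x * m k n x ^+ 2) /\
  \int[mu]_x (\1_B x * m k n x ^+ 2) <= K * (q ^+ k) ^+ 2.
Proof.
have [h1 h2] := ma k; have k1 : (1 : R) <= 2 ^+ k by rewrite exprn_ege1// ler1n.
have hol' x u u' : 0 < u <= 1 -> 0 < u' <= 1 -> `|Gam x u - Gam x u'| <= C3 * `|u - u'| `^ alpha.
  by move=> /andP[/ltW h hh] /andP[/ltW h' hh']; apply: hol; rewrite ?h ?h'.
have [r1 [r2 r3]] := maxF_est al0 g0 s01 th01 C10 C30 e1 e2 q11 bil hol' mG rho0 k1 h1 h2 (la k)
  (fun xi h => supp g1 h) (fun xi h => supp g2 h) t01 n.
split => //; split => //; apply: (le_trans r3); rewrite max_constE.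
have c0 : 0 <= c rho.
  have p01 : 0 <= near_exp alpha gamma sigma < 1 by rewrite q11 (near_exp_ge0 al0 g0 s01).
  have [ta tb] := andP th01; have ta0 : 0 <= th by apply: le_trans ta.
  rewrite /c /max_const /kap_mass mulr_ge0 ?expR_ge0// mulr_ge0//.
    by rewrite mulr_ge0 ?near_far_const_ge0 ?expR_ge0.
  have r2' : 0 <= 2 * (2 * rho) by rewrite !mulr_ge0// ltW.
  have d1 : 0 <= 1 - near_exp alpha gamma sigma by rewrite subr_ge0 ltW.
  have d2 : 0 <= 1 - th by rewrite subr_ge0 ltW.
  exact: (addr_ge0 (divr_ge0 (mulr_ge0 r2' (powR_ge0 _ _)) d1) (divr_ge0 (mulr_ge0 r2' (powR_ge0 _ _)) d2)).
have Q : (q ^+ k) ^+ 2 = expR (2 * sigma * ln 2 * k%:R) * expR (- (2 * s * ln 2) * k%:R).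
  by rewrite /q -expRM_natr expr2 -!expRD; congr expR; ring.
apply: (@le_trans _ _ (c rho * expR (2 * sigma * ln 2 * k%:R) * (expR (2 * s * ln 2) * expR (- (2 * s * ln 2) * k%:R) * N))).
  by rewrite ler_wpM2l ?energy// mulr_ge0// expR_ge0.
by rewrite Q /K le_eqVlt; apply/orP; left; apply/eqP; ring.
Qed.

Let m0 k n x : 0 <= m k n x. Proof. exact: maxF_ge0. Qed.

(** The weight q^k balances the two terms, so that the L^1 norm on the ball is again of order q^k
    and can be summed over k. *)
Let Bm_le k n x : \1_B x * m k n x <= 2^-1 * (q ^+ k * \1_B x + (q ^+ k)^-1 * (\1_B x * m k n x ^+ 2)).
Proof.
have Q0 : 0 < q ^+ k by rewrite exprn_gt0.
rewrite (_ : 2^-1 * _ = \1_B x * (2^-1 * (q ^+ k + (q ^+ k)^-1 * m k n x ^+ 2))); last by ring.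
rewrite ler_wpM2l ?indic_ge0//; move: (q ^+ k) Q0 (m k n x) => Q Q0 M.
rewrite -subr_ge0 (_ : _ - M = 2^-1 * Q^-1 * (Q - M) ^+ 2).
  by rewrite mulr_ge0 ?sqr_ge0// mulr_ge0// invr_ge0 ltW.
by field; rewrite gt_eqF.
Qed.

Let Bm_L1 k n : L1 (fun x => \1_B x * m k n x) /\
  \int[mu]_x (\1_B x * m k n x) <= q ^+ k * ((2 * rho + K) / 2).
Proof.
have Q0 : 0 < q ^+ k by rewrite exprn_gt0.
have [h1 [h2 h3]] := mest k n.
have lB : L1 (\1_B : R -> R) by exact: L1_itv.
have lR : L1 (fun x => 2^-1 * (q ^+ k * \1_B x + (q ^+ k)^-1 * (\1_B x * m k n x ^+ 2))).
  by apply: L1Z; apply: L1D; apply: L1Z.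
have l : L1 (fun x => \1_B x * m k n x).
  apply: (L1_le _ _ lR) => [|x]; first by apply: m_mul => //; exact: L1_meas lB.
  by rewrite ger0_norm ?Bm_le// mulr_ge0 ?indic_ge0.
split => //; apply: (le_trans (i_le l lR (Bm_le k n))).
rewrite iZ; last by apply: L1D; apply: L1Z.
rewrite iD; [|exact: L1Z|exact: L1Z].
rewrite iZ// iZ// i_itv; last by rewrite gtrN.
apply: (@le_trans _ _ (2^-1 * (q ^+ k * (rho - - rho) + (q ^+ k)^-1 * (K * (q ^+ k) ^+ 2)))).
  by rewrite ler_wpM2l// lerD2l ler_wpM2l// invr_ge0 ltW.
rewrite le_eqVlt; apply/orP; left; apply/eqP; move: (q ^+ k) Q0 => Q Q0.
by field; rewrite gt_eqF.
Qed.

Let geo n : \sum_(k < n) q ^+ k <= (1 - q)^-1.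
Proof.
have d0 : 0 < 1 - q by rewrite subr_gt0.
rewrite -[leRHS]mul1r ler_pdivlMr// mulrC.
have -> : (1 - q) * \sum_(k < n) q ^+ k = 1 - q ^+ n.
  by rewrite -(opprB q) mulNr -subrX1 opprB.
by rewrite lerBlDr lerDl exprn_ge0// ltW.
Qed.

(** The number of pieces and the number of times grow together, which keeps a single monotone
    sequence. *)
Let Tn n x := \sum_(k < n) \1_B x * m k n x.

Let Tbound : exists2 S : R -> R, L1 S & {ae mu, forall x n, Tn n x <= S x}.
Proof.
have h n := @L1_sum R (fun k x => \1_B x * m k n x) n (fun k => (Bm_L1 k n).1).
apply: (@mono_ae_dominated _ Tn ((1 - q)^-1 * ((2 * rho + K) / 2))).
- by move=> n; case: (h n).
- by move=> n x; apply: sumr_ge0 => k _; rewrite mulr_ge0 ?indic_ge0.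
- move=> n x; rewrite /Tn big_ord_recr /=.
  apply: (@le_trans _ _ (\sum_(k < n) \1_B x * m k n.+1 x)); last by rewrite lerDl mulr_ge0 ?indic_ge0.
  by apply: ler_sum => k _; rewrite ler_wpM2l ?indic_ge0//; exact: maxF_homo.
- move=> n; rewrite (h n).2.
  apply: (@le_trans _ _ (\sum_(k < n) q ^+ k * ((2 * rho + K) / 2))).
    by apply: ler_sum => k _; case: (Bm_L1 k n).
  have [_ [l3 h3]] := mest 0 0; move: h3; rewrite expr0 expr1n mulr1 => h3.
  have K0 : 0 <= K.
    by apply: le_trans h3; apply: i_ge0 => x; rewrite mulr_ge0 ?indic_ge0 ?sqr_ge0.
  have K1 : 0 <= (2 * rho + K) / 2.
    by apply: divr_ge0 => //; apply: addr_ge0 => //; apply: mulr_ge0 => //; exact: ltW.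
  by rewrite -mulr_suml; apply: ler_wpM2r => //; exact: geo.
Qed.

Let J y tau xi := expR (- (tau `^ gamma) * xi ^+ 2) *
    (cos (y * xi + tau * xi ^+ 2) * g1 xi - sin (y * xi + tau * xi ^+ 2) * g2 xi).

Let Fop_sum n y tau : L1 (fun xi => \1_(dball n) xi * J y tau xi) /\
  \sum_(k < n.+1) Fop gamma (a1 k) (a2 k) y tau = \int[mu]_xi (\1_(dball n) xi * J y tau xi).
Proof.
have [mg1 mg2 _] := L2g.
have lk k : L1 (fun xi => \1_(dyad k) xi * J y tau xi).
  have [l1 l2'] := la1 k; have mi : measurable_fun setT (\1_(dyad k) : R -> R) := m_indic (dyad_meas k).
  apply: (L1_le _ _ (L1D (L1_norm l1) (L1_norm l2'))) => [|xi]; first by rewrite /J; mf.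
  rewrite /a1 /a2 !normrM -mulrDr ler_wpM2l//.
  rewrite -normrM; exact: Fop_integrand_le.
have [h1 h2] := L1_sum n.+1 lk.
have E xi : \sum_(k < n.+1) \1_(dyad k) xi * J y tau xi = \1_(dball n) xi * J y tau xi.
  by rewrite -mulr_suml dyad_telescope.
split; first by apply: L1_eq h1 => xi; rewrite E.
rewrite -(i_eq E) h2; apply: eq_bigr => k _; apply: i_eq => xi.
by rewrite /a1 /a2 /J; ring.
Qed.

(** Although g is only in L^2, the damping e at a positive time makes the integrand integrable, by 2
    e |g| <= e^2 + |g|^2. *)
Let Fop_pieces y tau : 0 < tau ->
  \sum_(k < n) Fop gamma (a1 k) (a2 k) y tau @[n --> \oo] --> Fop gamma g1 g2 y tau.
Proof.
move=> tau0; have [mg1 mg2 lg] := L2g.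
rewrite -cvg_shiftS /=.
under eq_fun do rewrite (Fop_sum _ y tau).2.
have b0 : 0 < 2 * tau `^ gamma by rewrite mulr_gt0// powR_gt0.
have lJ : L1 (fun xi => 2 * expR (- (2 * tau `^ gamma) * xi ^+ 2) + sq g1 g2 xi).
  by apply: L1D => //; apply: L1Z; exact: gauss_L1.
have JE xi : `|J y tau xi| <= 2 * expR (- (2 * tau `^ gamma) * xi ^+ 2) + sq g1 g2 xi.
  rewrite /J normrM ger0_norm ?expR_ge0//.
  have -> : expR (- (2 * tau `^ gamma) * xi ^+ 2) = expR (- (tau `^ gamma) * xi ^+ 2) ^+ 2.
    by rewrite -[RHS]/(expR _ * expR _) -expRD; congr expR; ring.
  have /ler_wpM2l : `|cos (y * xi + tau * xi ^+ 2) * g1 xi - sin (y * xi + tau * xi ^+ 2) * g2 xi| <= `|g1 xi| + `|g2 xi|.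
    apply: (le_trans (ler_normB _ _)); rewrite !normrM; apply: lerD.
      by rewrite ler_piMl// cos_le1n.
    by rewrite ler_piMl// sin_le1n.
  move=> /(_ _ (expR_ge0 (- (tau `^ gamma) * xi ^+ 2))) h; apply: (le_trans h).
  rewrite /sq -(real_normK (num_real (g1 xi))) -(real_normK (num_real (g2 xi))).
  move: (expR _) (`|g1 xi|) (`|g2 xi|) => e u v.
  have := sqr_ge0 (e - u); have := sqr_ge0 (e - v); have := sqr_ge0 u; have := sqr_ge0 v; nra.
have mJ : measurable_fun setT (fun xi : R => expR (- (tau `^ gamma) * xi ^+ 2) *
    (cos (y * xi + tau * xi ^+ 2) * g1 xi - sin (y * xi + tau * xi ^+ 2) * g2 xi)) by mf.
by apply: dball_int_cvg; exact: (L1_le mJ JE lJ).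
Qed.

Let Gam_cvg x (t0 : R) (u : nat -> R) : 0 <= t0 <= 1 -> (forall n, 0 < u n) ->
  (\forall n \near \oo, u n <= 1) -> u n @[n --> \oo] --> t0 ->
  Gam x (u n) @[n --> \oo] --> Gam x t0.
Proof.
move=> t001 u0 u1 cu; apply: cvg_zero; apply: norm_cvg0.
have c0 : `|u n - t0| @[n --> \oo] --> (0 : R).
  by rewrite -(@normr0 _ R) -(subrr t0); apply: cvg_norm; apply: cvgB => //; exact: cvg_cst.
have c1 : C3 * `|u n - t0| `^ alpha @[n --> \oo] --> (0 : R).
  by rewrite -[X in _ --> X](mulr0 C3); apply: cvgM; [exact: cvg_cst|exact: powR_cvg_seq0].
apply: (squeeze_cvgr _ (cvg_cst (0:R)) c1); near=> n.
rewrite normr_ge0 /=; apply: hol => //; apply/andP; split; first exact: ltW.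
by near: n.
Unshelve. all: by end_near. Qed.

(** The suprema of the pieces over the listed times are summable, continuity extends them to all
    times, and [tannery] gives the limit. The bound on the partial sums at time 0 serves later as a
    majorant. *)
Let pt_conv x M : B x -> (forall n, Tn n x <= M) ->
  (forall n, `|\sum_(k < n) Fop gamma (a1 k) (a2 k) x 0| <= M) /\
  exists2 V : R, \sum_(k < n) Fop gamma (a1 k) (a2 k) x 0 @[n --> \oo] --> V &
    Fop gamma g1 g2 (Gam x tau) tau @[tau --> 0^'+] --> V.
Proof.
move=> Bx hM.
have TM n : \sum_(k < n) m k n x <= M.
  apply: le_trans (hM n); rewrite le_eqVlt; apply/orP; left; apply/eqP.
  by apply: eq_bigr => k _; rewrite indicE mem_set// mul1r.
have ub k : has_ubound (range (m k ^~ x)).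
  exists M => _ [n _ <-].
  apply: (@le_trans _ _ (m k (maxn n k.+1) x)); first by apply: maxF_homo; exact: leq_maxl.
  apply: le_trans (TM (maxn n k.+1)).
  have kn : (k < maxn n k.+1)%N by exact: leq_maxr.
  rewrite (bigD1 (Ordinal kn))//= lerDl; exact: sumr_ge0.
pose S k := sup (range (m k ^~ x)).
have mS k n : m k n x <= S k by apply: ub_le_sup => //; exists n.
have cS k : m k n x @[n --> \oo] --> S k.
  by apply: nondecreasing_cvgn => //; move=> i j; exact: maxF_homo.
have S0 k : 0 <= S k by exact: le_trans (mS k 0%N).
have SM j : \sum_(k < j) S k <= M.
  have cs : \sum_(k < j) m k n x @[n --> \oo] --> \sum_(k < j) S k.
    elim: j => [|j IH].
      by rewrite big_ord0; under eq_fun do rewrite big_ord0; exact: cvg_cst.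
    by rewrite big_ord_recr /=; under eq_fun do rewrite big_ord_recr /=; exact: cvgD.
  apply: (cvgr_to_le cs); near=> n.
  have jn : (j <= n)%N by near: n; exact: nbhs_infty_ge.
  apply: le_trans (TM n); rewrite -!(big_mkord xpredT (fun k => m k n x)).
  by rewrite (big_cat_nat (leq0n j) jn)//= lerDl; exact: sumr_ge0.
have FS k tau : 0 < tau <= 1 -> `|Fop gamma (a1 k) (a2 k) (Gam x tau) tau| <= S k.
  move=> tau01; have [phi cphi] := td tau01; have [l1 l2'] := la1 k.
  have /andP[tau0 tau1] := tau01.
  have tn0 n : 0 < t (phi n) by have /andP[] := t01 (phi n).
  have cs : `|Fop gamma (a1 k) (a2 k) (Gam x (t (phi n))) (t (phi n))| @[n --> \oo] -->
      `|Fop gamma (a1 k) (a2 k) (Gam x tau) tau|.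
    apply: cvg_norm; apply: (Fop_cvg g0 l1 l2') => //; first exact: ltW.
    apply: Gam_cvg => //; first by rewrite (ltW tau0).
    by near=> n; have /andP[] := t01 (phi n).
  apply: (cvgr_to_le cs); near=> n.
  by apply: (le_trans _ (mS k (phi n))); exact: maxF_ge.
have cF k : Fop gamma (a1 k) (a2 k) (Gam x tau) tau @[tau --> 0^'+] --> Fop gamma (a1 k) (a2 k) x 0.
  apply/cvg_at_rightP => u [u0 cu]; have [l1 l2'] := la1 k.
  apply: (Fop_cvg g0 l1 l2') => //; rewrite -[X in _ --> X]Gam0.
  apply: Gam_cvg => //; first by rewrite lexx ler01.
  by near=> n; apply: ltW; near: n; move/cvgr_lt : cu; apply; exact: ltr01.
have FP tau : 0 < tau <= 1 -> \sum_(k < n) Fop gamma (a1 k) (a2 k) (Gam x tau) tau @[n --> \oo] -->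
   Fop gamma g1 g2 (Gam x tau) tau.
  by move=> /andP[tau0 _]; exact: Fop_pieces.
split; last exact: (tannery S0 SM FS cF FP).
move=> n; apply: le_trans (SM n); apply: (le_trans (ler_norm_sum _ _ _)); apply: ler_sum => k _.
have h : `|Fop gamma (a1 k) (a2 k) (Gam x tau) tau| @[tau --> 0^'+] --> `|Fop gamma (a1 k) (a2 k) x 0|.
  by apply: cvg_norm; exact: cF.
apply: (cvgr_to_le h); near=> tau; apply: FS; apply/andP; split.
  by near: tau; exact: nbhs_right_gt.
by near: tau; apply: nbhs_right_le.
Unshelve. all: by end_near. Qed.

(** At time 0 the damping factor is 1, so these are frequency-truncated inverse Fourier
    integrals. *)
Let W n x := \sum_(k < n) Fop gamma (a1 k) (a2 k) x 0.

Let W_meas n : measurable_fun setT (W n).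
Proof.
elim: n => [|n IH].
  by apply: eq_measurable_fun (m_cst (0 : R)) => x _; rewrite /W big_ord0.
have [l1 l2'] := la1 n.
have h := m_add IH (Fop_meas gamma (@m_idR R) (m_cst (0 : R)) l1 l2').
by apply: eq_measurable_fun h => x _; rewrite /W big_ord_recr.
Qed.

Let W_box n a b : \int[mu]_(x in `[a, b]) W n.+1 x =
  \int[mu]_xi (\1_(dball n) xi * (box1 a b xi * g1 xi - box2 a b xi * g2 xi)).
Proof.
have [mg1 mg2 lg] := L2g.
have E x : W n.+1 x = \int[mu]_xi (cos (x * xi) * (\1_(dball n) xi * g1 xi) - sin (x * xi) * (\1_(dball n) xi * g2 xi)).
  rewrite /W (Fop_sum n x 0).2; apply: i_eq => xi.
  by rewrite /J powR0 ?(gt_eqF g0)// oppr0 !mul0r expR0 mul1r !addr0; ring.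
have -> : \int[mu]_(x in `[a, b]) W n.+1 x = \int[mu]_(x in `[a, b])
    \int[mu]_xi (cos (x * xi) * (\1_(dball n) xi * g1 xi) - sin (x * xi) * (\1_(dball n) xi * g2 xi)).
  by apply: eq_Rintegral => x _; exact: E.
rewrite int_itv_osc.
- by apply: i_eq => xi; ring.
- exact: dball_trunc (sq_L1l mg1 lg).
- exact: dball_trunc (sq_L1r mg2 lg).
Qed.

Let W_box_cvg a b : a < b ->
  \int[mu]_(x in `[a, b]) W n x @[n --> \oo] --> 2 * pi * \int[mu]_(x in `[a, b]) f1 x.
Proof.
move=> ab; have [lb <-] := fourier_box ab Ff.
rewrite -cvg_shiftS /=; under eq_fun do rewrite W_box.
exact: dball_int_cvg.
Qed.

(** The limit along the curve equals the limit v of the partial sums at time 0. These are dominated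
    by an integrable function, so their integrals over intervals converge to those of v; by
    [fourier_box] they also converge to those of 2 pi f1, and [ae_zero_itv] concludes. *)
Lemma conv_ball : {ae mu, forall x, B x -> Fop gamma g1 g2 (Gam x tau) tau @[tau --> 0^'+] --> 2 * pi * f1 x}.
Proof.
have [S lS aeTS] := Tbound; have [mf1 mf2 lf] := L2f.
pose w n x := \1_B x * W n x.
have mB : measurable_fun setT (\1_B : R -> R) := m_indic (measurable_itv _).
have mw n : measurable_fun setT (w n) by apply: m_mul; [exact: mB|exact: W_meas].
have [v mv wv] := measurable_limit mw.
have pt : {ae mu, forall x, (forall n, `|w n x| <= `|S x|) /\ w n x @[n --> \oo] --> v x /\
    (B x -> Fop gamma g1 g2 (Gam x tau) tau @[tau --> 0^'+] --> v x)}.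
  apply: aeS aeTS => x hx; have [Bx|nBx] := pselect (B x); last first.
    have w0 n : w n x = 0 by rewrite /w indicE memNset// mul0r.
    have cw : w n x @[n --> \oo] --> (0 : R) by under eq_fun do rewrite w0; exact: cvg_cst.
    by split => [n|]; [rewrite w0 normr0|rewrite (wv _ _ cw)].
  have [b [V cV cF]] := pt_conv Bx hx.
  have wE n : w n x = W n x by rewrite /w indicE mem_set// mul1r.
  have cw : w n x @[n --> \oo] --> V by under eq_fun do rewrite wE; exact: cV.
  split => [n|]; first by rewrite wE; apply: (le_trans (b n)); exact: ler_norm.
  by rewrite (wv _ _ cw).
have aeb : {ae mu, forall x n, `|w n x| <= `|S x|} by apply: aeS pt => x [].
have aec : {ae mu, forall x, w n x @[n --> \oo] --> v x} by apply: aeS pt => x [_ []].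
have [lv _] := dct_ae mw mv aec (L1_norm lS) aeb.
have lBf : L1 (fun x => \1_B x * f1 x).
  apply: (L1_le _ _ (L1D (L1_itv (- rho) rho) (sq_L1l mf1 lf))) => [|x]; first by mf.
  have /andP[i0 i1] := indic_le1 B x; rewrite normrM (ger0_norm i0) -/B.
  have := sqr_ge0 (`|f1 x| - 1); rewrite -(real_normK (num_real (f1 x))).
  by case: (indic01 B x) => ->; move: (`|f1 x|) => z; nra.
have vint a b : a < b -> - rho <= a -> b <= rho ->
    \int[mu]_(x in `[a, b]) v x = 2 * pi * \int[mu]_(x in `[a, b]) f1 x.
  move=> ab ra br; pose C := `[a, b]%classic.
  have mC : measurable_fun setT (\1_C : R -> R) := m_indic (measurable_itv _).
  have E n x : \1_C x * W n x = \1_C x * w n x.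
    rewrite /w mulrA; congr (_ * _); have [Cx|nCx] := pselect (C x); last first.
      by rewrite [in RHS]indicE [in LHS]indicE (memNset nCx) mul0r.
    rewrite (_ : \1_B x = 1) ?mulr1// indicE mem_set// /B /=.
    move: Cx; rewrite /C /= !in_itv /= => /andP[h1 h2].
    by rewrite (le_trans ra h1) (le_trans h2 br).
  have D1 : \int[mu]_x (\1_C x * w n x) @[n --> \oo] --> 2 * pi * \int[mu]_(x in `[a, b]) f1 x.
    have := W_box_cvg ab; under eq_fun do (rewrite i_set; under i_eq => x do rewrite E).
    exact.
  have D2 : \int[mu]_x (\1_C x * w n x) @[n --> \oo] --> \int[mu]_(x in `[a, b]) v x.
    rewrite [X in _ --> X]i_set; apply: (dct_ae _ _ _ (L1_norm lS) _).2.
    - by move=> n; exact: m_mul.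
    - exact: m_mul.
    - by apply: aeS aec => x h; apply: cvgM; [exact: cvg_cst|exact: h].
    - apply: aeS aeb => x h n; have /andP[i0 i1] := indic_le1 C x.
      by rewrite normrM -[leRHS]mul1r ler_pM// ger0_norm.
  exact: (cvg_unique _ D2 D1).
pose h x := \1_B x * (v x - 2 * pi * f1 x).
have lBv : L1 (fun x => \1_B x * v x) by apply: L1_indic => //; exact: measurable_itv.
have lh : L1 h.
  by apply: L1_eq (L1B lBv (L1Z (2 * pi) lBf)) => x; rewrite /h; ring.
have h0 : {ae mu, forall x, h x = 0}.
  apply: ae_zero_itv => // a b ab; apply: itv_indic_int => // a' b' ab' ra br.
  have iv : L1 (fun x => \1_(`[a', b']%classic) x * (\1_B x * v x)).
    by apply: L1_indic => //; exact: measurable_itv.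
  have ig : L1 (fun x => \1_(`[a', b']%classic) x * (\1_B x * f1 x)).
    by apply: L1_indic => //; exact: measurable_itv.
  have E (f : R -> R) x : \1_(`[a', b']%classic) x * (\1_B x * f x) = \1_(`[a', b']%classic) x * f x.
    rewrite mulrA; congr (_ * _); have [Cx|nCx] := pselect (`[a', b']%classic x); last first.
      by rewrite [in RHS]indicE [in LHS]indicE (memNset nCx) mul0r.
    rewrite (_ : \1_B x = 1) ?mulr1// indicE mem_set// /B /=.
    move: Cx; rewrite /= !in_itv /= => /andP[h1 h2].
    by rewrite (le_trans ra h1) (le_trans h2 br).
  have := vint a' b' ab' ra br; rewrite (i_set _ v) (i_set _ f1) => V; rewrite [LHS]i_set.
  transitivity (\int[mu]_x (\1_(`[a', b']%classic) x * (\1_B x * v x) - 2 * pi * (\1_(`[a', b']%classic) x * (\1_B x * f1 x)))).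
    by apply: i_eq => x; rewrite !E; ring.
  rewrite (iB iv (L1Z _ ig)) (iZ _ ig) (i_eq (E v)) (i_eq (E f1)) V subrr//.
apply: aeS (aeI pt h0) => x [[_ [_ hF]] hx] Bx.
rewrite (_ : 2 * pi * f1 x = v x); first exact: hF.
by move: hx; rewrite /h indicE mem_set// mul1r => /eqP; rewrite subr_eq0 => /eqP->.
Qed.
End ConvRe.

Section Positive.
Variable R : realType.
Local Notation mu := (@lebesgue_measure R).

Lemma P_reE (gamma : R) g1 g2 y t : P_re gamma g1 g2 y t = (2 * pi)^-1 * Fop gamma g1 g2 y t.
Proof. by []. Qed.

Lemma P_imE (gamma : R) g1 g2 y t : P_im gamma g1 g2 y t = (2 * pi)^-1 * Fop gamma g2 (fun xi => - g1 xi) y t.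
Proof.
by rewrite /P_im /Fop; congr (_ * _); apply: i_eq => xi; rewrite mulrN opprK.
Qed.

(** Multiplication by -i, which reduces the imaginary part to the real one. *)
Lemma is_fourier_rot (f1 f2 g1 g2 : R -> R) : is_fourier f1 f2 g1 g2 ->
  is_fourier f2 (fun x => - f1 x) g2 (fun x => - g1 x).
Proof.
move=> [/L2P[m1 m2 l] [/L2P[n1 n2 k] F]].
have sw (a b : R -> R) x : sq b (fun x => - a x) x = sq a b x by rewrite /sq sqrrN addrC.
split; first by apply/L2P; split => //; [exact: m_opp|apply: L1_eq l => x; rewrite sw].
split; first by apply/L2P; split => //; [exact: m_opp|apply: L1_eq k => x; rewrite sw].
have E N xi : FT_trunc_re f2 (fun x => - f1 x) N xi = FT_trunc_im f1 f2 N xi.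
  by apply: eq_Rintegral => x _; ring.
have E' N xi : FT_trunc_im f2 (fun x => - f1 x) N xi = - FT_trunc_re f1 f2 N xi.
  rewrite /FT_trunc_im /FT_trunc_re [LHS]i_set [X in _ = - X]i_set -iN.
    by apply: i_eq => x; ring.
  have [t1 t2] := trunc_L1 N m1 m2 l.
  have h := L1D (L1_cosM (p := fun x => x * xi) _ t1) (L1_sinM (p := fun x => x * xi) _ t2).
  have {h} h := h ltac:(mf) ltac:(mf).
  by apply: L1_eq h => x; ring.
under eq_fun do under eq_integral do rewrite E E' -opprD sqrrN addrC.
exact: F.
Qed.

Lemma lip_continuous (f : R -> R) (C : R) : 0 < C -> (forall x y, `|f x - f y| <= C * `|x - y|) -> continuous f.
Proof.
move=> C0 h x; apply/cvgrPdist_le => e e0; near=> y.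
apply: (le_trans (h x y)); rewrite mulrC -ler_pdivlMr//.
near: y; apply: cvgr_dist_le; first exact: cvg_id.
by rewrite divr_gt0.
Unshelve. all: by end_near. Qed.

Lemma admissible_meas (alpha : R) Gam t : admissible alpha Gam -> 0 < t <= 1 ->
  measurable_fun setT (Gam ^~ t).
Proof.
move=> [_ [_ [C1 [C2 [C3 [_ [C20 [_ [bil _]]]]]]]]] /andP[t0 t1].
have t11 : -1 <= t <= 1 by rewrite t1 andbT; lra.
apply: continuous_measurable_fun; apply: (lip_continuous C20) => x y.
by have /andP[] := bil t x y t11.
Qed.

Lemma conv_re (alpha gamma : R) Gam s f1 f2 g1 g2 : 0 < gamma -> 4^-1 < alpha < 2^-1 ->
  admissible alpha Gam -> s_crit alpha gamma < s -> in_Hs s f1 f2 g1 g2 ->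
  {ae mu, forall x, P_re gamma g1 g2 (Gam x t) t @[t --> 0^'+] --> f1 x}.
Proof.
move=> g0 al01 adm ss [F [_ lW]].
have [sigma [th [s01 sgs th01 [e1 e2 q11]]]] := exponents g0 al01 ss.
have [_ [Gam0 [C1 [C2 [C3 [C10 [_ [C30 [bil hol]]]]]]]]] := adm.
have al0 : 0 < alpha by have /andP[h _] := al01; lra.
have ge1 (t : R) : 0 <= t <= 1 -> -1 <= t <= 1 by move=> /andP[h1 h2]; rewrite h2 andbT; lra.
have bil' t x x' : 0 < t <= 1 -> C1 * `|x - x'| <= `|Gam x t - Gam x' t|.
  by move=> /andP[t0 t1]; have /andP[] := bil t x x' (ge1 t ltac:(by rewrite (ltW t0) t1)).
have hol' x t t' : 0 <= t <= 1 -> 0 <= t' <= 1 -> `|Gam x t - Gam x t'| <= C3 * `|t - t'| `^ alpha.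
  by move=> h h'; apply: hol; exact: ge1.
have [t [t01 td]] := rat_times R.
have H n := @conv_ball R alpha gamma sigma th C1 C3 s al0 g0 s01 th01 C10 C30 e1 e2 q11 sgs Gam bil' hol' Gam0
   (fun t => admissible_meas adm (t := t)) f1 f2 g1 g2 F lW n.+1%:R (ltr0Sn _ _) t t01 td.
apply: aeS (ae_foralln H) => x hx.
have pi0 : (2 * pi) != 0 :> R by rewrite mulf_neq0// gt_eqF// pi_gt0.
rewrite (_ : f1 x = (2 * pi)^-1 * (2 * pi * f1 x)); last by rewrite mulKf.
apply: cvgM; first exact: cvg_cst.
apply: (hx (Num.bound `|x|)); rewrite /= in_itv /= -ler_norml ltW//.
apply: (@lt_trans _ _ (Num.bound `|x|)%:R); first by apply: archi_boundP.
by rewrite ltr_nat.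
Qed.

Lemma positive_part (alpha gamma : R) Gam s f1 f2 g1 g2 : 0 < gamma -> 4^-1 < alpha < 2^-1 ->
  admissible alpha Gam -> s_crit alpha gamma < s -> in_Hs s f1 f2 g1 g2 ->
  ae_conv gamma Gam f1 f2 g1 g2.
Proof.
move=> g0 al01 adm ss H; have [F [mW lW]] := H.
have H' : in_Hs s f2 (fun x => - f1 x) g2 (fun x => - g1 x).
  split; first exact: is_fourier_rot.
  split => //; move: lW; apply: eq_integrable => // xi _.
  by rewrite sqrrN addrC.
apply: aeS (aeI (conv_re g0 al01 adm ss H) (conv_re g0 al01 adm ss H')) => x [h1 h2].
split => //; apply: cvg_trans h2; apply: near_eq_cvg; near=> t.
by rewrite P_imE.
Unshelve. all: by end_near. Qed.
End Positive.

(** * Divergence along resonant frequency sets *)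

Section Hump.
Variable R : realType.
Local Notation mu := (@lebesgue_measure R).
Variables (gamma s : R) (Gam : R -> R -> R).
Hypotheses (g0 : 0 < gamma) (s0 : 0 <= s).

(** After rotation by phi no cancellation occurs on the support, and the damping keeps at least the
    fraction e^(-1). *)
Definition resonant (h : R -> R) (theta tau : R) := forall x, 1 <= x <= 2 ->
  exists t phi, theta <= t <= tau /\ forall xi, h xi = 1 ->
    2^-1 <= cos (Gam x t * xi + t * xi ^+ 2 - phi) /\ t `^ gamma * xi ^+ 2 <= 1.

(** [L] measures the gain of L^1 mass over H^s energy: scaled to mass m, the hump has energy at most
    m^2 / L. *)
Definition hump (h : R -> R) (lo Lam L theta tau : R) :=
  [/\ inversive h, (forall xi, h xi = 0 \/ h xi = 1 /\ lo <= xi <= Lam),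
    0 < \int[mu]_xi h xi, (1 + Lam ^+ 2) `^ s * L <= \int[mu]_xi h xi &
    0 < theta <= tau /\ resonant h theta tau].

Hypothesis humps : forall L tau lo, 0 < L -> 0 < tau -> exists h Lam theta, hump h lo Lam L theta tau.

(* Each amplitude dominates the sum of all the previous ones. *)
Let m k : R := 100 * 16 ^+ k.
(** Makes the k-th energy at most 8^(-k), the rate required by [fourier_series]. *)
Let L k : R := m k ^+ 2 * 8 ^+ k.

Let m0 k : 0 < m k. Proof. by rewrite mulr_gt0 ?exprn_gt0. Qed.
Let L0 k : 0 < L k. Proof. by rewrite mulr_gt0 ?exprn_gt0. Qed.

(** The quadruple is (h, lo, Lam, theta). [lo] must exceed the previous support, exceed k so that
    supports escape to infinity, and be so large that damping at any time from [thp] on makes the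
    new hump negligible; the last bound uses e^u >= u. *)
Let step k (thp Lp : R) : 0 < thp -> exists q : (R -> R) * R * R * R,
  [/\ hump q.1.1.1 q.1.1.2 q.1.2 (L k) q.2 (Num.min thp (k.+1%:R)^-1),
    Lp < q.1.1.2, k%:R < q.1.1.2, 1 <= q.1.1.2 & m k * expR (- (thp `^ gamma) * q.1.1.2 ^+ 2) <= 2^-1 ^+ k].
Proof.
move=> th0; pose z := m k * 2 ^+ k / thp `^ gamma.
pose lo := Num.max (Num.max (Lp + 1) k.+1%:R) z.
have l1 : Lp + 1 <= lo by rewrite /lo !le_max lexx.
have l2 : k.+1%:R <= lo by rewrite /lo !le_max lexx orbT.
have l3 : z <= lo by rewrite /lo !le_max lexx !orbT.
have l4 : 1 <= lo by apply: le_trans l2; rewrite ler1n.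
have [|h [Lam [th H]]] := @humps (L k) (Num.min thp (k.+1%:R)^-1) lo (L0 k).
  by rewrite lt_min th0 /= invr_gt0 ltr0Sn.
exists (h, lo, Lam, th); split => //=.
- by apply: lt_le_trans l1; rewrite ltrDl.
- by apply: lt_le_trans l2; rewrite ltr_nat.
- have tg : 0 < thp `^ gamma by exact: powR_gt0.
  have zl : m k * 2 ^+ k <= thp `^ gamma * lo ^+ 2.
    rewrite mulrC -ler_pdivrMl//.
    have : thp `^ gamma * z <= thp `^ gamma * lo ^+ 2.
      rewrite ler_pM2l//; apply: (le_trans l3); rewrite expr2 ler_peMr//; exact: le_trans l4.
    rewrite /z mulrCA divff ?mulr1 ?gt_eqF// => hz.
    by rewrite ler_pdivrMl// mulrC.
  rewrite exprVn mulNr expRN -[leRHS]mul1r ler_pdivlMr ?exprn_gt0// mulrAC ler_pdivrMr ?expR_gt0// mul1r.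
  apply: (le_trans zl); apply: le_trans (expR_ge1Dx _); by rewrite lerDr.
Qed.

Lemma hump_seq : exists (h : nat -> R -> R) (lo Lam theta : nat -> R),
  [/\ forall k, hump (h k) (lo k) (Lam k) (L k) (theta k) (k.+1%:R)^-1,
    (forall k, Lam k < lo k.+1) /\ (forall k, k%:R < lo k),
    forall k, theta k.+1 <= theta k &
    forall k, m k.+1 * expR (- (theta k `^ gamma) * lo k.+1 ^+ 2) <= 2^-1 ^+ k.+1].
Proof.
(* The state is the index with the previous theta and Lam; the guard makes the relation total, as
   the choice principle requires. *)
pose P (p : nat * (R * R)) (q : (R -> R) * R * R * R) := 0 < p.2.1 ->
  [/\ hump q.1.1.1 q.1.1.2 q.1.2 (L p.1) q.2 (Num.min p.2.1 (p.1.+1%:R)^-1),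
    p.2.2 < q.1.1.2, p.1%:R < q.1.1.2, 1 <= q.1.1.2 & m p.1 * expR (- (p.2.1 `^ gamma) * q.1.1.2 ^+ 2) <= 2^-1 ^+ p.1].
have hP p : exists q, P p q.
  move: p => [k [a b]]; rewrite /P /=; have [a0|a0] := ltP 0 a.
    by have [q hq] := @step k a b a0; exists q.
  by exists (fun=> 0, 0, 0, 0).
have [f hf] := choice hP.
pose fix q n := f (n, if n is n'.+1 then ((q n').2, (q n').1.2) else (1, 0)).
have th0 n : 0 < (q n).2.
  elim: n => [|n IH].
    by have [[_ _ _ _ [/andP[]]]] := hf (0%N, (1, 0)) ltr01.
  by have [[_ _ _ _ [/andP[]]]] := hf (n.+1, ((q n).2, (q n).1.2)) IH.
have weak h lo Lam LL th a b : hump h lo Lam LL th (Num.min a b) -> hump h lo Lam LL th b.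
  move=> [h1 h2 h3 h4 [/andP[h5 h6] h7]].
  have mb : Num.min a b <= b by rewrite ge_min lexx orbT.
  split => //; split; first by rewrite h5 (le_trans h6).
  move=> x hx; have [t [phi [/andP[t1 t2] ht]]] := h7 x hx.
  by exists t, phi; split => //; rewrite t1 (le_trans t2).
exists (fun n => (q n).1.1.1), (fun n => (q n).1.1.2), (fun n => (q n).1.2), (fun n => (q n).2).
split.
- case=> [|n]; first by have [/weak] := hf (0%N, (1, 0)) ltr01.
  by have [/weak] := hf (n.+1, ((q n).2, (q n).1.2)) (th0 n).
- split=> [n|[|n]].
  + by have [] := hf (n.+1, ((q n).2, (q n).1.2)) (th0 n).
  + by have [] := hf (0%N, (1, 0)) ltr01.
  + by have [] := hf (n.+1, ((q n).2, (q n).1.2)) (th0 n).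
- move=> n; have [[_ _ _ _ [/andP[_ h] _]] _ _ _ _] := hf (n.+1, ((q n).2, (q n).1.2)) (th0 n).
  by apply: (le_trans h); rewrite /= ge_min lexx.
- by move=> n; have [] := hf (n.+1, ((q n).2, (q n).1.2)) (th0 n).
Qed.

Section Sum.
Variables (h : nat -> R -> R) (lo Lam theta : nat -> R).
Hypotheses (hu : forall k, hump (h k) (lo k) (Lam k) (L k) (theta k) (k.+1%:R)^-1)
  (lo1 : forall k, Lam k < lo k.+1) (lo2 : forall k, k%:R < lo k)
  (th1 : forall k, theta k.+1 <= theta k)
  (small : forall k, m k.+1 * expR (- (theta k `^ gamma) * lo k.+1 ^+ 2) <= 2^-1 ^+ k.+1).

Let v k := m k / \int[mu]_xi h k xi.
Let u k xi := v k * h k xi.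
Let S n xi := \sum_(k < n) u k xi.

Let hp k : 0 < \int[mu]_xi h k xi. Proof. by have [_ _ ? _ _] := hu k. Qed.
Let h01 k xi : h k xi = 0 \/ h k xi = 1 /\ lo k <= xi <= Lam k. Proof. by have [_ ? _ _ _] := hu k. Qed.
Let h_inv k : inversive (h k). Proof. by have [? _ _ _ _] := hu k. Qed.
Let lh k : L1 (h k). Proof. by have [? _ _] := h_inv k. Qed.
Let h_ge0 k xi : 0 <= h k xi. Proof. by case: (h01 k xi) => [->|[-> _]]. Qed.
Let v0 k : 0 < v k. Proof. by rewrite divr_gt0. Qed.
Let u_ge0 k xi : 0 <= u k xi. Proof. by rewrite mulr_ge0// ltW. Qed.
Let lu k : L1 (u k). Proof. exact: L1Z. Qed.
Let iu k : \int[mu]_xi u k xi = m k.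
Proof. by rewrite /u iZ// /v divfK// gt_eqF. Qed.

Let u_inv k : inversive (u k).
Proof.
have := inversive_lin (v k) (inversive_0 R) (h_inv k).
by rewrite (_ : (fun x => 0 + v k * h k x) = u k)//; apply/funext => x; rewrite add0r.
Qed.

Let ulo k xi : u k xi != 0 -> lo k <= xi <= Lam k.
Proof. by rewrite /u; case: (h01 k xi) => [->|[_]//]; rewrite mulr0 eqxx. Qed.

Let loLam k : lo k <= Lam k.
Proof.
rewrite leNgt; apply/negP => lt; have := hp k.
have -> : \int[mu]_xi h k xi = 0; last by rewrite ltxx.
transitivity (\int[mu]_xi (0 * h k xi)); last by rewrite iZ// mul0r.
apply: i_eq => xi; rewrite mul0r; case: (h01 k xi) => // -[_ /andP[h1 h2]].
by have := le_trans h1 h2; rewrite leNgt lt.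
Qed.

Let Lam_mono j k : (j < k)%N -> Lam j < lo k.
Proof.
elim: k => // k IH; rewrite ltnS leq_eqVlt => /orP[/eqP->|jk]; first exact: lo1.
by apply: (lt_trans (IH jk)); apply: (le_lt_trans (loLam k)); exact: lo1.
Qed.

Let disj j k xi : (j < k)%N -> u j xi * u k xi = 0.
Proof.
move=> jk; have [->|uj] := eqVneq (u j xi) 0; first by rewrite mul0r.
have [->|uk] := eqVneq (u k xi) 0; first by rewrite mulr0.
have /andP[_ a2] := ulo uj; have /andP[b1 _] := ulo uk.
by have := lt_le_trans (Lam_mono jk) (le_trans b1 a2); rewrite ltxx.
Qed.

Let D n j xi := \sum_(i < j) u (n + i) xi.

Let DE n j xi : S (n + j) xi = S n xi + D n j xi.
Proof. by rewrite /S big_split_ord. Qed.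

Let D_sqr n j xi : D n j xi ^+ 2 = \sum_(i < j) u (n + i) xi ^+ 2.
Proof.
elim: j => [|j IH]; first by rewrite /D !big_ord0 expr0n.
rewrite /D !big_ord_recr /= -/(D n j xi) sqrrD IH.
rewrite (_ : D n j xi * u (n + j) xi = 0) ?mul0rn ?addr0//.
rewrite /D mulr_suml big1// => i _; apply: disj.
by rewrite ltn_add2l.
Qed.

Let w (xi : R) := (1 + xi ^+ 2) `^ s.
Let mw : measurable_fun setT w. Proof. by apply: m_powR; mf. Qed.
Let w1 xi : 1 <= w xi.
Proof.
have x1 : 1 <= 1 + xi ^+ 2 by rewrite lerDl sqr_ge0.
by have := ler_powR x1 s0; rewrite powRr0.
Qed.

Let u_energy k : L1 (fun xi => u k xi ^+ 2 * w xi) /\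
  \int[mu]_xi (u k xi ^+ 2 * w xi) <= (8^-1) ^+ k.
Proof.
pose W := (1 + Lam k ^+ 2) `^ s; have W0 : 0 <= W by exact: powR_ge0.
have le xi : u k xi ^+ 2 * w xi <= v k ^+ 2 * W * h k xi.
  rewrite /u; case: (h01 k xi) => [->|[-> /andP[b1 b2]]].
    by rewrite !mulr0 expr0n mul0r.
  rewrite !mulr1 ler_wpM2l ?sqr_ge0// /w /W; apply: ge0_ler_powR => //.
  - by rewrite nnegrE addr_ge0 ?sqr_ge0.
  - by rewrite nnegrE addr_ge0 ?sqr_ge0.
  - have xi0 : 0 <= xi by apply: le_trans b1; apply: ltW; apply: le_lt_trans (lo2 k).
    by rewrite lerD2l lerXn2r ?nnegrE// (le_trans xi0).
have mu_ := L1_meas (lu k).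
have lW : L1 (fun xi => v k ^+ 2 * W * h k xi) by exact: L1Z.
have l : L1 (fun xi => u k xi ^+ 2 * w xi).
  apply: (L1_le _ _ lW) => [|xi]; first by mf.
  by rewrite ger0_norm ?le// mulr_ge0 ?sqr_ge0// (le_trans _ (w1 xi)).
split => //; apply: (le_trans (i_le l lW le)); rewrite iZ//.
have [_ _ _ hW _] := hu k; rewrite -/W in hW.
have H0 := hp k; rewrite /v.
move: (\int[mu]_xi h k xi) H0 hW => I I0 hW.
rewrite /L in hW; have q0 : 0 < 8 ^+ k :> R by rewrite exprn_gt0.
rewrite exprVn; move: (8 ^+ k : R) q0 (m k) hW => q q0 M hW.
have -> : (M / I) ^+ 2 * W * I = W * M ^+ 2 / I by field; rewrite gt_eqF.
by rewrite ler_pdivrMr// ler_pdivlMl// mulrC -mulrA.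
Qed.

Let mu_ k : measurable_fun setT (u k). Proof. exact: L1_meas. Qed.

Let mS n : measurable_fun setT (S n).
Proof. by have [l _] := L1_sum n lu; exact: L1_meas l. Qed.

Let mD n j : measurable_fun setT (D n j).
Proof. by have [l _] := L1_sum j (fun i => lu (n + i)); exact: L1_meas l. Qed.

(** The supports are disjoint and escape to infinity, so at each frequency the sum is finite and
    squares add up. From time [theta k] on, the humps after the k-th contribute at most a geometric
    series. *)
Lemma hump_sum : exists g : R -> R, [/\ measurable_fun setT g,
  forall xi, S n xi @[n --> \oo] --> g xi, (forall xi, 0 <= g xi),
  forall n, L1 (fun xi => (g xi - S n xi) ^+ 2 * w xi) /\
    \int[mu]_xi ((g xi - S n xi) ^+ 2 * w xi) <= 2 * (8^-1) ^+ n &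
  forall k t, theta k <= t -> L1 (fun xi => expR (- (t `^ gamma) * xi ^+ 2) * (g xi - S k.+1 xi)) /\
    \int[mu]_xi `|expR (- (t `^ gamma) * xi ^+ 2) * (g xi - S k.+1 xi)| <= 2].
Proof.
have [g mg hg] := measurable_limit mS.
have cS xi : S n xi @[n --> \oo] --> g xi.
  suff c : S n xi @[n --> \oo] --> S (Num.bound `|xi|) xi by rewrite (hg _ _ c).
  apply: cvg_near_cst; near=> n.
  have nN : (Num.bound `|xi| <= n)%N by near: n; exact: nbhs_infty_ge.
  rewrite -(subnKC nN) DE (_ : D _ _ xi = 0) ?addr0// /D big1// => i _.
  have [//|/ulo/andP[b1 _]] := eqVneq (u (Num.bound `|xi| + i) xi) 0.
  have := lt_le_trans (lo2 _) b1; rewrite ltNge => /negP[].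
  apply: (le_trans (ler_norm _)); apply: ltW; apply: (@lt_le_trans _ _ (Num.bound `|xi|)%:R).
    exact: archi_boundP.
  by rewrite ler_nat leq_addr.
have cD n xi : D n j xi @[j --> \oo] --> g xi - S n xi.
  have hc : S (j + n) xi - S n xi @[j --> \oo] --> g xi - S n xi.
    by apply: cvgB; [rewrite (cvg_shiftn n (S ^~ xi))|exact: cvg_cst].
  apply: cvg_trans hc; apply: near_eq_cvg; near=> j.
  by rewrite addnC DE addrC addKr.
have D0 n j xi : 0 <= D n j xi by apply: sumr_ge0 => i _.
have gS n xi : 0 <= g xi - S n xi by apply: (cvgr_to_ge (cD n xi)); near=> j.
have g_ge0 xi : 0 <= g xi.
  by apply: (cvgr_to_ge (cS xi)); near=> n; apply: sumr_ge0 => i _.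
exists g; split => //.
  move=> n; have ww xi : 0 <= w xi by exact: le_trans (w1 xi).
  have hs j := @L1_sum R (fun i xi => u (n + i) xi ^+ 2 * w xi) j (fun i => (u_energy (n + i)).1).
  have E j xi : D n j xi ^+ 2 * w xi = \sum_(i < j) u (n + i) xi ^+ 2 * w xi by rewrite D_sqr mulr_suml.
  apply: (@fatou_real _ (fun j xi => D n j xi ^+ 2 * w xi)).
  - by move=> j; apply: L1_eq (hs j).1 => xi; rewrite E.
  - by move=> j xi; rewrite mulr_ge0 ?sqr_ge0.
  - move=> xi; apply: cvgM; last exact: cvg_cst.
    by rewrite expr2; under eq_fun do rewrite expr2; apply: cvgM; exact: cD.
  - move=> j; rewrite (i_eq (E j)) (hs j).2.
    apply: (@le_trans _ _ (\sum_(i < j) 8^-1 ^+ n * 8^-1 ^+ i)).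
      by apply: ler_sum => i _; rewrite -exprD; case: (u_energy (n + i)).
    rewrite -mulr_sumr mulrC ler_wpM2r ?exprn_ge0//; apply: geo_sum_le; lra.
move=> k t tk; pose E xi := expR (- (t `^ gamma) * xi ^+ 2).
have E0 xi : 0 <= E xi by exact: expR_ge0.
have mE : measurable_fun setT E by rewrite /E; mf.
have thm i : theta (k + i) <= theta k.
  by elim: i => [|i IH]; [rewrite addn0|rewrite addnS; exact: le_trans IH].
have th_gt0 i : 0 < theta i by have [_ _ _ _ [/andP[]]] := hu i.
have Eu i : L1 (fun xi => E xi * u (k.+1 + i) xi) /\ \int[mu]_xi (E xi * u (k.+1 + i) xi) <= 2^-1 ^+ i.
  have le xi : E xi * u (k.+1 + i) xi <= expR (- (theta (k + i) `^ gamma) * lo (k + i).+1 ^+ 2) * u (k.+1 + i) xi.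
    have [->|] := eqVneq (u (k.+1 + i) xi) 0; first by rewrite !mulr0.
    move=> /ulo/andP[b1 _]; rewrite ler_wpM2r// ler_expR !mulNr lerN2.
    have l0 : 0 <= lo (k + i).+1 by apply: ltW; apply: le_lt_trans (lo2 _).
    apply: ler_pM; rewrite ?powR_ge0 ?sqr_ge0//.
      apply: ge0_ler_powR; rewrite ?nnegrE ?(ltW g0) ?(ltW (th_gt0 _))//.
        by apply: le_trans tk; apply: ltW.
      by apply: le_trans tk.
    by rewrite lerXn2r ?nnegrE// (le_trans l0).
  have l2 : L1 (fun xi => expR (- (theta (k + i) `^ gamma) * lo (k + i).+1 ^+ 2) * u (k.+1 + i) xi) by exact: L1Z.
  have l : L1 (fun xi => E xi * u (k.+1 + i) xi).
    apply: (L1_le _ _ l2) => [|xi]; first by apply: m_mul.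
    by rewrite ger0_norm ?le// mulr_ge0.
  split=> //; apply: (le_trans (i_le l l2 le)); rewrite iZ// iu mulrC.
  apply: (le_trans (small (k + i))).
  by apply: ler_wiXn2l; [rewrite invr_ge0|rewrite invf_le1// ler1n|rewrite -addSn leq_addl].
have [||||h1 h2] := @fatou_real _ (fun j xi => E xi * D k.+1 j xi) (fun xi => E xi * (g xi - S k.+1 xi)) 2.
- move=> j; have [l _] := L1_sum j (fun i => (Eu i).1).
  by apply: L1_eq l => xi; rewrite -mulr_sumr.
- by move=> j xi; rewrite mulr_ge0.
- by move=> xi; apply: cvgM; [exact: cvg_cst|exact: cD].
- move=> j; have [_ l] := L1_sum j (fun i => (Eu i).1).
  rewrite (i_eq (g := fun xi => \sum_(i < j) E xi * u (k.+1 + i) xi)) => [|xi]; last by rewrite /D mulr_sumr.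
  rewrite l; apply: (@le_trans _ _ (\sum_(i < j) 2^-1 ^+ i)).
    by apply: ler_sum => i _; case: (Eu i).
  by apply: geo_sum_le; lra.
split=> //; rewrite (i_eq (g := fun xi => E xi * (g xi - S k.+1 xi)))// => xi.
by rewrite ger0_norm// mulr_ge0.
Unshelve. all: by end_near. Qed.

Lemma hump_in_Hs (g : R -> R) : measurable_fun setT g ->
  (forall n, L1 (fun xi => (g xi - S n xi) ^+ 2 * w xi) /\
    \int[mu]_xi ((g xi - S n xi) ^+ 2 * w xi) <= 2 * (8^-1) ^+ n) ->
  exists f1 f2, in_Hs s f1 f2 g (fun=> 0).
Proof.
move=> mg hS.
have drop (f : R -> R) : measurable_fun setT f -> L1 (fun xi => f xi ^+ 2 * w xi) ->
    L1 (fun xi => f xi ^+ 2) /\ \int[mu]_xi f xi ^+ 2 <= \int[mu]_xi (f xi ^+ 2 * w xi).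
  move=> mf l; have le xi : f xi ^+ 2 <= f xi ^+ 2 * w xi by rewrite ler_peMr ?sqr_ge0.
  have l' : L1 (fun xi => f xi ^+ 2).
    by apply: (L1_le _ _ l) => [|xi]; [exact: m_sqr|rewrite ger0_norm ?sqr_ge0].
  by split => //; exact: i_le.
have e k : \int[mu]_xi u k xi ^+ 2 <= 1 * (8^-1) ^+ k.
  by have [l1 l2] := u_energy k; rewrite mul1r; apply: le_trans l2; case: (drop _ (mu_ k) l1).
have gS0 xi : g xi - S 0 xi = g xi by rewrite /S big_ord0 subr0.
have lg : L1 (fun xi => g xi ^+ 2 * w xi).
  by have [l _] := hS 0; apply: L1_eq l => xi; rewrite gS0.
have c : \int[mu]_xi (g xi - S n xi) ^+ 2 @[n --> \oo] --> (0 : R).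
  have c0 : 2 * (8^-1) ^+ n @[n --> \oo] --> (0 : R).
    rewrite -[X in _ --> X](mulr0 2); apply: cvgM; first exact: cvg_cst.
    by apply: cvg_expr; rewrite ger0_norm ?invr_ge0// invf_lt1// ltr1n.
  apply: (squeeze_cvgr _ (cvg_cst (0:R)) c0); near=> n.
  have [l1 l2] := hS n.
  have [h1 h2] := drop (fun xi => g xi - S n xi) (m_add mg (m_opp (mS n))) l1.
  by rewrite (le_trans h2 l2) andbT; apply: i_ge0 => xi; exact: sqr_ge0.
have [f1 [f2 F]] := fourier_series ler01 u_inv e mg (drop _ mg lg).1 c.
exists f1, f2; split => //; split; first exact: mw.
move: lg; rewrite /L1; apply: eq_integrable => // xi _ /=.
by rewrite expr0n addr0.
Unshelve. all: by end_near. Qed.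

(** At its own resonant time the k-th hump contributes at least m(k)/8, with 1/2 from the cosine and
    1/4 from the damping. The earlier humps have total mass at most 100 * 16^k / 15, the later ones
    at most 2. The real part after rotation by phi is bounded by the two components. *)
Lemma hump_large (g : R -> R) x k : measurable_fun setT g ->
  (forall k t, theta k <= t -> L1 (fun xi => expR (- (t `^ gamma) * xi ^+ 2) * (g xi - S k.+1 xi)) /\
    \int[mu]_xi `|expR (- (t `^ gamma) * xi ^+ 2) * (g xi - S k.+1 xi)| <= 2) ->
  1 <= x <= 2 -> exists2 t, 0 < t <= (k.+1%:R)^-1 &
    k%:R <= `|Fop gamma g (fun=> 0) (Gam x t) t| + `|Fop gamma (fun=> 0) (fun xi => - g xi) (Gam x t) t|.
Proof.
move=> mg tail hx.
have [_ _ _ _ [/andP[th0 _] res]] := hu k.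
have [t [phi [/andP[t1 t2] ht]]] := res x hx.
exists t; first by rewrite (lt_le_trans th0 t1).
pose E xi := expR (- (t `^ gamma) * xi ^+ 2).
pose P xi := Gam x t * xi + t * xi ^+ 2.
pose C xi := E xi * cos (P xi - phi).
have E0 xi : 0 <= E xi by exact: expR_ge0.
have E1 xi : E xi <= 1 by rewrite -[leRHS]expR0 ler_expR mulNr oppr_le0 mulr_ge0 ?powR_ge0 ?sqr_ge0.
have mE : measurable_fun setT E by rewrite /E; mf.
have mP : measurable_fun setT P by rewrite /P; mf.
have mC : measurable_fun setT C by rewrite /C; mf.
have CE xi : `|C xi| <= E xi by rewrite normrM ger0_norm// ler_piMr// cos_le1n.
have CZ z xi : `|C xi * z| <= `|E xi * z|.
  by rewrite normrM [leRHS]normrM ler_wpM2r// (ger0_norm (E0 xi)).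
have C1 xi : `|C xi| <= 1 by exact: le_trans (E1 xi).
have [lr ir] := tail k t t1; rewrite -/E in lr ir.
have [lS iS] := L1_sum k lu.
have LC (f : R -> R) : L1 f -> L1 (fun xi => C xi * f xi).
  move=> lf; have mf' := L1_meas lf; apply: (L1_le _ _ (L1_norm lf)) => [|xi]; first exact: m_mul.
  by rewrite normrM ler_piMl.
have lCr : L1 (fun xi => C xi * (g xi - S k.+1 xi)).
  apply: (L1_le _ _ (L1_norm lr)) => [|xi].
    by apply: m_mul => //; apply: m_add => //; apply: m_opp.
  exact: CZ.
have lCS := LC _ lS; have lCu := LC _ (lu k).
have split3 : \int[mu]_xi (C xi * g xi) = \int[mu]_xi (C xi * S k xi) + \int[mu]_xi (C xi * u k xi) +
    \int[mu]_xi (C xi * (g xi - S k.+1 xi)).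
  rewrite -(iD lCS lCu) -(iD (L1D lCS lCu) lCr); apply: i_eq => xi.
  by rewrite /S big_ord_recr /=; ring.
have b1 : `|\int[mu]_xi (C xi * S k xi)| <= \sum_(i < k) m i.
  rewrite [leRHS](_ : _ = \sum_(i < k) \int[mu]_xi u i xi); last by apply: eq_bigr => i _; rewrite iu.
  rewrite -iS; apply: i_norm_le => // xi.
  by rewrite normrM (ger0_norm (sumr_ge0 _ _))// ler_piMl ?sumr_ge0.
have b3 : `|\int[mu]_xi (C xi * (g xi - S k.+1 xi))| <= 2.
  by apply: le_trans ir; apply: i_norm_le => //; exact: L1_norm.
have b2 : m k / 8 <= \int[mu]_xi (C xi * u k xi).
  rewrite -(iu k) mulrC -iZ//; apply: i_le => //; first exact: L1Z.
  move=> xi; rewrite /u; case: (h01 k xi) => [->|[hE _]]; first by rewrite !mulr0.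
  rewrite hE.
  have [c1 c2] := ht xi hE.
  rewrite mulr1; apply: ler_wpM2r; first exact: ltW (v0 k).
  have e4 : 4^-1 <= E xi.
    apply: (@le_trans _ _ (expR (- 1))); last by rewrite ler_expR mulNr lerN2.
    have -> : expR (- 1) = expR (- 2^-1) * expR (- 2^-1) :> R by rewrite -expRD; congr expR; lra.
    by have := expR_ge1Dx (- 2^-1 : R); move: (expR _) => z; nra.
  by rewrite /C; move: (E xi) (cos _) c1 e4 => a b c1' e4; nra.
have sm : \sum_(i < k) m i <= 100 / 15 * 16 ^+ k.
  elim: k {res th0 ht t1 t2 lr ir lS iS lCr lCS lCu split3 b1 b2 b3} => [|j IH].
    by rewrite big_ord0 expr0; lra.
  rewrite big_ord_recr /= exprS; apply: (le_trans (lerD IH (lexx _))).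
  by rewrite /m; move: (16 ^+ j : R) => z; lra.
have k16 : k%:R + 2 <= 100 * (8^-1 - 15^-1) * 16 ^+ k :> R.
  have : k.+1%:R <= 16 ^+ k :> R by rewrite -natrX ler_nat ltn_expl.
  by rewrite -[k.+1]addn1 natrD; move: (16 ^+ k : R) => z; have := ler0n R k; lra.
have big : k%:R <= \int[mu]_xi (C xi * g xi).
  rewrite split3; move: b1 b3; rewrite !ler_norml => /andP[b1 _] /andP[b3 _].
  move: b2; rewrite /m; move: (16 ^+ k : R) sm k16 => z sm k16 b2; lra.
have lEg : L1 (fun xi => E xi * g xi).
  have l1 : L1 (fun xi => E xi * S k.+1 xi).
    have [l _] := L1_sum k.+1 lu; apply: (L1_le _ _ (L1_norm l)) => [|xi]; first exact: m_mul.
    by rewrite normrM ler_piMl// ger0_norm.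
  apply: L1_eq (L1D l1 lr) => xi; rewrite -[expR _ * _]/(E xi * _) -mulrDr.
  by congr (_ * _); ring.
have e1 : Fop gamma g (fun=> 0) (Gam x t) t = \int[mu]_xi (cos (P xi) * (E xi * g xi)).
  by apply: i_eq => xi; rewrite /E /P; ring.
have e2 : Fop gamma (fun=> 0) (fun xi => - g xi) (Gam x t) t = \int[mu]_xi (sin (P xi) * (E xi * g xi)).
  by apply: i_eq => xi; rewrite /E /P; ring.
rewrite e1 e2; apply: (le_trans big).
have l1 := L1_cosM mP lEg; have l2 := L1_sinM mP lEg.
have -> : \int[mu]_xi (C xi * g xi) = cos phi * \int[mu]_xi (cos (P xi) * (E xi * g xi)) +
   sin phi * \int[mu]_xi (sin (P xi) * (E xi * g xi)).
  rewrite -iZ// -(iZ (sin phi))// -iD; [|exact: L1Z|exact: L1Z].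
  by apply: i_eq => xi; rewrite /C cosB; ring.
apply: (le_trans (ler_norm _)); apply: (le_trans (ler_normD _ _)); rewrite !normrM.
by apply: lerD; rewrite ler_piMl// ?cos_le1n ?sin_le1n.
Qed.
End Sum.

Lemma humps_diverge : exists f1 f2 g1 g2, in_Hs s f1 f2 g1 g2 /\ ~ ae_conv gamma Gam f1 f2 g1 g2.
Proof.
have [h [lo [Lam [theta [hu [lo1 lo2] th1 small]]]]] := hump_seq.
have [g [mg cS g_ge0 hS tail]] := hump_sum hu lo1 lo2 th1 small.
have [f1 [f2 H]] := hump_in_Hs hu lo2 mg hS.
exists f1, f2, g, (fun=> 0); split => //.
move=> [N [mN N0 hN]].
have sub : `[1, 2]%classic `<=` N.
  move=> x; rewrite /= in_itv /= => hx; apply: hN => -[c1 c2].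
  pose l := `|f1 x| + `|f2 x| + 1.
  have d1 : \forall t \near (0 : R)^'+, `|P_re gamma g (fun=> 0) (Gam x t) t| + `|P_im gamma g (fun=> 0) (Gam x t) t| < l.
    have c : `|P_re gamma g (fun=> 0) (Gam x t) t| + `|P_im gamma g (fun=> 0) (Gam x t) t| @[t --> 0^'+] --> `|f1 x| + `|f2 x|.
      by apply: cvgD; apply: cvg_norm.
    by move/cvgr_lt : c; apply; rewrite ltrDl.
  have [e /= e0 he] := d1.
  (* Makes 1/(k+1) smaller than e, so that the resonant time falls in the window, and k at least 2
     pi l. *)
  pose k := maxn (Num.bound e^-1) (Num.bound (2 * pi * l)).
  have [t /andP[t0 tk] ht] := hump_large hu k mg tail hx.
  have te : t < e.
    apply: (le_lt_trans tk); rewrite invf_plt ?posrE//.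
    apply: (@lt_le_trans _ _ (Num.bound e^-1)%:R); first by apply: archi_boundP; rewrite invr_ge0 ltW.
    by rewrite ler_nat leqW// leq_maxl.
  have := he t; rewrite /ball /= sub0r normrN gtr0_norm// => /(_ te t0).
  have p0 : 0 < 2 * pi :> R by rewrite mulr_gt0// pi_gt0.
  have z : (fun xi : R => - 0 : R) = (fun=> 0) by apply/funext => xi; rewrite oppr0.
  rewrite P_reE P_imE !normrM -mulrDr gtr0_norm ?invr_gt0// ltr_pdivrMl//.
  rewrite ltNge => /negP; apply; apply: le_trans ht.
  apply: (@le_trans _ _ (Num.bound (2 * pi * l))%:R).
    by apply/ltW/archi_boundP; rewrite mulr_ge0 ?(ltW p0)// !addr_ge0.
  by rewrite ler_nat leq_maxr.
have : (mu `[1%R : R, 2%R]%classic <= 0)%E.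
  by rewrite -N0; apply: le_measure => //; apply/mem_set => //; exact: measurable_itv.
rewrite lebesgue_measure_itv /= lte_fin ltr1n /= -EFinB lee_fin; lra.
Qed.
End Hump.

(** * Frequency combs *)

Section Comb.
Variable R : realType.
Local Notation mu := (@lebesgue_measure R).

Lemma cos_ge_half (u : R) : `|u| <= 2^-1 -> 2^-1 <= cos u.
Proof.
wlog u0 : u / 0 <= u.
  move=> h; have [/h//|u0] := leP 0 u.
  by rewrite -cosN -normrN; apply: h; rewrite oppr_ge0 ltW.
rewrite ger0_norm// => u1; move: u0; rewrite le_eqVlt => /orP[/eqP<-|u0].
  by rewrite cos0 invf_le1// ler1n.
have [|c _] := @MVT R cos (fun z => - sin z) 0 u u0 (fun z _ => is_derive_cos z).
  by apply: continuous_subspaceT; exact: continuous_cos.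
rewrite cos0 subr0 => E; have := sin_le1 c; move: E; move: (sin c) => z E zl.
have : z * u <= 1 * u by rewrite ler_wpM2r// ltW.
by lra.
Qed.

(** Crude bounds from the zero pi/2 of the cosine: it lies below 2, and the cosine is at least 1/2
    up to 1/2. *)
Lemma pi_bounds : (1 : R) <= pi /\ pi <= (4 : R).
Proof.
have [/andP[h1 h2] h3] := pihalf_02_cos_pihalf R; split; last by lra.
rewrite leNgt; apply/negP => p1; have := @cos_ge_half (pi / 2).
rewrite h3 ger0_norm// => /(_ _) h; have := h ltac:(lra).
by rewrite leNgt invr_gt0 ltr0n.
Qed.

Lemma cosDk2pi (x : R) k : cos (x + 2 * pi * k%:R) = cos x.
Proof.
elim: k => [|k IH]; first by rewrite mulr0 addr0.
rewrite -IH -[k.+1]addn1 natrD mulrDr mulr1 addrA.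
have -> : 2 * pi = pi *+ 2 :> R by rewrite mulr_natl.
exact: cosD2pi.
Qed.

Section teeth.
Variables (mu0 rho : R) (N : nat).
Hypotheses (rho01 : 0 < rho <= 1).

Let delta := 2 * pi / rho.
(** With j rho <= 4, the phase drifts by at most 1/4 inside a tooth of this length. *)
Let c : R := 16^-1.
Let I (n : nat) : set R := `[mu0 + n%:R * delta, mu0 + n%:R * delta + c]%classic.

Definition comb xi : R := \sum_(n < N) \1_(I n) xi.

Let rho0 : 0 < rho. Proof. by case/andP: rho01. Qed.
Let c0 : 0 < c. Proof. by rewrite invr_gt0. Qed.
Let d1 : 1 <= delta.
Proof.
have [p1 _] := pi_bounds; have /andP[_ r1] := rho01.
by rewrite /delta ler_pdivlMr// mul1r; lra.
Qed.

Let cd n : mu0 + n%:R * delta < mu0 + n%:R * delta + c. Proof. by rewrite ltrDl. Qed.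

Let comb_int : inversive comb /\ \int[mu]_xi comb xi = N%:R * c.
Proof.
rewrite /comb; elim: N => [|n [IH1 IH2]].
  have z : (fun xi : R => \sum_(n < 0) \1_(I n) xi : R) = (fun=> 0) by apply/funext => xi; rewrite big_ord0.
  rewrite z; split; first exact: inversive_0.
  transitivity (\int[mu]_xi (0 * (\1_(I 0) xi : R))); first by apply: i_eq => xi; rewrite mul0r.
  by rewrite iZ ?mul0r//; exact: L1_itv.
have E : (fun xi : R => \sum_(k < n.+1) \1_(I k) xi : R) = (fun xi => \sum_(k < n) \1_(I k) xi + 1 * \1_(I n) xi).
  by apply/funext => xi; rewrite big_ord_recr /= mul1r.
rewrite E; split; first exact: (inversive_lin 1 IH1 (inversive_itv (cd n))).
have [l _ _] := IH1; have [l' _ _] := inversive_itv (cd n).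
rewrite iD//; last exact: L1Z.
rewrite IH2 iZ// i_itv// -[n.+1]addn1 natrD; ring.
Qed.

Let comb01 xi : comb xi = 0 \/ comb xi = 1 /\ exists n u, [/\ (n < N)%N, 0 <= u <= c & xi = mu0 + n%:R * delta + u].
Proof.
have [[n In]|nI] := pselect (exists n : 'I_N, I n xi); last first.
  left; rewrite /comb big1// => n _; rewrite indicE memNset// => h.
  by apply: nI; exists n.
right; split.
  rewrite /comb (bigD1 n)//= big1 ?addr0; first by rewrite indicE mem_set.
  move=> k kn; rewrite indicE memNset// => Ik.
  move: In Ik; rewrite /I /= !in_itv /= => /andP[a1 a2] /andP[b1 b2].
  have cl1 : c < 1 by rewrite invf_lt1// ltr1n.
  have aux i j : (i < j)%N -> mu0 + j%:R * delta <= xi -> xi <= mu0 + i%:R * delta + c -> False.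
    move=> ij h1 h2; have h3 : i%:R + 1 <= j%:R :> R by rewrite natr1 ler_nat.
    have : (i%:R + 1) * delta <= j%:R * delta by rewrite ler_wpM2r// (le_trans _ d1).
    by have := d1; lra.
  have : (k != n :> nat) by exact: kn.
  by rewrite neq_ltn => /orP[kn'|kn']; [exact: (aux k n)|exact: (aux n k)].
exists n, (xi - (mu0 + n%:R * delta)); split => //; last by rewrite addrC subrK.
by move: In; rewrite /I /= in_itv /= subr_ge0 lerBlDl.
Qed.

(** Bounds the extent of the comb, by 2 pi <= 8 and a tooth shorter than 1. *)
Let eta_max := N%:R * 8 / rho + 1.

(** A slope j rho in eta advances the phase by 2 pi j from tooth to tooth, which the cosine ignores.
    The error 1/4 of the linear model and the drift 1/4 inside a tooth add up to 1/2. *)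
Lemma comb_hump (gamma s : R) (Gam : R -> R -> R) (lo L theta tau : R) :
  lo <= mu0 -> 0 <= mu0 -> (0 < N)%N ->
  (1 + (mu0 + eta_max) ^+ 2) `^ s * (16 * L) <= N%:R -> 0 < theta <= tau -> 0 < gamma ->
  (forall x, 1 <= x <= 2 -> exists t (j : nat), [/\ theta <= t <= tau, t `^ gamma * (mu0 + eta_max) ^+ 2 <= 1,
    j%:R * rho <= 4 &
    exists C, forall eta, 0 <= eta <= eta_max ->
      `|Gam x t * (mu0 + eta) + t * (mu0 + eta) ^+ 2 - (C + j%:R * rho * eta)| <= 4^-1]) ->
  hump gamma s Gam comb lo (mu0 + eta_max) L theta tau.
Proof.
move=> lom m0 N0 energy th g0 H; have [cinv cint] := comb_int.
have N0' : (0 : R) < N%:R by rewrite ltr0n.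
have inv n u : (n < N)%N -> 0 <= u <= c -> 0 <= n%:R * delta + u <= eta_max.
  move=> nN /andP[u0 uc]; have del0 : 0 <= delta by exact: le_trans d1.
  apply/andP; split; first exact: (addr_ge0 (mulr_ge0 (ler0n _ _) del0) u0).
  rewrite /eta_max; apply: lerD; last by apply: (le_trans uc); rewrite invf_le1// ler1n.
  rewrite -mulrA; apply: ler_pM => //; first by rewrite ler_nat ltnW.
  by rewrite /delta ler_wpM2r ?invr_ge0 ?(ltW rho0)//; have [_ p4] := pi_bounds; lra.
split => //.
- move=> xi; case: (comb01 xi) => [|[-> [n [u [nN uc ->]]]]]; [by left|right; split => //].
  by have /andP[h1 h2] := inv n u nN uc; rewrite -addrA (le_trans lom) ?lerDl//= lerD2l.
- by rewrite cint mulr_gt0.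
- by rewrite cint /c ler_pdivlMr// -mulrA (mulrC L).
split => //; move=> x hx; have [t [j [tt tg jr [C hC]]]] := H x hx.
exists t, C; split => // xi xi1; case: (comb01 xi) => [E|[_ [n [u [nN uc xiE]]]]].
  by move: xi1; rewrite E => /eqP; rewrite eq_sym oner_eq0.
have eta01 := inv n u nN uc; have /andP[eta0 eta1] := eta01.
have := hC _ eta01; rewrite addrA -xiE => hE; split; last first.
  apply: (le_trans _ tg); rewrite ler_wpM2l ?powR_ge0// xiE -addrA.
  by apply: sqr_le; [exact: (addr_ge0 m0 eta0)|rewrite lerD2l].
set e := _ - (C + _) in hE.
have /andP[u0 u1] := uc.
have -> : Gam x t * xi + t * xi ^+ 2 - C = (e + j%:R * rho * u) + 2 * pi * (j * n)%:R.
  by rewrite /e /delta natrM; field; rewrite gt_eqF.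
rewrite cosDk2pi; apply: cos_ge_half; apply: (le_trans (ler_normD _ _)).
have : `|j%:R * rho * u| <= 4^-1.
  rewrite ger0_norm ?mulr_ge0// ?(ltW rho0)//.
  apply: (@le_trans _ _ (4 * c)); last by rewrite /c; lra.
  by apply: ler_pM => //; rewrite mulr_ge0// ltW.
lra.
Qed.
End teeth.
End Comb.

(** * Combs for the two curves *)

Section Powers.
Variable R : realType.

Lemma pow_large (e C : R) : 0 < e -> exists N0 : nat, forall N, (N0 <= N)%N -> C <= N%:R `^ e.
Proof.
move=> e0; exists (Num.bound (`|C| `^ e^-1)) => N hN.
apply: (le_trans (ler_norm C)).
have -> : `|C| = (`|C| `^ e^-1) `^ e by rewrite -powRrM mulVf ?gt_eqF// powRr1.
apply: ge0_ler_powR; rewrite ?nnegrE ?powR_ge0 ?(ltW e0)//.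
apply: (@le_trans _ _ (Num.bound (`|C| `^ e^-1))%:R); last by rewrite ler_nat.
by apply/ltW/archi_boundP; exact: powR_ge0.
Qed.

Section x.
Variable n : R.
Hypothesis n1 : 1 <= n.

Lemma powD (a b : R) : n `^ (a + b) = n `^ a * n `^ b.
Proof. by rewrite powRD//; apply/implyP => _; rewrite gt_eqF// (lt_le_trans ltr01 n1). Qed.

Lemma pow_ge1 (a : R) : 0 <= a -> 1 <= n `^ a.
Proof. by move=> a0; have := ler_powR n1 a0; rewrite powRr0. Qed.

Lemma pow_gt0 (a : R) : 0 < n `^ a.
Proof. by rewrite powR_gt0// (lt_le_trans ltr01 n1). Qed.

Lemma pow_small (a C e : R) : C <= n `^ e -> a <= - e -> C * n `^ a <= 1.
Proof.
move=> Ce ae; have h : n `^ a <= n `^ (- e) by exact: ler_powR.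
have [C0|C0] := leP C 0.
  by apply: (@le_trans _ _ 0) => //; rewrite mulr_le0_ge0// ltW// pow_gt0.
apply: (@le_trans _ _ (n `^ e * n `^ (- e))); first by apply: ler_pM => //; rewrite ltW// pow_gt0.
by rewrite -powD addrN powRr0.
Qed.
End x.

(** A comb of n teeth has mass n/16 and its weight is of order n^(2 q s); the spare power n^e
    absorbs all constants. *)
Lemma energy_bound (n q Lam s A L e : R) : 1 <= n -> 0 <= s -> 0 <= Lam -> Lam ^+ 2 <= A * n `^ (2 * q) -> 0 <= q ->
  0 <= A -> 0 < L -> (1 + A) `^ s * (16 * L) <= n `^ e -> 2 * q * s <= 1 - e ->
  (1 + Lam ^+ 2) `^ s * (16 * L) <= n.
Proof.
move=> n1 s0 Lam0 hL q0 A0 L0 he hq.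
have Q1 := pow_ge1 n1 (_ : 0 <= 2 * q); have {}Q1 := Q1 ltac:(by rewrite mulr_ge0).
have h : (1 + Lam ^+ 2) `^ s <= (1 + A) `^ s * n `^ (2 * q * s).
  rewrite powRrM -powRM ?addr_ge0 ?powR_ge0//; apply: ge0_ler_powR; rewrite ?nnegrE//.
  - by rewrite addr_ge0 ?sqr_ge0.
  - by rewrite mulr_ge0 ?addr_ge0 ?powR_ge0.
  - by rewrite mulrDl mul1r lerD.
apply: (@le_trans _ _ ((1 + A) `^ s * n `^ (2 * q * s) * (16 * L))).
  by rewrite ler_wpM2r// mulr_ge0 ?(ltW L0).
rewrite mulrAC; apply: (@le_trans _ _ (n `^ e * n `^ (1 - e))).
  apply: ler_pM => //; rewrite ?mulr_ge0 ?powR_ge0 ?(ltW L0)//.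
  exact: ler_powR.
by rewrite -powD// addrC subrK powRr1// (le_trans ler01).
Qed.
End Powers.

Section Cases.
Variable R : realType.

Lemma grid (x rho : R) : 0 < rho <= 1 -> 1 <= x -> exists k : nat, (0 < k)%N /\ k%:R * rho <= x < k%:R * rho + rho.
Proof.
move=> /andP[r0 r1] x1; have xr : 0 <= x / rho by rewrite divr_ge0 ?(ltW r0)// (le_trans ler01).
have /andP[h1 h2] := truncn_itv xr; exists (Num.trunc (x / rho)); split.
  rewrite -(ltr_nat R); have : 1 <= x / rho by rewrite ler_pdivlMr// mul1r (le_trans r1).
  move=> h; have := le_lt_trans h h2; rewrite -[1]/(1%:R) ltr_nat ltnS => p.
  by rewrite ltr_nat.
rewrite -ler_pdivlMr// h1 /=; move: h2; rewrite ltr_pdivrMr// -[_.+1]addn1 natrD mulrDl mul1r.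
exact.
Qed.

(** Going one cell below the nearest grid point keeps the remainder at least rho, so that the
    resonant times are bounded below. *)
Lemma grid_below (x rho : R) : 0 < rho <= 1 -> 1 <= x <= 2 ->
  exists k : nat, rho <= x - k%:R * rho <= 2 * rho /\ k%:R * rho <= 4.
Proof.
move=> r01 /andP[x1 x2]; have [k [kp /andP[k1 k2]]] := grid r01 x1.
have /andP[r0 r1] := r01; exists k.-1.
have kE : k%:R = k.-1%:R + 1 :> R by rewrite natr1 prednK.
move: k1 k2; rewrite kE; move: (k.-1%:R) => z k1 k2.
by split; [apply/andP; split|]; lra.
Qed.

Lemma grid_above (x rho : R) : 0 < rho <= 1 -> 1 <= x <= 2 ->
  exists k : nat, rho <= k%:R * rho - x <= 2 * rho /\ k%:R * rho <= 4.
Proof.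
move=> r01 /andP[x1 x2]; have [k [kp /andP[k1 k2]]] := grid r01 x1.
have /andP[r0 r1] := r01; exists k.+2.
have -> : k.+2%:R = k%:R + 2 :> R by rewrite -addn2 natrD.
by split; [apply/andP; split|]; lra.
Qed.

(** The time t is of order rho^(1/alpha) = N^(- kap/alpha) and the frequencies are at most of order
    N^(1 + kap). The three inequalities on [kap] say in turn that t xi^2 is a small phase error,
    that t^gamma xi^2 is a harmless damping, and that the energy is small. *)
Lemma humps_tangential (alpha gamma s kap : R) : 0 < alpha -> 0 < gamma -> 0 <= s -> 0 < kap ->
  2 + 2 * kap < kap / alpha -> 2 + 2 * kap < kap / alpha * gamma -> 2 * s * (1 + kap) < 1 ->
  forall L tau lo : R, 0 < L -> 0 < tau -> exists h Lam theta,
    hump gamma s (fun x t => x - `|t| `^ alpha) h lo Lam L theta tau.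
Proof.
move=> al0 g0 s0 k0 E1 E2 E3 L tau lo L0 tau0.
pose mu0 := Num.max lo 1; pose a : R := 2 `^ alpha^-1.
have lom : lo <= mu0 by rewrite le_max lexx.
have m1 : 1 <= mu0 by rewrite le_max lexx orbT.
have a0 : 0 < a by exact: powR_gt0.
have d1 : 0 < kap / alpha - (2 + 2 * kap) by rewrite subr_gt0.
have d2 : 0 < kap / alpha * gamma - (2 + 2 * kap) by rewrite subr_gt0.
have d3 : 0 < 1 - 2 * s * (1 + kap) by rewrite subr_gt0.
have d4 : 0 < kap / alpha by rewrite divr_gt0.
have [N1 h1] := @pow_large R _ (4 * (a * 81)) d1.
have [N2 h2] := @pow_large R _ (a `^ gamma * 81) d2.
have [N3 h3] := @pow_large R _ ((1 + 81) `^ s * (16 * L)) d3.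
have [N4 h4] := @pow_large R _ (a / tau) d4.
have [N5 h5] := @pow_large R _ (mu0 + 1) (ltr01 : 0 < 1).
pose N := maxn (maxn (maxn N1 N2) (maxn N3 N4)) (maxn N5 1).
have {}h1 := h1 N ltac:(by rewrite /N !leq_max leqnn).
have {}h2 := h2 N ltac:(by rewrite /N !leq_max leqnn !orbT).
have {}h3 := h3 N ltac:(by rewrite /N !leq_max leqnn !orbT).
have {}h4 := h4 N ltac:(by rewrite /N !leq_max leqnn !orbT).
have {}h5 := h5 N ltac:(by rewrite /N !leq_max leqnn !orbT).
have N0 : (0 < N)%N by apply: leq_trans (leq_maxr _ _); exact: leq_maxr.
have n1 : 1 <= N%:R :> R by rewrite ler1n.
have [n nE] : exists n : R, n = N%:R by exists N%:R.
rewrite -nE in n1 h1 h2 h3 h4 h5.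
have n0 : 0 < n by exact: lt_le_trans n1.
rewrite powRr1 ?(ltW n0)// in h5.
pose rho := n `^ (- kap).
have rho0 : 0 < rho by exact: pow_gt0.
have rho1 : rho <= 1.
  by rewrite /rho powRN invf_le1 ?pow_gt0// pow_ge1// ltW.
have rr : rho <= 2 * rho by rewrite ler_peMl ?(ltW rho0)// ler1n.
have rho01 : 0 < rho <= 1 by rewrite rho0.
pose Q := n `^ (1 + kap).
have QE : n / rho = Q.
  by rewrite /rho powRN invrK /Q powD// powRr1// ltW.
have Qn : n <= Q.
  have : n `^ 1 <= Q by apply: ler_powR => //; rewrite lerDl ltW.
  by rewrite powRr1// ltW.
pose Lam := mu0 + (n * 8 / rho + 1).
have LamE : Lam = mu0 + (8 * Q + 1) by rewrite /Lam mulrAC QE mulrC.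
have Lam0 : 0 <= Lam by rewrite LamE !addr_ge0 ?mulr_ge0 ?powR_ge0// (le_trans ler01).
(* N is so large that mu0 + 1 <= N <= Q, hence Lam <= 9 Q. *)
have Lam2 : Lam ^+ 2 <= 81 * n `^ (2 * (1 + kap)).
  have -> : 81 * n `^ (2 * (1 + kap)) = (9 * Q) ^+ 2.
    have -> : 2 * (1 + kap) = (1 + kap) + (1 + kap) by ring.
    by rewrite powD// -/Q; move: Q {QE Qn LamE} => z; ring.
  by apply: sqr_le => //; rewrite LamE; lra.
pose T := (2 * rho) `^ alpha^-1.
have rp (r : R) : 0 <= r -> (r `^ alpha^-1) `^ alpha = r.
  by move=> r0; rewrite -powRrM mulVf ?gt_eqF// powRr1.
have TE : T = a * n `^ (- (kap / alpha)).
  by rewrite /T powRM// ?(ltW rho0)// /rho -powRrM mulNr.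
have T0 : 0 <= T by exact: powR_ge0.
have ph : T * Lam ^+ 2 <= 4^-1.
  apply: (@le_trans _ _ (T * (81 * n `^ (2 * (1 + kap))))); first by rewrite ler_wpM2l.
  have := pow_small n1 h1 (lexx _); rewrite opprB.
  rewrite (_ : 2 + 2 * kap - kap / alpha = - (kap / alpha) + 2 * (1 + kap)); last by ring.
  rewrite powD// TE; move: (n `^ _) (n `^ _) => z y.
  have -> : a * y * (81 * z) = 4^-1 * (4 * (a * 81) * (y * z)) by field.
  by move=> h; rewrite ler_piMr// invr_ge0.
have dm : T `^ gamma * Lam ^+ 2 <= 1.
  apply: (@le_trans _ _ (T `^ gamma * (81 * n `^ (2 * (1 + kap))))); first by rewrite ler_wpM2l ?powR_ge0.
  have := pow_small n1 h2 (lexx _); rewrite opprB.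
  rewrite (_ : 2 + 2 * kap - kap / alpha * gamma = - (kap / alpha) * gamma + 2 * (1 + kap)); last by ring.
  rewrite powD// TE powRM ?(ltW a0) ?powR_ge0// -powRrM.
  move: (n `^ _) (n `^ _) (a `^ gamma) => z y w.
  by rewrite (_ : w * y * (81 * z) = w * 81 * (y * z))//; ring.
exists (comb mu0 rho N), (mu0 + (N%:R * 8 / rho + 1)), (rho `^ alpha^-1).
have mono (u v : R) : 0 <= u -> u <= v -> u `^ alpha^-1 <= v `^ alpha^-1.
  by move=> u0 uv; apply: ge0_ler_powR; rewrite ?nnegrE ?invr_ge0 ?(ltW al0)// (le_trans u0).
have Ttau : T <= tau.
  rewrite TE powRN ler_pdivrMr ?pow_gt0// mulrC -ler_pdivrMr//.
apply: comb_hump => //.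
- exact: le_trans m1.
- rewrite -nE; apply: (energy_bound n1 s0 Lam0 Lam2 _ _ L0 h3) => //; first by rewrite addr_ge0// ltW.
  by rewrite le_eqVlt; apply/orP; left; apply/eqP; ring.
- by rewrite powR_gt0//=; apply: le_trans Ttau; apply: mono; [exact: ltW|exact: rr].
move=> x x12; have [k [/andP[r1 r2] k4]] := grid_below rho01 x12.
set r := x - k%:R * rho in r1 r2.
have r0 : 0 <= r by apply: le_trans r1; exact: ltW.
exists (r `^ alpha^-1), k; split.
- apply/andP; split; first by apply: mono => //; exact: ltW.
  by apply: le_trans Ttau; exact: mono.
- apply: le_trans dm; rewrite -nE -/Lam; apply: ler_wpM2r; first exact: sqr_ge0.
  apply: ge0_ler_powR; [exact: ltW|rewrite nnegrE; exact: powR_ge0|rewrite nnegrE; exact: powR_ge0|].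
  exact: mono.
- exact: k4.
exists (k%:R * rho * mu0) => eta; rewrite -nE => /andP[eta0 eta1].
rewrite (ger0_norm (powR_ge0 _ _)) (rp r r0).
have -> : (x - r) * (mu0 + eta) + r `^ alpha^-1 * (mu0 + eta) ^+ 2 - (k%:R * rho * mu0 + k%:R * rho * eta) = r `^ alpha^-1 * (mu0 + eta) ^+ 2.
  by rewrite /r; ring.
have me : 0 <= mu0 + eta by rewrite addr_ge0// (le_trans ler01).
rewrite (ger0_norm (mulr_ge0 (powR_ge0 _ _) (sqr_ge0 _))); apply: le_trans ph.
apply: ler_pM; [exact: powR_ge0|exact: sqr_ge0|exact: mono|].
by apply: (sqr_le me); rewrite lerD2l.
Qed.

(** Expanding x (mu + eta) + t (mu + eta)^2, the slope in eta is x + 2 t mu and the error t eta^2.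
    Here mu = N^m, t is of order rho / mu = N^(- kap - m) and eta at most of order N^(1 + kap), so
    the three inequalities control in turn the error, the damping and the energy. *)
Lemma humps_vertical (gamma s kap m : R) : 0 < gamma -> 0 <= s -> 0 < kap ->
  2 + kap < m -> 2 * m < (kap + m) * gamma -> 2 * s * m < 1 ->
  forall L tau lo : R, 0 < L -> 0 < tau -> exists h Lam theta,
    hump gamma s (fun x _ => x) h lo Lam L theta tau.
Proof.
move=> g0 s0 k0 E1 E2 E3 L tau lo L0 tau0.
have d1 : 0 < m - (2 + kap) by rewrite subr_gt0.
have d2 : 0 < (kap + m) * gamma - 2 * m by rewrite subr_gt0.
have d3 : 0 < 1 - 2 * s * m by rewrite subr_gt0.
have m0 : 0 < m by lra.
have d4 : 0 < kap + m by lra.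
have [N1 h1] := @pow_large R _ (4 * 81) d1.
have [N2 h2] := @pow_large R _ 100 d2.
have [N3 h3] := @pow_large R _ ((1 + 100) `^ s * (16 * L)) d3.
have [N4 h4] := @pow_large R _ tau^-1 d4.
have [N5 h5] := @pow_large R _ lo m0.
pose N := maxn (maxn (maxn N1 N2) (maxn N3 N4)) (maxn N5 1).
have {}h1 := h1 N ltac:(by rewrite /N !leq_max leqnn).
have {}h2 := h2 N ltac:(by rewrite /N !leq_max leqnn !orbT).
have {}h3 := h3 N ltac:(by rewrite /N !leq_max leqnn !orbT).
have {}h4 := h4 N ltac:(by rewrite /N !leq_max leqnn !orbT).
have {}h5 := h5 N ltac:(by rewrite /N !leq_max leqnn !orbT).
have N0 : (0 < N)%N by apply: leq_trans (leq_maxr _ _); exact: leq_maxr.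
have n1 : 1 <= N%:R :> R by rewrite ler1n.
have [n nE] : exists n : R, n = N%:R by exists N%:R.
rewrite -nE in n1 h1 h2 h3 h4 h5.
have n0 : 0 < n by exact: lt_le_trans n1.
pose mu0 := n `^ m; have mu1 : 1 <= mu0 by apply: pow_ge1 => //; exact: ltW.
have mu00 : 0 < mu0 by exact: lt_le_trans mu1.
pose rho := n `^ (- kap).
have rho0 : 0 < rho by exact: pow_gt0.
have rho1 : rho <= 1 by rewrite /rho powRN invf_le1 ?pow_gt0// pow_ge1// ltW.
have rho01 : 0 < rho <= 1 by rewrite rho0.
pose Q := n `^ (1 + kap).
have QE : n / rho = Q by rewrite /rho powRN invrK /Q powD// powRr1// ltW.
have Q1 : 1 <= Q by apply: pow_ge1 => //; lra.
have Qm : Q <= mu0 by apply: ler_powR => //; lra.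
have etaE : n * 8 / rho + 1 = 8 * Q + 1 by rewrite mulrAC QE mulrC.
pose Lam := mu0 + (n * 8 / rho + 1).
have Lam0 : 0 <= Lam by rewrite /Lam etaE; lra.
have Lam2 : Lam ^+ 2 <= 100 * n `^ (2 * m).
  have -> : 100 * n `^ (2 * m) = (10 * mu0) ^+ 2.
    have -> : 2 * m = m + m by ring.
    by rewrite powD// -/mu0; move: mu0 {mu1 mu00 Qm Lam Lam0} => z; ring.
  by apply: sqr_le => //; rewrite /Lam etaE; lra.
pose T := rho / mu0.
have TE : T = n `^ (- (kap + m)).
  by rewrite opprD powD// -/rho powRN.
have T0 : 0 <= T by rewrite TE powR_ge0.
have ph : T * (8 * Q + 1) ^+ 2 <= 4^-1.
  apply: (@le_trans _ _ (T * (9 * Q) ^+ 2)).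
    rewrite ler_wpM2l//; apply: sqr_le; first by rewrite addr_ge0// mulr_ge0// (le_trans ler01).
    by rewrite (_ : 9 * Q = 8 * Q + Q) ?lerD2l//; ring.
  have := pow_small n1 h1 (lexx _); rewrite opprB.
  rewrite (_ : 2 + kap - m = - (kap + m) + ((1 + kap) + (1 + kap))); last by ring.
  rewrite powD// -TE (powD n1 (1 + kap)) -/Q; move: T Q {T0 TE QE Q1 Qm etaE Lam Lam0 Lam2} => y z.
  have -> : y * (9 * z) ^+ 2 = 4^-1 * (4 * 81 * (y * (z * z))) by field.
  by move=> h; rewrite ler_piMr// invr_ge0.
have dm : T `^ gamma * Lam ^+ 2 <= 1.
  apply: (@le_trans _ _ (T `^ gamma * (100 * n `^ (2 * m)))); first by rewrite ler_wpM2l ?powR_ge0.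
  have := pow_small n1 h2 (lexx _); rewrite opprB.
  rewrite (_ : 2 * m - (kap + m) * gamma = - (kap + m) * gamma + 2 * m); last by ring.
  rewrite powD// TE -powRrM.
  move: (n `^ _) (n `^ _) => z y.
  by rewrite (_ : y * (100 * z) = 100 * (y * z))//; ring.
have Ttau : T <= tau.
  by rewrite TE powRN -[leRHS]invrK lef_pV2 ?posrE ?invr_gt0 ?pow_gt0.
exists (comb mu0 rho N), (mu0 + (N%:R * 8 / rho + 1)), (T / 2).
have Tp : 0 < T by rewrite TE pow_gt0.
apply: comb_hump => //.
- exact: ltW.
- rewrite -nE; apply: (energy_bound n1 s0 Lam0 Lam2 _ _ L0 h3) => //; first exact: ltW.
  by rewrite le_eqVlt; apply/orP; left; apply/eqP; ring.
- by rewrite divr_gt0//= (le_trans _ Ttau)// ler_pdivrMr// ler_peMr// ler1n.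
move=> x x12; have [k [/andP[k1 k2] k4]] := grid_above rho01 x12.
pose t := (k%:R * rho - x) / (2 * mu0).
have t2 : t <= T.
  by rewrite /t /T ler_pdivrMr ?mulr_gt0// (_ : rho / mu0 * (2 * mu0) = 2 * rho); last by field; rewrite gt_eqF.
have t1 : T / 2 <= t.
  by rewrite /t /T ler_pdivlMr ?mulr_gt0// (_ : rho / mu0 / 2 * (2 * mu0) = rho); last by field; rewrite gt_eqF.
have t0 : 0 <= t by apply: le_trans t1; rewrite divr_ge0.
have tx : x + 2 * t * mu0 = k%:R * rho.
  by rewrite /t; field; rewrite gt_eqF.
exists t, k; split.
- by rewrite t1 (le_trans t2).
- apply: le_trans dm; rewrite -nE -/Lam ler_wpM2r ?sqr_ge0//.
  by apply: ge0_ler_powR; rewrite ?nnegrE ?(ltW g0).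
- exact: k4.
exists (x * mu0 + t * mu0 ^+ 2) => eta; rewrite -nE etaE => /andP[eta0 eta1].
rewrite -tx (_ : _ - _ = t * eta ^+ 2); last by ring.
rewrite (ger0_norm (mulr_ge0 t0 (sqr_ge0 _))); apply: le_trans ph.
by apply: (ler_pM t0 (sqr_ge0 _) t2); exact: sqr_le.
Qed.
End Cases.

(** * The extremal curves *)

Section Curves.
Variable R : realType.

(** A ratio in [0, 1] is at most its a-th power; apply this to u / (u + v) and v / (u + v) and
    add. *)
Lemma powR_subadd (a u v : R) : 0 < a <= 1 -> 0 <= u -> 0 <= v -> (u + v) `^ a <= u `^ a + v `^ a.
Proof.
move=> /andP[a0 a1] u0 v0; have [uv0|uv] := leP (u + v) 0.
  have -> : u + v = 0 by apply/eqP; rewrite eq_le uv0 addr_ge0.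
  by rewrite powR0 ?gt_eqF// addr_ge0 ?powR_ge0.
have frac y : 0 <= y -> y <= u + v -> y / (u + v) * (u + v) `^ a <= y `^ a.
  rewrite le_eqVlt => /orP[/eqP<-|y0] yuv; first by rewrite !mul0r powR_ge0.
  rewrite (powR_pos_ln _ uv) (powR_pos_ln _ y0).
  have -> : y / (u + v) = expR (ln y - ln (u + v)) by rewrite -lnDp// lnK// posrE divr_gt0.
  rewrite -expRD ler_expR; have : ln y <= ln (u + v) by rewrite ler_ln ?posrE.
  move=> h; have : a * (ln (u + v) - ln y) <= 1 * (ln (u + v) - ln y) by rewrite ler_wpM2r// subr_ge0.
  by move: (ln y) (ln (u + v)) => p q; lra.
apply: le_trans (lerD (frac u u0 _) (frac v v0 _)); rewrite ?lerDl ?lerDr//.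
by rewrite -mulrDl -mulrDl divff ?gt_eqF// mul1r.
Qed.

Lemma powR_hoelder (a u v : R) : 0 < a <= 1 -> 0 <= u -> 0 <= v -> `|u `^ a - v `^ a| <= `|u - v| `^ a.
Proof.
move=> a01; have /andP[a0 _] := a01; wlog uv : u v / v <= u.
  move=> h u0 v0; case/orP: (le_total v u) => uv; first exact: h.
  by rewrite distrC (distrC u); exact: h.
move=> u0 v0; rewrite ger0_norm; last first.
  by rewrite subr_ge0; apply: ge0_ler_powR; rewrite ?nnegrE ?(ltW a0).
rewrite ger0_norm ?subr_ge0// lerBlDr.
by have := powR_subadd a01 (_ : 0 <= u - v) v0; rewrite subrK subr_ge0; exact.
Qed.

Lemma admissible_id (alpha : R) : admissible alpha (fun x _ : R => x).
Proof.
split; first by apply: continuous_subspaceT => p; exact: cvg_fst.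
split=> //; exists 1, 1, 1; do 3!split=> //; split.
  by move=> t x x' _; rewrite mul1r lexx.
by move=> x t t' _ _; rewrite subrr normr0 mul1r powR_ge0.
Qed.

Lemma admissible_tangential (alpha : R) : 0 < alpha <= 1 -> admissible alpha (fun x t : R => x - `|t| `^ alpha).
Proof.
move=> a01; have /andP[a0 _] := a01.
have hol (t t' : R) : `| `|t| `^ alpha - `|t'| `^ alpha| <= `|t - t'| `^ alpha.
  apply: (le_trans (powR_hoelder a01 _ _)) => //.
  apply: ge0_ler_powR; rewrite ?nnegrE ?(ltW a0)//; exact: ler_dist_dist.
have cont : continuous (fun t : R => `|t| `^ alpha).
  move=> t; apply/cvgrPdist_le => e e0; near=> t'.
  apply: (le_trans (hol t t')).
  have -> : e = (e `^ alpha^-1) `^ alpha by rewrite -powRrM mulVf ?gt_eqF// powRr1// ltW.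
  apply: ge0_ler_powR; rewrite ?nnegrE ?powR_ge0 ?(ltW a0)//.
  near: t'; apply: cvgr_dist_le; first exact: cvg_id.
  exact: powR_gt0.
split.
  apply: continuous_subspaceT => p; apply: cvgB; first exact: cvg_fst.
  apply: (@continuous_cvg _ _ _ _ _ (fun p : R * R => p.2) (fun t => `|t| `^ alpha)); first exact: cont.
  exact: cvg_snd.
split; first by move=> x; rewrite normr0 powR0 ?gt_eqF// subr0.
exists 1, 1, 1; do 3!split=> //; split.
  by move=> t x x' _; rewrite mul1r (_ : _ - _ = x - x') ?lexx//; ring.
move=> x t t' _ _; rewrite mul1r (_ : x - `|t| `^ alpha - (x - `|t'| `^ alpha) = - (`|t| `^ alpha - `|t'| `^ alpha)); last by ring.
by rewrite normrN; exact: hol.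
Unshelve. all: by end_near. Qed.

Lemma exponent_between (s k0 : R) : 0 <= s -> s < 2^-1 -> 2 * s * k0 < 1 -> exists2 k, k0 < k & 2 * s * k < 1.
Proof.
move=> s0 s1 h; exists (k0 + (1 - 2 * s * k0) / 2); first by lra.
have : 2 * s * ((1 - 2 * s * k0) / 2) <= 1 * ((1 - 2 * s * k0) / 2) by rewrite ler_wpM2r; lra.
by rewrite mulrDr; lra.
Qed.

(** With k = 1 + kap and g = min(gamma, 1), the phase and damping conditions both follow from 2
    alpha k < (k - 1) g, that is k > g / (g - 2 alpha). The energy condition 2 s k < 1 leaves room
    for such k exactly when s < 1/2 - alpha / g. *)
Lemma counter_tangential (alpha gamma s : R) : 0 < alpha < 2^-1 -> 2 * alpha < gamma ->
  0 <= s -> s < 2^-1 - alpha / gmin gamma ->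
  exists f1 f2 g1 g2, in_Hs s f1 f2 g1 g2 /\ ~ ae_conv gamma (fun x t => x - `|t| `^ alpha) f1 f2 g1 g2.
Proof.
move=> /andP[a0 a1] ag s0 ss.
have g0 : 0 < gamma by lra.
have m0 : 0 < gmin gamma by exact: gmin_gt0.
have m1 : gmin gamma <= 1 by rewrite /gmin ge_min lexx orbT.
have mg : gmin gamma <= gamma by rewrite /gmin ge_min lexx.
have ma : 2 * alpha < gmin gamma by rewrite /gmin lt_min ag; lra.
have d0 : 0 < gmin gamma - 2 * alpha by rewrite subr_gt0.
have ag0 : 0 < alpha / gmin gamma by rewrite divr_gt0.
have [|||k k0 k1] := @exponent_between s (gmin gamma / (gmin gamma - 2 * alpha)).
- exact: s0.
- lra.
- rewrite mulrA ltr_pdivrMr// mul1r.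
  have : s * gmin gamma < (2^-1 - alpha / gmin gamma) * gmin gamma by rewrite ltr_pM2r.
  by rewrite mulrBl divfK ?gt_eqF//; lra.
have kd : gmin gamma < k * (gmin gamma - 2 * alpha) by rewrite -ltr_pdivrMr.
have kp : 2 * alpha < (k - 1) * (gmin gamma - 2 * alpha) by lra.
have k10 : 0 < k - 1 by rewrite -(pmulr_lgt0 _ d0); lra.
have c1 : 2 + 2 * (k - 1) < (k - 1) / alpha.
  rewrite ltr_pdivlMr//.
  have : (k - 1) * gmin gamma <= (k - 1) * 1 by rewrite ler_pM2l.
  lra.
have c2 : 2 + 2 * (k - 1) < (k - 1) / alpha * gamma.
  rewrite mulrAC ltr_pdivlMr//.
  have : (k - 1) * gmin gamma <= (k - 1) * gamma by rewrite ler_pM2l.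
  lra.
apply: (humps_diverge g0 s0); apply: (humps_tangential a0 g0 s0 k10 c1 c2).
by rewrite addrC subrK.
Qed.

(** A positive kap must fit between z = (2 - gamma) m / gamma and m - 2. This is possible as soon as
    m exceeds 2 and gamma / (gamma - 1), and 2 s m < 1 then gives the two bounds on s. *)
Lemma counter_vertical (gamma s : R) : 1 < gamma -> 0 <= s -> s < 4^-1 -> 2 * s < 1 - gamma^-1 ->
  exists f1 f2 g1 g2, in_Hs s f1 f2 g1 g2 /\ ~ ae_conv gamma (fun x _ => x) f1 f2 g1 g2.
Proof.
move=> g1 s0 s4 sg; have g0 : 0 < gamma by lra.
have d0 : 0 < gamma - 1 by rewrite subr_gt0.
pose m0 := Num.max 2 (gamma / (gamma - 1)).
have [|||m mm sm] := @exponent_between s m0.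
- exact: s0.
- lra.
- rewrite /m0; case: (leP 2 (gamma / (gamma - 1))) => _; last by lra.
  rewrite mulrA ltr_pdivrMr// mul1r.
  have : 2 * s * gamma < (1 - gamma^-1) * gamma by rewrite ltr_pM2r.
  by rewrite mulrBl mulVf ?gt_eqF// mul1r.
have [m2 mg] : 2 < m /\ gamma / (gamma - 1) < m by move: mm; rewrite /m0 gt_max => /andP[].
rewrite ltr_pdivrMr// in mg.
pose z := (2 - gamma) * m / gamma.
have zE : z * gamma = (2 - gamma) * m by rewrite /z divfK// gt_eqF.
have zm : z < m - 2.
  by rewrite -(ltr_pM2r g0) zE; lra.
pose k := (Num.max 0 z + (m - 2)) / 2.
have [mx1 mx2] : 0 <= Num.max 0 z /\ z <= Num.max 0 z by rewrite !le_max !lexx orbT.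
have mx3 : Num.max 0 z < m - 2 by rewrite gt_max zm andbT; lra.
have k0 : 0 < k by rewrite /k; lra.
have km : 2 + k < m by rewrite /k; lra.
have kz : z < k by rewrite /k; lra.
have kg : 2 * m < (k + m) * gamma.
  by rewrite -(ltr_pM2r g0) zE in kz; lra.
exact: (humps_diverge g0 s0 (humps_vertical g0 s0 k0 km kg sm)).
Qed.
End Curves.

(** For 2 alpha <= gamma < 1/(2 alpha) the tangential term of the threshold is the larger one, and
    the curve x - |t|^alpha is taken; otherwise the vertical line. *)
Theorem theorem3 (R : realType) (gamma alpha : R) :
  0 < gamma -> 4^-1 < alpha < 2^-1 ->
  (forall Gam : R -> R -> R, admissible alpha Gam ->
     forall s : R, s_crit alpha gamma < s ->
     forall fre fim gre gim : R -> R, in_Hs s fre fim gre gim ->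
       ae_conv gamma Gam fre fim gre gim) /\
  (exists Gam : R -> R -> R, admissible alpha Gam /\
     forall s : R, 0 <= s -> s < s_crit alpha gamma ->
     exists fre fim gre gim : R -> R, in_Hs s fre fim gre gim /\
       ~ ae_conv gamma Gam fre fim gre gim).
Proof.
move=> g0 al01; have /andP[a1 a2] := al01; split.
  by move=> Gam adm s ss f1 f2 g1 g2 H; exact: (positive_part g0 al01 adm ss H).
have a0 : 0 < alpha by lra.
have V0 : 0 < gamma^-1 by rewrite invr_gt0.
have [h1|h1] := ltP gamma (2 * alpha).
  exists (fun x _ => x); split; first exact: admissible_id.
  by move=> s s0; rewrite /s_crit h1 => /(le_lt_trans s0); rewrite ltxx.
have b1 : (gamma < 2 * alpha) = false by rewrite ltNge h1.
have [h2|h2] := ltP gamma (2 * alpha)^-1.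
  exists (fun x t => x - `|t| `^ alpha); split; first by apply: admissible_tangential; lra.
  move=> s s0 ss.
  have sg : s < 2^-1 - alpha / gmin gamma.
    move: ss; rewrite /s_crit b1 h2 /gmin; case: (ltP gamma 1) => // h.
    by rewrite divr1.
  (* At gamma = 2 alpha the threshold is 0, which contradicts 0 <= s < 0. *)
  have ag : 2 * alpha < gamma.
    rewrite lt_neqAle h1 andbT; apply/eqP => E.
    have gm : gmin gamma = gamma by rewrite /gmin min_l// -E; lra.
    move: sg; rewrite gm -E invfM mulrCA divff ?gt_eqF// mulr1 subrr.
    by rewrite ltNge s0.
  by apply: counter_tangential => //; rewrite a0.
exists (fun x _ => x); split; first exact: admissible_id.
move=> s s0 ss.
have V2 : gamma^-1 <= 2 * alpha by rewrite -[leRHS]invrK lef_pV2 ?posrE// invr_gt0; lra.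
have g1 : 1 < gamma.
  by rewrite -[ltLHS]invr1 -[ltRHS]invrK ltf_pV2 ?posrE//; lra.
have h3 : (gamma < 1) = false by rewrite ltNge (ltW g1).
have b2 : (gamma < (2 * alpha)^-1) = false by rewrite ltNge h2.
move: ss; rewrite /s_crit b1 h3 b2; case: (ltP gamma 2) => h4 ss.
  have V3 : 2^-1 < gamma^-1 by rewrite ltf_pV2 ?posrE//.
  by apply: counter_vertical => //; lra.
have V3 : gamma^-1 <= 2^-1 by rewrite lef_pV2 ?posrE//.
by apply: counter_vertical => //; lra.
Qed.
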